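(* If $G$ is any graph with $q(G)\ge |G|-1$ except for $P_4$, $P_5$ and $T_{2,2}$, then $q(G)+q(G^c)\le |G|+2$.
   Context: All graphs are finite, undirected and simple; isomorphic graphs are identified; $|G|$ is the number of vertices of $G$, and $G^c$ is the complement of $G$. For a graph $G$ with vertex set $\{1,\dots,n\}$, $S(G)$ is the set of all real symmetric $n\times n$ matrices $A=(a_{ij})$ such that for $i\ne j$, $a_{ij}\neq 0$ if and only if $\{i,j\}$ is an edge of $G$ (no restriction on the diagonal). $q(A)$ is the number of distinct eigenvalues of $A$, and $q(G)=\min\{q(A): A\in S(G)\}$. $P_n$ is the path on $n$ vertices. $T_{2,2}$ is the graph on $5$ vertices obtained from the path with vertices $1,2,3,4,5$ in order by adding the edge $\{2,4\}$. *)

(* Defs.v *)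
From HB Require Import structures.
From mathcomp Require Import all_boot all_order all_algebra.
From mathcomp Require Import finmap boolp classical_sets cardinality reals.
Set Implicit Arguments.
Unset Strict Implicit.
Unset Printing Implicit Defensive.

Import Order.TTheory GRing.Theory Num.Theory.

Local Open Scope ring_scope.

(* Simple graphs are taken on the vertex set 'I_n = {0, ..., n-1}; up to
   isomorphism these are all the finite simple graphs. *)
Record graph (n : nat) := Graph {
  adj :> rel 'I_n;
  adj_sym : symmetric adj;
  adj_irrefl : irreflexive adj }.

Definition giso (m n : nat) (G : graph m) (H : graph n) : Prop :=
  exists2 f : 'I_m -> 'I_n, bijective f & forall i j, H (f i) (f j) = G i j.

Section Complement.
Variables (n : nat) (G : graph n).

Definition compl_rel : rel 'I_n := fun i j => (i != j) && ~~ G i j.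

Lemma compl_rel_sym : symmetric compl_rel.
Proof. by move=> i j; rewrite /compl_rel eq_sym adj_sym. Qed.

Lemma compl_rel_irrefl : irreflexive compl_rel.
Proof. by move=> i; rewrite /compl_rel eqxx. Qed.

Definition gcompl : graph n := Graph compl_rel_sym compl_rel_irrefl.

End Complement.

Section PathGraph.
Variable n : nat.

Definition path_rel : rel 'I_n := fun i j => (i.+1 == j :> nat) || (j.+1 == i :> nat).

Lemma path_rel_sym : symmetric path_rel.
Proof. by move=> i j; rewrite /path_rel orbC. Qed.

Lemma path_rel_irrefl : irreflexive path_rel.
Proof. by move=> i; rewrite /path_rel orbb gtn_eqF. Qed.

Definition path_graph : graph n := Graph path_rel_sym path_rel_irrefl.

End PathGraph.

(* Vertices are numbered from 0, so the edge {2,4} added to the path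
   1-2-3-4-5 is the pair {1,3} here. *)
Definition T22_rel : rel 'I_5 := fun i j =>
  [|| path_graph 5 i j,
      (i == 1 :> nat) && (j == 3 :> nat) |
      (i == 3 :> nat) && (j == 1 :> nat)]%N.

Lemma T22_rel_sym : symmetric T22_rel.
Proof.
by move=> i j; rewrite /T22_rel adj_sym; congr orb; rewrite orbC andbC [X in _ || X]andbC.
Qed.

Lemma T22_rel_irrefl : irreflexive T22_rel.
Proof. by move=> i; rewrite /T22_rel adj_irrefl; case: i => [[|[|[|[|]]]]]. Qed.

Definition T22 : graph 5 := Graph T22_rel_sym T22_rel_irrefl.

Section DistinctEigenvalues.
Variable R : realType.

Definition in_S (n : nat) (G : graph n) (A : 'M[R]_n) : Prop :=
  A^T = A /\ forall i j, i != j -> (A i j != 0) = G i j.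

Definition eigenvalues (n : nat) (A : 'M[R]_n) : set R :=
  [set a | eigenvalue A a]%classic.

(* [fset_set] is the empty set on infinite sets; this never happens here. *)
Lemma finite_eigenvalues (n : nat) (A : 'M[R]_n) : finite_set (eigenvalues A).
Proof.
apply: contrapT => /(infinite_set_fset n.+1) [B sB szB].
suff : (size (enum_fset B) < size (char_poly A))%N by rewrite size_char_poly ltnNge szB.
apply: max_poly_roots; last exact: fset_uniq.
  exact: monic_neq0 (char_poly_monic A).
by apply/allP => a /sB /=; rewrite -eigenvalue_root_char.
Qed.

Definition q_mx (n : nat) (A : 'M[R]_n) : nat := #|` fset_set (eigenvalues A) |.

Definition q_attained (n : nat) (G : graph n) : pred nat :=
  fun k => `[< exists2 A : 'M[R]_n, in_S G A & q_mx A = k >].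

Lemma q_attained_ex (n : nat) (G : graph n) : exists k, q_attained G k.
Proof.
pose A : 'M[R]_n := \matrix_(i, j) (G i j)%:R.
exists (q_mx A); apply/asboolP; exists A => //; split.
  by apply/matrixP => i j; rewrite !mxE adj_sym.
by move=> i j _; rewrite mxE pnatr_eq0 eqb0 negbK.
Qed.

Definition q (n : nat) (G : graph n) : nat := ex_minn (q_attained_ex G).

End DistinctEigenvalues.

(* Main.v *)
Require Import Defs.
From mathcomp Require Import all_boot all_order all_algebra.
From mathcomp Require Import finmap.
From mathcomp Require boolp classical_sets cardinality.
From mathcomp Require Import reals.
From mathcomp Require Import spectral complex.
From mathcomp Require Import zify ring lra.

Set Implicit Arguments.
Unset Strict Implicit.
Unset Printing Implicit Defensive.

Import Order.TTheory GRing.Theory Num.Theory.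

Local Open Scope ring_scope.

(** The proof has two halves, one about G and one about its complement.

    If q(G) >= n - 1, then G is nearly a path (near_path_dichotomy): deleting a suitable
    vertex z leaves an induced path, and z has no neighbour, one neighbour or two
    consecutive neighbours on it. The eigenspaces of a symmetric matrix are independent, so
    q(G) <= n - 2 follows once some matrix in S(G) has an eigenvalue of multiplicity three
    or two eigenvalues of multiplicity two. The second option has a flexible form
    (q_two_diagonals): it is enough to have two matrices of nullity two in S(G) that differ
    by a positive diagonal matrix D, since conjugation with the inverse square root of D
    turns their kernels into two eigenspaces of one matrix.

    Such matrices are assembled around a vertex v: blocks on the components of G - v, mostly
    Laplacians, bordered by one row and column for v. This works if G - v has four
    components, or three components that each have an edge. It also works if G - v splits
    into two good parts, or into a good part and two others (q_two_good, q_good_two_parts);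
    a part is good if it carries a singular block with the attachment vector of v in its
    range. The main construction (q_same_colour) excludes two neighbours of v that lie in
    one component and have the same colour in a 2-colouring whose bichromatic edges connect
    the component. Weight the bichromatic edges by 1 and the others by a small constant. The
    Laplacian with a positive kernel vector is then positive semidefinite, the Laplacian
    with the vector of signs in its kernel is negative semidefinite, and the two differ by a
    positive diagonal matrix (coloring_pair). A variant glues two such pairs across a bridge
    (q_bridge). Hence a component of G - v contains at most two neighbours of v, and a
    second one forces a triangle of a very special shape (loop_near_path). Otherwise G is a
    forest, and then a path or a spider with a leg of length one (three_parts_near_path).

    For the complement, attach to the vertices of G vectors w_i of a three-dimensional space
    with w_i orthogonal to w_j exactly when i and j are adjacent in G. For positive weights
    c_i, the Gram matrix of the vectors sqrt(c_i) w_i lies in S(G^c), and its nonzero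
    eigenvalues are those of the 3 x 3 matrix sum_i c_i w_i w_i^T (frame_spectrum). If that
    matrix is scalar, then q(G^c) <= 2. For n >= 7 this is always possible (q_compl_large):
    six explicit vectors realise a path, the identity is a positive combination of their
    squares, and these squares form a basis of the symmetric forms. So further vectors, in
    general position, can be added with a small weight. For n <= 6 there are explicit
    vectors or explicit matrices, which give q(G^c) <= 2, q(G^c) <= 3 or q(G^c) <= n - 2.
    They are combined with q(G) <= n, or with q(G) <= n - 1, which holds unless G is a path
    (q_modelled_lt). The remaining near paths are the excluded graphs P_4, P_5 and T_{2,2}. *)

(** * Multiplicities of eigenvalues *)

Section Spectrum.
Variable R : realType.
Variable n : nat.
Implicit Types (A S : 'M[R]_n) (G : graph n).

Lemma q_le_q_mx G A : in_S G A -> (q R G <= q_mx A)%N.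
Proof.
by move=> GA; rewrite /q; case: ex_minnP => m _; apply; apply/boolp.asboolP; exists A.
Qed.

Lemma mem_spectrum A a :
  (a \in cardinality.fset_set (eigenvalues A)) = eigenvalue A a.
Proof. by rewrite cardinality.in_fset_set ?classical_sets.mem_setE//; exact: finite_eigenvalues. Qed.

Lemma q_mx_le_size A (s : seq R) :
  (forall a, eigenvalue A a -> a \in s) -> (q_mx A <= size s)%N.
Proof.
move=> As; rewrite /q_mx; apply: uniq_leq_size; first exact: finmap.fset_uniq.
by move=> a /[!mem_spectrum]; exact: As.
Qed.

Lemma sum_rank_eigenspace A :
  (\sum_(a <- cardinality.fset_set (eigenvalues A)) \rank (eigenspace A a) <= n)%N.
Proof.
set e : seq R := cardinality.fset_set _.
have ue : uniq e by exact: finmap.fset_uniq.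
rewrite (big_nth 0) big_mkord.
have /mxdirectP/= <- : mxdirect (\sum_(i < size e) eigenspace A e`_i).
  by apply: mxdirect_sum_eigenspace => i j _ _ /eqP; rewrite nth_uniq// => /eqP/val_inj.
exact: rank_leq_row.
Qed.

(** The eigenspaces are independent, so their dimensions add up to at most n. Hence an
    eigenvalue of multiplicity m wastes m - 1 of the n possible distinct values. *)
Lemma q_mx_excess A (s : seq R) : uniq s ->
  (q_mx A + \sum_(a <- s) (\rank (eigenspace A a)).-1 <= n)%N.
Proof.
move=> us; apply: leq_trans (sum_rank_eigenspace A).
set e : seq R := cardinality.fset_set _.
have ue : uniq e by exact: finmap.fset_uniq.
rewrite (_ : q_mx A = \sum_(a <- e) 1)%N; last by rewrite sum1_size.
have posE a : (0 < \rank (eigenspace A a))%N = (a \in e).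
  by rewrite mem_spectrum lt0n mxrank_eq0.
have -> : (\sum_(a <- s) (\rank (eigenspace A a)).-1
         = \sum_(a <- [seq x <- s | x \in e]) (\rank (eigenspace A a)).-1)%N.
  rewrite big_filter [RHS]big_mkcond; apply: eq_bigr => a _.
  by case: ifP => //; rewrite -posE lt0n => /negbFE/eqP ->.
have pse : perm_eq [seq x <- s | x \in e] [seq x <- e | x \in s].
  apply: uniq_perm; rewrite ?filter_uniq// => a.
  by rewrite !mem_filter andbC.
rewrite (perm_big _ pse) /= {pse}.
rewrite big_filter [X in (_ + X <= _)%N]big_mkcond -big_split /=.
rewrite big_seq [X in (_ <= X)%N]big_seq; apply: leq_sum => a.
rewrite -posE => a_gt0; case: ifP => _; first by rewrite add1n prednK.
by rewrite addn0.
Qed.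

Lemma kermx_eigenspace S : kermx S = eigenspace S 0.
Proof. by rewrite /eigenspace raddf0 subr0. Qed.

Lemma q_nullity G S k : in_S G S -> (k < \rank (kermx S))%N -> (q R G + k <= n)%N.
Proof.
move=> GS kS; have := q_mx_excess S (s := [:: 0]) isT.
rewrite big_seq1 -kermx_eigenspace.
have := q_le_q_mx GS; move: kS; lia.
Qed.

Lemma q_two_nullities G S a : in_S G S -> a != 0 -> (1 < \rank (kermx S))%N ->
  (1 < \rank (eigenspace S a))%N -> (q R G + 2 <= n)%N.
Proof.
move=> GS a0 r0 ra.
have us : uniq [:: 0; a] by rewrite /= inE eq_sym a0.
have := q_mx_excess S us.
rewrite big_cons big_seq1 -kermx_eigenspace.
have := q_le_q_mx GS; move: r0 ra; lia.
Qed.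

(** A triangular certificate of linear independence: the coordinate attached to a vector
    vanishes on all later vectors. *)
Fixpoint pivoted (us : seq ('rV[R]_n * 'I_n)) : Prop :=
  if us is (u, i) :: us' then
    [/\ u 0 i != 0, (forall w j, (w, j) \in us' -> w 0 i = 0) & pivoted us']
  else True.

Definition stack (us : seq ('rV[R]_n * 'I_n)) : 'M[R]_(size us, n) :=
  \matrix_(k, i) (nth 0 (map fst us) k) 0 i.

Lemma row_free_stack us : pivoted us -> row_free (stack us).
Proof.
move=> pus; apply/row_freeP.
suff : forall v : 'rV_(size us), v *m stack us = 0 -> v = 0.
  move=> inj; apply/row_freeP; rewrite -kermx_eq0; apply/rowV0P => v /sub_kermxP.
  exact: inj.
elim: us pus => [|[u i] us IH] /=; first by move=> _ v _; apply/rowP => -[].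
case=> ui usi pus v vus.
pose w : 'rV[R]_(size us) := \row_j v 0 (lift ord0 j).
have vE j : (v *m stack ((u, i) :: us)) 0 j = v 0 ord0 * u 0 j + (w *m stack us) 0 j.
  rewrite !mxE big_ord_recl !mxE/=; congr (_ + _).
  by apply: eq_bigr => k _; rewrite !mxE.
have v0 : v 0 ord0 = 0.
  have := vE i; rewrite vus mxE.
  rewrite [X in _ + X](_ : _ = 0) ?addr0.
    by move/esym/eqP; rewrite mulf_eq0 (negPf ui) orbF => /eqP.
  rewrite mxE big1// => k _; rewrite !mxE.
  rewrite (nth_map (0, i))// (usi _ (nth (0, i) us k).2) ?mulr0//.
  by rewrite -surjective_pairing mem_nth.
have w0 : w = 0.
  apply: IH => //; apply/rowP => j; have := vE j; rewrite vus v0 mul0r add0r.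
  by rewrite !mxE => <-.
apply/rowP => k; rewrite mxE; case: (unliftP ord0 k) => [j|] -> //.
by have := congr1 (fun x : 'rV_(size us) => x 0 j) w0; rewrite !mxE.
Qed.

Lemma row_stack us k : exists i, (row k (stack us), i) \in us.
Proof.
have -> : row k (stack us) = nth 0 (map fst us) k by apply/rowP => j; rewrite !mxE.
have /mapP[[u i] ui ->] : nth 0 (map fst us) k \in map fst us by rewrite mem_nth ?size_map.
by exists i.
Qed.

Lemma nullity_pivoted S us : pivoted us ->
  (forall u i, (u, i) \in us -> u *m S = 0) -> (size us <= \rank (kermx S))%N.
Proof.
move=> pus us0; have /eqP <- := row_free_stack pus.
apply: mxrankS; apply/row_subP => k; apply/sub_kermxP.
by have [i /us0] := row_stack k.
Qed.

(** The images lie on the line of b, so all but one dimension of the family is mapped to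
    zero. *)
Lemma nullity_pivoted1 S us (b : 'rV[R]_n) : pivoted us ->
  (forall u i, (u, i) \in us -> (u *m S <= b)%MS) ->
  (size us <= (\rank (kermx S)).+1)%N.
Proof.
move=> pus us0; have /eqP sz := row_free_stack pus.
have rS : (\rank (stack us *m S) <= 1)%N.
  apply: leq_trans (rank_leq_row b); apply: mxrankS; apply/row_subP => k.
  by rewrite row_mul; have [i /us0] := row_stack k.
have := mxrank_mul_ker (stack us) S; rewrite sz => <-.
have le_ker : (\rank (stack us :&: kermx S)%MS <= \rank (kermx S))%N.
  by rewrite mxrankS// capmxSr.
by apply: leq_trans (leq_add rS le_ker) _; rewrite add1n.
Qed.

Lemma sym_rangeP S (b : 'rV[R]_n) : S^T = S ->
  (forall z : 'rV_n, z *m S = 0 -> z *m b^T = 0) -> exists x : 'rV_n, x *m S = b.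
Proof.
move=> symS bz; suff /submxP[x ->] : (b <= S)%MS by exists x.
rewrite submxE; apply/eqP/trmx_inj; rewrite trmx_mul trmx0.
apply/row_matrixP => i; rewrite row_mul row0; apply: bz.
by rewrite -row_mul -[X in _ *m X]symS -trmx_mul mulmx_coker trmx0 row0.
Qed.

Definition dot (x y : 'rV[R]_n) : R := (x *m y^T) 0 0.

Lemma dotE x y : dot x y = \sum_i x 0 i * y 0 i.
Proof. by rewrite /dot mxE; apply: eq_bigr => i _; rewrite mxE. Qed.

Lemma dotC x y : dot x y = dot y x.
Proof. by rewrite !dotE; apply: eq_bigr => i _; rewrite mulrC. Qed.

Lemma dotDl x y z : dot (x + y) z = dot x z + dot y z.
Proof. by rewrite /dot mulmxDl mxE. Qed.

Lemma dotDr x y z : dot z (x + y) = dot z x + dot z y.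
Proof. by rewrite !(dotC z) dotDl. Qed.

Lemma dotZl a x z : dot (a *: x) z = a * dot x z.
Proof. by rewrite /dot -scalemxAl mxE. Qed.

Lemma dotZr a x z : dot z (a *: x) = a * dot z x.
Proof. by rewrite !(dotC z) dotZl. Qed.

Lemma dotNl x z : dot (- x) z = - dot x z.
Proof. by rewrite /dot mulNmx mxE. Qed.

Lemma dotNr x z : dot z (- x) = - dot z x.
Proof. by rewrite !(dotC z) dotNl. Qed.

Lemma dotBl x y z : dot (x - y) z = dot x z - dot y z.
Proof. by rewrite dotDl dotNl. Qed.

Lemma dotBr x y z : dot z (x - y) = dot z x - dot z y.
Proof. by rewrite dotDr dotNr. Qed.

Lemma dot0l x : dot 0 x = 0. Proof. by rewrite /dot mul0mx mxE. Qed.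
Lemma dot0r x : dot x 0 = 0. Proof. by rewrite dotC dot0l. Qed.

Lemma dot_ge0 x : 0 <= dot x x.
Proof. by rewrite dotE sumr_ge0// => i _; rewrite -expr2 sqr_ge0. Qed.

Lemma dot_eq0 x : (dot x x == 0) = (x == 0).
Proof.
apply/idP/eqP => [|->]; last by rewrite dot0l.
rewrite dotE psumr_eq0 => [/allP x0|i _]; last by rewrite -expr2 sqr_ge0.
apply/rowP => i; rewrite mxE; apply/eqP.
by have := x0 i (mem_index_enum _); rewrite -expr2 sqrf_eq0.
Qed.

Lemma dot_sym S x y : S^T = S -> dot (x *m S) y = dot x (y *m S).
Proof. by move=> symS; rewrite /dot trmx_mul symS mulmxA. Qed.

(** The range of a symmetric matrix is the orthogonal complement of its kernel. *)
Lemma sym_range S b : S^T = S ->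
  (forall z, z *m S = 0 -> dot z b = 0) -> exists x : 'rV_n, x *m S = b.
Proof.
move=> symS bz; apply: sym_rangeP => // z /bz zb.
by apply/matrixP => i j; rewrite !ord1 [RHS]mxE -zb.
Qed.

Definition unit_row (v : 'I_n) : 'rV[R]_n := delta_mx 0 v.

Lemma unit_rowE v i : unit_row v 0 i = (i == v)%:R.
Proof. by rewrite mxE eqxx. Qed.

Lemma dot_unit_row x v : dot x (unit_row v) = x 0 v.
Proof.
rewrite dotE (bigD1 v)//= unit_rowE eqxx mulr1 big1 ?addr0// => i /negPf iv.
by rewrite unit_rowE iv mulr0.
Qed.

Lemma mul_outer (x a b : 'rV[R]_n) : x *m (a^T *m b) = dot x a *: b.
Proof. by rewrite mulmxA [x *m a^T]mx11_scalar mul_scalar_mx. Qed.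

(** The spectral theorem, applied over the complex numbers, diagonalises S with a real
    diagonal; if that diagonal were zero, S would be zero. *)
Lemma sym_nonzero_eigenvalue S : S^T = S -> S != 0 ->
  exists2 s : R, s != 0 & eigenvalue S s.
Proof.
move=> symS S0; pose C := R[i]; pose phi : {rmorphism R -> C} := @real_complex R.
pose T : 'M[C]_n := map_mx phi S.
have realT : T \is a realmx.
  by apply/mxOverP => i j; rewrite mxE; apply/complex_realP; exists (S i j).
have symT : T \is symmetricmx.
  apply/is_hermitianmxP; rewrite expr0 scale1r map_mx_id//. by rewrite /T map_trmx symS.
have hermT := realsym_hermsym symT realT.
have /hermitian_normalmx/orthomx_spectralP TE := hermT.
have /mxOverP reald := hermitian_spectral_diag_real hermT.
have [j dj0] : exists j, spectral_diag T 0 j != 0.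
  apply/existsP; apply: contra_neqT S0; rewrite negb_exists => /forallP d0.
  have d00 : spectral_diag T = 0.
    by apply/rowP => j; rewrite mxE; apply/eqP; have := d0 j; rewrite negbK.
  apply/eqP; rewrite -(map_mx_eq0 phi) -/T TE d00.
  by rewrite (_ : diag_mx 0 = 0) ?mulmx0 ?mul0mx// raddf0.
have [r rE] : exists r, spectral_diag T 0 j = phi r.
  by have /complex_realP[r ->] := reald 0 j; exists r.
exists r; first by apply: contra_neq dj0; rewrite rE => ->; rewrite rmorph0.
rewrite eigenvalue_root_char -(fmorph_root phi) map_char_poly -rE -eigenvalue_root_char.
apply/eigenvalueP; exists (row j (spectralmx T)).
  have PT : spectralmx T *m T = diag_mx (spectral_diag T) *m spectralmx T.
    by rewrite {2}TE !mulmxA mulmxV ?spectral_unit// mul1mx.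
  rewrite -row_mul PT row_mul.
  by rewrite row_diag_mx -scalemxAl -rowE.
have := spectral_unit T; rewrite -row_free_unit => /row_freeP[B PB].
apply: contra_eq_neq (congr1 (row j) PB) => r0.
by rewrite row_mul r0 mul0mx row1 eq_sym; apply/eqP => /rowP/(_ j)/eqP; rewrite !mxE !eqxx oner_eq0.
Qed.
End Spectrum.

(** * Blocks and bordered matrices *)

Section Blocks.
Variable R : realType.
Variable n : nat.
Variable G : graph n.
Implicit Types (S : 'M[R]_n) (K : {set 'I_n}) (v i j : 'I_n) (u x z b : 'rV[R]_n).

(** With D the diagonal matrix of d and E the inverse of its square root, E S1 E has the
    pattern of S1, and E S1 E - 1 = E S2 E. So 0 and 1 are multiple eigenvalues of E S1 E.
    *)
Lemma q_two_diagonals S1 S2 (d : 'rV[R]_n) :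
  in_S G S1 -> (forall i, 0 < d 0 i) -> S2 = S1 - diag_mx d ->
  (1 < \rank (kermx S1))%N -> (1 < \rank (kermx S2))%N -> (q R G + 2 <= n)%N.
Proof.
move=> [symS1 GS1] d0 -> r1 r2.
pose e : 'rV[R]_n := \row_i (Num.sqrt (d 0 i))^-1.
have e0 i : e 0 i != 0 by rewrite mxE invr_eq0 sqrtr_eq0 -ltNge d0.
pose E := diag_mx e.
have Eunit : E \in unitmx.
  by rewrite unitmxE det_diag unitfE; apply/prodf_neq0 => i _.
have symE : E^T = E by rewrite tr_diag_mx.
have EdE : E *m diag_mx d *m E = 1%:M.
  rewrite /E !mulmx_diag -diag_const_mx; congr diag_mx; apply/rowP => i; rewrite !mxE.
  rewrite -{2}(sqr_sqrtr (ltW (d0 i))); have := e0 i; rewrite mxE invr_eq0 => ?.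
  by field.
clearbody e.
have rE (S : 'M[R]_n) : \rank (kermx (E *m S *m E)) = \rank (kermx S).
  rewrite !mxrank_ker mxrankMfree ?row_free_unit//.
  by rewrite -mxrank_tr trmx_mul symE mxrankMfree ?row_free_unit// mxrank_tr.
have ES : E *m S1 *m E - 1%:M = E *m (S1 - diag_mx d) *m E.
  by rewrite mulmxBr mulmxBl EdE.
apply: (@q_two_nullities _ _ _ (E *m S1 *m E) 1) => //.
- split; first by rewrite !trmx_mul symE symS1 mulmxA.
  move=> i j ij; rewrite -GS1// mul_mx_diag mul_diag_mx !mxE.
  by rewrite !mulf_eq0 (negPf (e0 i)) (negPf (e0 j)) orbF.
- exact: oner_neq0.
- by rewrite rE.
- by rewrite /eigenspace ES rE.
Qed.

Definition supp K u := forall i, i \notin K -> u 0 i = 0.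

(** Matrices of the pattern of the subgraph induced on K, extended by zero. All blocks keep
    the full size n, so that blocks on disjoint sets are assembled by addition. *)
Definition block K S :=
  [/\ S^T = S,
      (forall i j, i \in K -> j \in K -> i != j -> (S i j != 0) = G i j)
    & (forall i j, i \notin K -> S i j = 0)].

Lemma symE S : S^T = S -> forall i j, S i j = S j i.
Proof. by move=> symS i j; rewrite -{1}symS mxE. Qed.

Lemma block_setT S : block setT S -> in_S G S.
Proof. by case=> symS GS _; split=> // i j; apply: GS; rewrite inE. Qed.

Lemma block_mul_supp K S u : block K S -> supp K (u *m S).
Proof.
case=> symS _ S0 i iK; rewrite mxE big1// => j _.
by rewrite (symE symS) S0// mulr0.
Qed.

Lemma block_mul0 K S u : block K S -> (forall i, i \in K -> u 0 i = 0) -> u *m S = 0.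
Proof.
case=> symS _ S0 u0; apply/rowP => i; rewrite !mxE big1// => j _.
by have [/u0->|/S0->] := boolP (j \in K); rewrite ?mul0r ?mulr0.
Qed.

Definition indicator K : 'rV[R]_n := \row_i (i \in K)%:R.

Definition restr K u : 'rV[R]_n := \row_i (if i \in K then u 0 i else 0).

Lemma supp_restr K u : supp K (restr K u).
Proof. by move=> i /negPf iK; rewrite mxE iK. Qed.

Lemma supp_ind K : supp K (indicator K).
Proof. by move=> i /negPf iK; rewrite mxE iK. Qed.

Lemma suppD K u x : supp K u -> supp K x -> supp K (u + x).
Proof. by move=> uK xK i iK; rewrite mxE uK ?xK ?addr0. Qed.

Lemma suppZ K a u : supp K u -> supp K (a *: u).
Proof. by move=> uK i iK; rewrite mxE uK ?mulr0. Qed.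

Lemma suppN K u : supp K u -> supp K (- u).
Proof. by move=> uK i iK; rewrite mxE uK ?oppr0. Qed.

Lemma suppS K K' u : K \subset K' -> supp K u -> supp K' u.
Proof. by move=> KK' uK i iK'; apply: uK; apply: contra iK'; apply: (fintype.subsetP KK'). Qed.

Lemma restr_mul K S u : block K S -> restr K u *m S = u *m S.
Proof.
move=> KS; apply/eqP; rewrite -subr_eq0 -mulmxBl; apply/eqP.
by apply: (block_mul0 KS) => i iK; rewrite !mxE iK subrr.
Qed.

Lemma restr_id K u : supp K u -> restr K u = u.
Proof. by move=> uK; apply/rowP => i; rewrite mxE; case: ifPn => // /uK. Qed.

Lemma dot_disj K K' u x : supp K u -> supp K' x -> [disjoint K & K'] -> dot u x = 0.
Proof.
move=> uK xK' KK'; rewrite dotE big1// => i _.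
have [iK|/uK->] := boolP (i \in K); last by rewrite mul0r.
by rewrite xK' ?mulr0// (disjointFr KK' iK).
Qed.

Lemma block_disj K K' S u : block K S -> supp K' u -> [disjoint K & K'] -> u *m S = 0.
Proof.
move=> KS uK' KK'; apply: (block_mul0 KS) => i iK; apply: uK'.
by rewrite (disjointFr KK' iK).
Qed.

Lemma block_union K1 K2 S1 S2 : block K1 S1 -> block K2 S2 -> [disjoint K1 & K2] ->
  (forall i j, i \in K1 -> j \in K2 -> ~~ G i j) -> block (K1 :|: K2) (S1 + S2).
Proof.
move=> [sym1 G1 S10] [sym2 G2 S20] K12 NG; split.
- by rewrite raddfD/= sym1 sym2.
- move=> i j; rewrite !inE mxE => /orP[] iK /orP[] jK ij.
  + by rewrite S20 ?addr0 ?G1// (disjointFr K12 iK).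
  + rewrite S20 ?(disjointFr K12 iK)// addr0 (symE sym1) S10 ?(disjointFl K12 jK)// eqxx.
    by apply/esym/negbTE/NG.
  + rewrite S10 ?(disjointFl K12 iK)// add0r (symE sym2) S20 ?(disjointFr K12 jK)// eqxx.
    by apply/esym/negbTE; rewrite adj_sym; apply: NG.
  + by rewrite S10 ?add0r ?G2// (disjointFl K12 iK).
- by move=> i j; rewrite inE negb_or => /andP[i1 i2]; rewrite mxE S10 ?S20 ?addr0.
Qed.

(** The row and the column of v receive b, and the diagonal entry at v receives c, when S
    vanishes there. *)
Definition border v S b c : 'M[R]_n :=
  S + (unit_row R v)^T *m b + b^T *m unit_row R v + c *: ((unit_row R v)^T *m unit_row R v).

Lemma mul_border v S b c u :
  u *m border v S b c = u *m S + u 0 v *: b + (dot u b + c * u 0 v) *: unit_row R v.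
Proof.
rewrite /border !mulmxDr -scalemxAr !mul_outer !dot_unit_row scalerDl scalerA.
by rewrite !addrA.
Qed.

Definition nbr_pattern v b := forall i, i != v -> (b 0 i != 0) = G v i.

Lemma border_block_in K v S b c : v \in K -> block (K :\ v) S -> supp K b -> b 0 v = 0 ->
  (forall i, i \in K -> i != v -> (b 0 i != 0) = G v i) -> block K (border v S b c).
Proof.
move=> vK [symS GS S0] bK bv bN; split.
- rewrite /border !raddfD/= linearZ/= !trmx_mul !trmxK symS.
  by congr (_ + _); rewrite -!addrA; congr (_ + _); rewrite addrC.
- move=> i j iK jK ij; rewrite /border !mxE !big_ord1 !mxE !eqxx /=.
  have [iv'|iv] := eqVneq i v; have [jv'|jv] := eqVneq j v.
  + by rewrite iv' jv' eqxx in ij.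
  + by rewrite iv' S0 ?inE ?eqxx// -bN// ?mulr0 ?addr0 ?add0r ?mul1r.
  + rewrite jv' (symE symS) S0 ?inE ?eqxx// adj_sym -bN//.
    by rewrite !mul0r mulr1 !mulr0 !addr0 !add0r.
  + by rewrite !mul0r !mulr0 !addr0 GS// !inE ?iv ?jv.
- move=> i j iK; have iv : (i == v) = false by apply: contraNF iK => /eqP ->.
  rewrite /border !mxE !big_ord1 !mxE !eqxx /= iv S0 ?inE ?(negPf iK) ?andbF//.
  by rewrite (bK i iK) ?mul0r ?mulr0 ?addr0.
Qed.

Lemma border_block v S b c : block (~: [set v]) S -> b 0 v = 0 -> nbr_pattern v b ->
  in_S G (border v S b c).
Proof.
move=> pS bv bN; apply: block_setT.
have E : [set: 'I_n] :\ v = ~: [set v] by apply/setP => i; rewrite !inE andbT.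
apply: border_block_in => //.
- exact: in_setT.
- by rewrite E.
- by move=> i; rewrite inE.
- by move=> i _; exact: bN.
Qed.

End Blocks.

(** * Weighted Laplacians *)

Section Laplacian.
Variable R : realType.
Variable n : nat.
Variable G : graph n.
Implicit Types (S : 'M[R]_n) (K : {set 'I_n}) (v i j : 'I_n) (u x z b p : 'rV[R]_n).

(** The diagonal is the one that puts p into the kernel; the usual weighted Laplacian is the
    case where p is constant. Other kernel vectors, with entries of both signs, give other
    diagonals for the same off-diagonal part. *)
Definition weighted_lap K (a : 'I_n -> 'I_n -> R) p : 'M[R]_n :=
  \matrix_(i, j) if (i \in K) && (j \in K) then
     (if i == j then (\sum_(k in K) a i k * p 0 k) / p 0 i else - a i j) else 0.

Definition weights K (a : 'I_n -> 'I_n -> R) :=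
  [/\ (forall i j, a i j = a j i), (forall i, a i i = 0)
   & (forall i j, i \in K -> j \in K -> (a i j != 0) = G i j)].

Lemma weighted_lap_block K a p : weights K a -> block G K (weighted_lap K a p).
Proof.
move=> [syma a0 aG]; split.
- apply/matrixP => i j; rewrite !mxE andbC (eq_sym j).
  by case: ifP => //; case: eqVneq => [->|] //; rewrite syma.
- by move=> i j iK jK /negPf ij; rewrite mxE iK jK ij oppr_eq0 aG.
- by move=> i j /negPf iK; rewrite mxE iK.
Qed.

Lemma mul_weighted_lap K a p z i : weights K a -> (z *m weighted_lap K a p) 0 i =
  if i \in K then z 0 i * (\sum_(k in K) a i k * p 0 k) / p 0 i
                  - \sum_(k in K) a i k * z 0 k else 0.
Proof.
move=> [syma a0 aG]; rewrite mxE; case: ifPn => iK; last first.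
  by rewrite big1// => j _; rewrite mxE (negPf iK) andbF mulr0.
rewrite (bigD1 i)//= mxE iK eqxx mulrA; congr (_ + _).
rewrite [X in _ = - X](bigD1 i)//= a0 mul0r add0r -sumrN.
rewrite [RHS]big_mkcondl; apply: eq_bigr => j ji.
rewrite mxE iK andbT (negPf ji); case: ifP => jK; last by rewrite mulr0.
by rewrite syma mulrN mulrC.
Qed.

Lemma weighted_lap_ker K a p : weights K a -> (forall i, i \in K -> p 0 i != 0) ->
  p *m weighted_lap K a p = 0.
Proof.
move=> wa p0; apply/rowP => i; rewrite (mul_weighted_lap _ _ _ wa) [RHS]mxE.
by case: ifP => // iK; rewrite mulrAC divff ?p0// mul1r subrr.
Qed.

(** In the coordinates z_i / p_i the form is a combination of squares of differences along
    the edges, and the sign of a term is that of a_ij p_i p_j. *)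
Lemma weighted_lap_form K a p z : weights K a -> (forall i, i \in K -> p 0 i != 0) ->
  dot (z *m weighted_lap K a p) z =
  2^-1 * \sum_(i in K) \sum_(j in K)
     a i j * (p 0 i * p 0 j) * (z 0 i / p 0 i - z 0 j / p 0 j) ^+ 2.
Proof.
move=> wa p0; have [syma _ _] := wa; rewrite dotE.
transitivity (\sum_(i in K) \sum_(j in K)
    (z 0 i ^+ 2 * (a i j * p 0 j / p 0 i) - a i j * z 0 i * z 0 j)).
  rewrite [RHS]big_mkcond; apply: eq_bigr => i _; rewrite (mul_weighted_lap _ _ _ wa).
  case: ifP => iK; last by rewrite mul0r.
  rewrite sumrB mulrBl; congr (_ - _).
    by rewrite -!mulrA mulr_suml !mulr_sumr; apply: eq_bigr => j _; field; rewrite p0.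
  by rewrite mulr_suml; apply: eq_bigr => j _; ring.
pose F i j := z 0 i ^+ 2 * (a i j * p 0 j / p 0 i) - a i j * z 0 i * z 0 j.
transitivity (2^-1 * \sum_(i in K) \sum_(j in K) (F i j + F j i)).
  under [in RHS]eq_bigr do rewrite big_split.
  rewrite big_split/= [X in _ * (_ + X)]exchange_big/= -mulr2n -mulr_natl.
  by field.
congr (_ * _); apply: eq_bigr => i iK; apply: eq_bigr => j jK; rewrite /F (syma j i).
by field; rewrite !p0.
Qed.

Lemma weighted_lap_sub K a p (q : 'rV[R]_n) : weights K a -> (forall i, i \in K -> p 0 i != 0) ->
   (forall i, i \in K -> q 0 i != 0) ->
   weighted_lap K a p - weighted_lap K a q =
   diag_mx (\row_i if i \in K then \sum_(j in K) a i j * (p 0 j / p 0 i - q 0 j / q 0 i) else 0).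
Proof.
move=> wa p0 q0; apply/matrixP => i j; rewrite !mxE.
have [<-|ij] := eqVneq i j; last by rewrite mulr0n subrr.
rewrite mulr1n andbb; case: ifP => iK; last by rewrite subr0.
rewrite !mulr_suml -sumrB; apply: eq_bigr => j' _; field.
by rewrite p0 ?q0.
Qed.

Definition adj_weight i j : R := (G i j)%:R.

Lemma weights_adj K : weights K adj_weight.
Proof.
split=> [i j|i|i j _ _]; rewrite /adj_weight ?(adj_sym _ i)// ?adj_irrefl//.
by rewrite pnatr_eq0 eqb0 negbK.
Qed.

Definition lap K : 'M[R]_n := weighted_lap K adj_weight (const_mx 1).

Lemma lap_block K : block G K (lap K).
Proof. exact/weighted_lap_block/weights_adj. Qed.

Lemma lap_form K z : dot (z *m lap K) z =
  2^-1 * \sum_(i in K) \sum_(j in K) (G i j)%:R * (z 0 i - z 0 j) ^+ 2.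
Proof.
rewrite weighted_lap_form; [|exact: weights_adj|by move=> i _; rewrite mxE oner_neq0].
congr (_ * _); apply: eq_bigr => i _; apply: eq_bigr => j _.
by rewrite !mxE !mulr1 !divr1.
Qed.

Lemma lap_form_ge0 K z : 0 <= dot (z *m lap K) z.
Proof.
rewrite lap_form mulr_ge0 ?invr_ge0//; apply: sumr_ge0 => i _; apply: sumr_ge0 => j _.
by rewrite mulr_ge0// sqr_ge0.
Qed.

Lemma mul_lap K z i : (z *m lap K) 0 i =
  if i \in K then \sum_(k in K) (G i k)%:R * (z 0 i - z 0 k) else 0.
Proof.
rewrite (mul_weighted_lap _ _ _ (weights_adj K)); case: ifP => // iK.
rewrite [in X in _ * _ / X]mxE divr1 mulr_sumr -sumrB; apply: eq_bigr => k _.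
by rewrite !mxE /adj_weight; ring.
Qed.

Lemma lap_ind K K' : (forall i j, i \in K -> j \in K -> i \in K' -> G i j -> j \in K') ->
  indicator R K' *m lap K = 0.
Proof.
move=> clK; apply/rowP => i; rewrite mul_lap [RHS]mxE; case: ifP => // iK.
rewrite big1// => j jK; rewrite !mxE.
have [Gij|] := boolP (G i j); last by rewrite mul0r.
have -> : (i \in K') = (j \in K'); last by rewrite subrr mulr0.
by apply/idP/idP; [move/clK|move=> jK'; apply: (clK j)] => //; rewrite ?(adj_sym _ j) //; apply.
Qed.

Lemma lap_form0 K z i j : dot (z *m lap K) z = 0 -> i \in K -> j \in K -> G i j ->
  z 0 i = z 0 j.
Proof.
move=> /eqP; rewrite lap_form mulf_eq0 invr_eq0 pnatr_eq0 /= => z0 iK jK Gij.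
move: z0; rewrite psumr_eq0 => [/allP/(_ i (mem_index_enum _))|k _]; last first.
  by apply: sumr_ge0 => l _; rewrite mulr_ge0// sqr_ge0.
rewrite iK /= psumr_eq0 => [/allP/(_ j (mem_index_enum _))|k _]; last first.
  by rewrite mulr_ge0// sqr_ge0.
by rewrite jK Gij /= mul1r sqrf_eq0 subr_eq0 => /eqP.
Qed.

Definition within K : rel 'I_n := fun i j => [&& i \in K, j \in K & G i j].

Definition connected K := forall i j, i \in K -> j \in K -> connect (within K) i j.

Lemma lap_form0_conn K z : connected K -> dot (z *m lap K) z = 0 ->
  forall i j, i \in K -> j \in K -> z 0 i = z 0 j.
Proof.
move=> cK z0 i j iK jK; have /connectP[s] := cK i j iK jK.
elim: s i {iK} => [|k s IH] i /=; first by move=> _ ->.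
move=> /andP[/and3P[iK kK Gik] ks] jE; rewrite (lap_form0 z0 iK kK Gik).
exact: IH.
Qed.

(** On a connected set only the constants are in the kernel of the Laplacian, so every
    vector of sum zero is in its range. *)
Lemma lap_range K b : connected K -> supp K b -> \sum_(i in K) b 0 i = 0 ->
  exists2 x, x *m lap K = b & supp K x.
Proof.
move=> cK bK sb; have [symL _ _] := lap_block K.
have [|x xb] := sym_range (b := b) symL.
  move=> z z0; have z0' : dot (z *m lap K) z = 0 by rewrite z0 dot0l.
  have zc := lap_form0_conn cK z0'.
  rewrite dotE; have [k kK|K0] := fintype.pickP (mem K).
    transitivity (\sum_(i in K) z 0 k * b 0 i); last by rewrite -mulr_sumr sb mulr0.
    rewrite [RHS]big_mkcond; apply: eq_bigr => i _; case: ifPn => iK; first by rewrite (zc i k).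
    by rewrite bK ?mulr0.
  by rewrite big1// => i _; rewrite bK ?mulr0//; have := K0 i; rewrite /= => ->.
exists (restr K x); last exact: supp_restr.
by rewrite (restr_mul _ (lap_block K)).
Qed.

(** The block is s (1 + L) on K, where L is the Laplacian: it is invertible there because L
    is positive semidefinite, and it has the eigenvalue s on the kernel of L, which contains
    the indicators of all unions of components. *)
Lemma shift_block K b s : s != 0 -> supp K b -> exists S,
  [/\ block G K S, (exists2 x, x *m S = b & supp K x)
    & forall K', K' \subset K ->
        (forall i j, i \in K -> j \in K -> i \in K' -> G i j -> j \in K') ->
      indicator R K' *m S = s *: indicator R K'].
Proof.
move=> s0 bK.
pose I_K : 'M[R]_n := diag_mx (indicator R K).
pose S := s *: I_K + s *: lap K.
have mulI z : z *m I_K = restr K z.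
  by apply/rowP => i; rewrite mul_mx_diag !mxE; case: ifP; rewrite ?mulr1 ?mulr0.
have [symL GL L0] := lap_block K.
have pS : block G K S.
  split; first by rewrite raddfD/= !linearZ/= symL tr_diag_mx.
    move=> i j iK jK ij; rewrite !mxE (negPf ij) mulr0n mulr0 add0r.
    rewrite mulf_eq0 (negPf s0) orFb.
    by have := GL i j iK jK ij; rewrite !mxE (negPf ij).
  by move=> i j iK; rewrite mxE [X in _ + X]mxE L0// !mxE (negPf iK) mul0rn !mulr0 addr0.
exists S; split => //.
- have [symS _ _] := pS; have [|x xb] := sym_range (b := b) symS.
    move=> z z0; have : dot (z *m S) (s^-1 *: z) = 0 by rewrite z0 dot0l.
    rewrite mulmxDr -!scalemxAr mulI -scalerDr dotZl dotZr mulrA divff// mul1r.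
    rewrite dotDl => zz.
    have zz0 : dot (restr K z) (restr K z) = 0.
      have -> : dot (restr K z) (restr K z) = dot (restr K z) z.
        by rewrite !dotE; apply: eq_bigr => i _; rewrite !mxE; case: ifP; rewrite ?mul0r.
      apply/eqP; rewrite eq_le; apply/andP; split.
        by rewrite -[X in _ <= X]zz lerDl lap_form_ge0.
      have -> : dot (restr K z) z = dot (restr K z) (restr K z); last exact: dot_ge0.
      by rewrite !dotE; apply: eq_bigr => i _; rewrite !mxE; case: ifP; rewrite ?mul0r.
    have rz : restr K z = 0 by apply/eqP; rewrite -dot_eq0 zz0.
    rewrite dotE big1// => i _; have [iK|/bK->] := boolP (i \in K); last by rewrite mulr0.
    by have := congr1 (fun w : 'rV_n => w 0 i) rz; rewrite !mxE iK => ->; rewrite mul0r.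
  by exists (restr K x); [rewrite (restr_mul _ pS)|exact: supp_restr].
- move=> K' K'K clK'; rewrite mulmxDr -!scalemxAr lap_ind// scaler0 addr0 mulI.
  by rewrite restr_id//; apply: (suppS K'K); exact: supp_ind.
Qed.

End Laplacian.

(** * Parts cut off by a vertex *)

Section CutVertex.
Variable R : realType.
Variable n : nat.
Variable G : graph n.
Implicit Types (S : 'M[R]_n) (K : {set 'I_n}) (v i j : 'I_n) (u x z b p : 'rV[R]_n).

(** That is, K is a union of connected components of G - v. *)
Definition cut_part v K := v \notin K /\ forall i j, i \in K -> G i j -> j != v -> j \in K.

Lemma cut_part_nadj v K K' : cut_part v K -> v \notin K' -> [disjoint K & K'] ->
  forall i j, i \in K -> j \in K' -> ~~ G i j.
Proof.
move=> [_ clK] vK' KK' i j iK jK'; apply/negP => Gij.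
have jv : j != v by apply: contraNneq vK' => <-.
by have := disjointFr KK' (clK i j iK Gij jv); rewrite jK'.
Qed.

Lemma ind_pivoted (Ks : seq ({set 'I_n} * 'I_n)) :
  all (fun Kk : {set 'I_n} * 'I_n => Kk.2 \in Kk.1) Ks ->
  pairwise (fun A B : {set 'I_n} * 'I_n => [disjoint A.1 & B.1]) Ks ->
  pivoted [seq (indicator R Kk.1, Kk.2) | Kk <- Ks].
Proof.
elim: Ks => //= [[K k] Ks IH] /andP[/= kK allK] /andP[/allP disj pw]; split.
- by rewrite mxE kK oner_neq0.
- move=> w j /mapP[[K' k'] K'Ks [-> _]]; rewrite mxE.
  by rewrite (disjointFr (disj _ K'Ks) kK).
- exact: IH.
Qed.

Definition adj_row v : 'rV[R]_n := \row_i (G v i)%:R.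

Lemma adj_row_nbrs v : nbr_pattern G v (adj_row v).
Proof. by move=> i _; rewrite mxE pnatr_eq0 eqb0 negbK. Qed.

Lemma adj_row0 v : adj_row v 0 v = 0.
Proof. by rewrite mxE adj_irrefl. Qed.

Lemma lap_cut_part K v : cut_part v K -> indicator R K *m lap R G (~: [set v]) = 0.
Proof.
move=> [_ clK]; apply: lap_ind => i j _ jv iK Gij.
by apply: clK Gij _ => //; move: jv; rewrite !inE.
Qed.

(** The Laplacian of G - v kills the indicators of the parts, so bordering by v sends them
    all to the line of the unit vector of v. *)
Lemma parts_nullity v (Ks : seq ({set 'I_n} * 'I_n)) :
  all (fun Kk : {set 'I_n} * 'I_n => Kk.2 \in Kk.1) Ks ->
  pairwise (fun A B : {set 'I_n} * 'I_n => [disjoint A.1 & B.1]) Ks ->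
  (forall Kk, Kk \in Ks -> cut_part v Kk.1) ->
  exists2 S : 'M[R]_n, in_S G S & (size Ks <= (\rank (kermx S)).+1)%N.
Proof.
move=> kK disj clK.
exists (border v (lap R G (~: [set v])) (adj_row v) 0).
  exact: border_block (lap_block _ _ _) (adj_row0 v) (@adj_row_nbrs v).
rewrite -(size_map (fun Kk : {set 'I_n} * 'I_n => (indicator R Kk.1, Kk.2))).
apply: (nullity_pivoted1 (b := unit_row R v) (ind_pivoted kK disj)).
move=> u i /mapP[[K k] /clK[/= vK clvK] [-> _]].
rewrite mul_border lap_cut_part// mxE (negPf vK) scale0r !add0r.
exact: scalemx_sub.
Qed.

Lemma q_four_parts v (Ks : seq ({set 'I_n} * 'I_n)) :
  all (fun Kk : {set 'I_n} * 'I_n => Kk.2 \in Kk.1) Ks ->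
  pairwise (fun A B : {set 'I_n} * 'I_n => [disjoint A.1 & B.1]) Ks ->
  (forall Kk, Kk \in Ks -> cut_part v Kk.1) ->
  (3 < size Ks)%N -> (q R G + 2 <= n)%N.
Proof.
move=> kK disj clK s3; have [S GS rS] := parts_nullity kK disj clK.
by apply: (q_nullity GS); apply: leq_trans s3 rS.
Qed.

Lemma q_three_parts v (Ks : seq ({set 'I_n} * 'I_n)) :
  all (fun Kk : {set 'I_n} * 'I_n => Kk.2 \in Kk.1) Ks ->
  pairwise (fun A B : {set 'I_n} * 'I_n => [disjoint A.1 & B.1]) Ks ->
  (forall Kk, Kk \in Ks -> cut_part v Kk.1) ->
  (2 < size Ks)%N -> (q R G + 1 <= n)%N.
Proof.
move=> kK disj clK s3; have [S GS rS] := parts_nullity kK disj clK.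
by apply: (q_nullity GS); apply: leq_trans s3 rS.
Qed.

Lemma blockZ K S c : c != 0 -> block G K S -> block G K (c *: S).
Proof.
move=> c0 [symS GS S0]; split; first by rewrite linearZ/= symS.
  by move=> i j iK jK ij; rewrite mxE mulf_eq0 (negPf c0) GS.
by move=> i j iK; rewrite mxE S0 ?mulr0.
Qed.

Lemma nonzero_coord u : u != 0 -> exists i, u 0 i != 0.
Proof.
move=> u0; apply/existsP; apply: contraNT u0; rewrite negb_exists => /forallP u0.
by apply/eqP/rowP => i; rewrite mxE; have := u0 i; rewrite negbK => /eqP.
Qed.

Lemma block_eigenvector K S : block G K S -> S != 0 -> exists s z k,
  [/\ s != 0, z *m S = s *: z, supp K z & z 0 k != 0].
Proof.
move=> pS S0; have [symS _ _] := pS.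
have [s s0 /eigenvalueP[z zS z0]] := sym_nonzero_eigenvalue symS S0.
have [k zk] := nonzero_coord z0; exists s, z, k; split=> //.
have -> : z = s^-1 *: (z *m S) by rewrite zS scalerA mulVf// scale1r.
exact/suppZ/(block_mul_supp _ pS).
Qed.

(** An edge makes the Laplacian nonzero, so it has an eigenvalue besides 0, which is scaled
    to 1. *)
Lemma unit_lap K i j : i \in K -> j \in K -> G i j -> exists S z k,
  [/\ block G K S, indicator R K *m S = 0,
      z *m S = z, supp K z & z 0 k != 0].
Proof.
move=> iK jK Gij; have pL := lap_block R G K.
have L0 : lap R G K != 0.
  have [_ GL _] := pL; have ij : i != j by apply: contraTneq Gij => ->; rewrite adj_irrefl.
  have := GL i j iK jK ij; rewrite Gij; apply: contraTneq => ->.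
  by rewrite mxE eqxx.
have [s [z [k [s0 zL zK zk]]]] := block_eigenvector pL L0.
exists (s^-1 *: lap R G K), z, k; split => //.
- by apply: blockZ => //; rewrite invr_eq0.
- rewrite -scalemxAr lap_ind ?scaler0//.
- by rewrite -scalemxAr zL scalerA mulVf// scale1r.
Qed.

Lemma border_in_line v S b u : u 0 v = 0 -> u *m S = 0 ->
  (u *m border v S b 0 <= unit_row R v)%MS.
Proof.
by move=> uv uS; rewrite mul_border uS uv scale0r !add0r scalemx_sub.
Qed.

Lemma cut_part_compl v K : cut_part v K -> cut_part v (~: (v |: K)).
Proof.
move=> [vK clK]; split; first by rewrite !inE eqxx.
move=> i j; rewrite !inE !negb_or => /andP[iv iK] Gij jv; rewrite jv /=.
by apply: contra iK => jK; apply: (clK j) => //; rewrite adj_sym.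
Qed.

Lemma cut_partU v K K' : cut_part v K -> cut_part v K' -> cut_part v (K :|: K').
Proof.
move=> [vK clK] [vK' clK']; split; first by rewrite inE negb_or vK.
move=> i j; rewrite !inE => /orP[iK|iK'] Gij jv.
  by rewrite (clK i j iK Gij jv).
by rewrite (clK' i j iK' Gij jv) orbT.
Qed.

Lemma disjoint_setU (A B C : {set 'I_n}) :
  [disjoint A :|: B & C] = [disjoint A & C] && [disjoint B & C].
Proof. by rewrite !disjoints_subset finset.subUset. Qed.

(** Each of the three blocks has the eigenvalues 0 and 1. Bordering by v costs one dimension
    for each of them, which leaves multiplicity two for both. *)
Lemma q_three_edges v K1 K2 K3 i1 j1 i2 j2 i3 j3 :
  cut_part v K1 -> cut_part v K2 -> cut_part v K3 ->
  [disjoint K1 & K2] -> [disjoint K1 & K3] -> [disjoint K2 & K3] ->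
  K1 :|: K2 :|: K3 = ~: [set v] ->
  i1 \in K1 -> j1 \in K1 -> G i1 j1 ->
  i2 \in K2 -> j2 \in K2 -> G i2 j2 ->
  i3 \in K3 -> j3 \in K3 -> G i3 j3 -> (q R G + 2 <= n)%N.
Proof.
move=> cl1 cl2 cl3 d12 d13 d23 KE iK1 jK1 G1 iK2 jK2 G2 iK3 jK3 G3.
have [S1 [z1 [k1 [p1 L1 zS1 zK1 zk1]]]] := unit_lap iK1 jK1 G1.
have [S2 [z2 [k2 [p2 L2 zS2 zK2 zk2]]]] := unit_lap iK2 jK2 G2.
have [S3 [z3 [k3 [p3 L3 zS3 zK3 zk3]]]] := unit_lap iK3 jK3 G3.
have [v1 v2 v3] : [/\ v \notin K1, v \notin K2 & v \notin K3].
  by split; [case: cl1|case: cl2|case: cl3].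
have pS : block G (~: [set v]) (S1 + S2 + S3).
  have d123 : [disjoint K1 :|: K2 & K3] by rewrite disjoint_setU d13.
  rewrite -KE; apply: block_union => //; last exact: cut_part_nadj (cut_partU cl1 cl2) v3 d123.
  by apply: block_union => //; exact: cut_part_nadj cl1 v2 d12.
have vcoord (K : {set 'I_n}) (u : 'rV[R]_n) : v \notin K -> supp K u -> u 0 v = 0.
  by move=> vK; exact.
have sd := disjoint_sym.
have mulS u K : supp K u -> [/\ (K = K1 -> u *m (S1 + S2 + S3) = u *m S1),
   (K = K2 -> u *m (S1 + S2 + S3) = u *m S2)
   & (K = K3 -> u *m (S1 + S2 + S3) = u *m S3)].
  move=> uK; rewrite !mulmxDr; split=> KE'; subst K.
  + by rewrite (block_disj p2 uK) 1?sd// (block_disj p3 uK) 1?sd// !addr0.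
  + by rewrite (block_disj p1 uK)// (block_disj p3 uK) 1?sd// addr0 add0r.
  + by rewrite (block_disj p1 uK)// (block_disj p2 uK)// !add0r.
have m1 u : supp K1 u -> u *m (S1 + S2 + S3) = u *m S1 by move=> /mulS[->].
have m2 u : supp K2 u -> u *m (S1 + S2 + S3) = u *m S2 by move=> /mulS[_ ->].
have m3 u : supp K3 u -> u *m (S1 + S2 + S3) = u *m S3 by move=> /mulS[_ _ ->].
have sI K : supp K (indicator R K) by exact: supp_ind.
apply: (@q_two_nullities _ _ _ (border v (S1 + S2 + S3) (adj_row v) 0) 1).
- exact: border_block pS (adj_row0 v) (@adj_row_nbrs v).
- exact: oner_neq0.
- pose Ks := [:: (K1, i1); (K2, i2); (K3, i3)].
  have := @nullity_pivoted1 _ _ (border v (S1 + S2 + S3) (adj_row v) 0)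
    [seq (indicator R Kk.1, Kk.2) | Kk <- Ks] (unit_row R v).
  rewrite size_map; apply.
    by apply: ind_pivoted => /=; rewrite ?iK1 ?iK2 ?iK3 ?d12 ?d13 ?d23.
  move=> u i; rewrite !inE => /or3P[]/eqP[-> _]; apply: border_in_line.
  - exact: vcoord v1 (sI _).
  - by rewrite m1.
  - exact: vcoord v2 (sI _).
  - by rewrite m2.
  - exact: vcoord v3 (sI _).
  - by rewrite m3.
- have kK (K : {set 'I_n}) (u : 'rV[R]_n) k : supp K u -> u 0 k != 0 -> k \in K.
    by move=> uK; apply: contraNT => /uK ->.
  have := @nullity_pivoted1 _ _ (border v (S1 + S2 + S3) (adj_row v) 0 - 1%:M)
    [:: (z1, k1); (z2, k2); (z3, k3)] (unit_row R v); rewrite /=; apply.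
    have k1K := kK _ _ _ zK1 zk1; have k2K := kK _ _ _ zK2 zk2.
    split=> // [w j|]; first rewrite !inE => /orP[]/eqP[-> _].
    + by rewrite zK2// (disjointFr d12 k1K).
    + by rewrite zK3// (disjointFr d13 k1K).
    split=> // w j; rewrite !inE => /eqP[-> _].
    by rewrite zK3// (disjointFr d23 k2K).
  have line z : z 0 v = 0 -> z *m (S1 + S2 + S3) = z ->
      (z *m (border v (S1 + S2 + S3) (adj_row v) 0 - 1%:M) <= unit_row R v)%MS.
    move=> zv zS; rewrite mulmxBr mul_border zS mulmx1 zv scale0r addr0 addrAC subrr add0r.
    exact: scalemx_sub.
  move=> u i; rewrite !inE => /or3P[]/eqP[-> _]; apply: line.
  - exact: vcoord v1 zK1.
  - by rewrite m1.
  - exact: vcoord v2 zK2.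
  - by rewrite m2.
  - exact: vcoord v3 zK3.
  - by rewrite m3.
Qed.

(** The blocks that still contribute a null vector after bordering: u is orthogonal to the
    attachment vector b, since b lies in the range of the symmetric matrix S, and the
    preimage x of b yields another null vector by border_null. *)
Definition good v K := exists S b u x,
  [/\ [/\ block G K S, supp K b & forall i, i \in K -> (b 0 i != 0) = G v i],
      [/\ u != 0, supp K u & u *m S = 0] & supp K x /\ x *m S = b].

Lemma good_orth S b u x : S^T = S -> u *m S = 0 -> x *m S = b -> dot u b = 0.
Proof. by move=> symS uS <-; rewrite dotC dot_sym// uS dot0r. Qed.

Lemma cut_vertex_notin v K K' : K :|: K' = ~: [set v] -> v \notin K.
Proof. by move=> /setP/(_ v); rewrite !inE eqxx /= => /negbT; rewrite negb_or => /andP[]. Qed.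

Lemma block_split v K K' S S' : cut_part v K -> [disjoint K & K'] -> K :|: K' = ~: [set v] ->
  block G K S -> block G K' S' -> block G (~: [set v]) (S + S').
Proof.
move=> clK dK KE pS pS'; rewrite -KE; apply: block_union => //.
have vK' : v \notin K' by apply: (@cut_vertex_notin v K' K); rewrite finset.setUC.
exact: cut_part_nadj clK vK' dK.
Qed.

Lemma split_nbrs v K K' b b' : K :|: K' = ~: [set v] -> [disjoint K & K'] ->
  supp K b -> supp K' b' ->
  (forall i, i \in K -> (b 0 i != 0) = G v i) -> (forall i, i \in K' -> (b' 0 i != 0) = G v i) ->
  nbr_pattern G v (b + b').
Proof.
move=> KE dK bK bK' bN bN' i iv; rewrite mxE.
have : i \in K :|: K' by rewrite KE !inE.
rewrite inE => /orP[] iK.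
  by rewrite bK' ?addr0 ?bN// (disjointFr dK iK).
by rewrite bK ?add0r ?bN'// (disjointFl dK iK).
Qed.

(** The diagonal entry x.b at v is the one that closes the equation at v. *)
Lemma border_null v S b x : block G (~: [set v]) S -> x 0 v = 0 -> b 0 v = 0 ->
  x *m S = b -> (unit_row R v - x) *m border v S b (dot x b) = 0.
Proof.
move=> pS xv bv xS; rewrite mul_border mulmxBl xS.
rewrite (block_mul0 pS); last by move=> i; rewrite !inE unit_rowE => /negPf->.
rewrite dotBl (dotC (unit_row R v)) dot_unit_row bv !mxE !eqxx xv subr0 mulr1 scale1r sub0r sub0r addNr add0r.
by rewrite addNr scale0r.
Qed.

Lemma border_null0 v S b c u : u 0 v = 0 -> u *m S = 0 -> dot u b = 0 ->
  u *m border v S b c = 0.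
Proof. by move=> uv uS ub; rewrite mul_border uS uv ub mulr0 addr0 !scale0r !addr0. Qed.

Lemma eigen_line v S b c s u : u 0 v = 0 -> u *m S = s *: u ->
  (u *m (border v S b c - s%:M) <= unit_row R v)%MS.
Proof.
move=> uv uS; rewrite mulmxBr mul_border uS mul_mx_scalar uv scale0r mulr0 !addr0.
by rewrite addrAC subrr add0r scalemx_sub.
Qed.

(** The good part makes 0 a double eigenvalue. Its block has another eigenvalue s, and the
    rest of G - v carries a block that has s as an eigenvalue on both of the other parts.
    Bordering costs one of these three dimensions. *)
Lemma q_good_two_parts v K K2 K3 i k2 k3 :
  cut_part v K -> good v K -> i \in K -> G v i -> cut_part v K2 -> cut_part v K3 ->
  [disjoint K & K2] -> [disjoint K & K3] -> [disjoint K2 & K3] ->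
  k2 \in K2 -> k3 \in K3 ->
  K :|: (K2 :|: K3) = ~: [set v] -> (q R G + 2 <= n)%N.
Proof.
move=> clK [S [b [u [x [[pS bK bN] [u0 uK uS] [xK xS]]]]]] iK vi cl2 cl3 d2 d3 d23 kK2 kK3 KE.
have [vK clK'] := clK; pose K' := K2 :|: K3.
have dK : [disjoint K & K'] by rewrite disjoint_sym disjoint_setU !(disjoint_sym _ K) d2.
have S0 : S != 0.
  by have := bN i iK; rewrite vi; apply: contraTneq => SS; rewrite -xS SS mulmx0 mxE eqxx.
have [s [z [k [s0 zS zK zk]]]] := block_eigenvector pS S0.
have [S' [pS' [x' xS' xK'] eigS']] := shift_block G s0 (supp_restr (K := K') (adj_row v)).
have vK' : v \notin K' by apply: (@cut_vertex_notin v K' K); rewrite finset.setUC.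
have pT := block_split clK dK KE pS pS'.
set b' := restr K' (adj_row v) in xS'.
have bK' : supp K' b' by exact: supp_restr.
have NT : nbr_pattern G v (b + b').
  apply: (split_nbrs KE) => // j jK'.
  by rewrite mxE jK' mxE pnatr_eq0 eqb0 negbK.
have bv : (b + b') 0 v = 0 by rewrite mxE bK ?bK' ?addr0.
have xv : (x + x') 0 v = 0 by rewrite mxE xK ?xK' ?addr0.
have m1 w : supp K w -> w *m (S + S') = w *m S.
  by move=> wK; rewrite mulmxDr (block_disj pS' wK) 1?disjoint_sym// addr0.
have m2 w : supp K' w -> w *m (S + S') = w *m S'.
  by move=> wK; rewrite mulmxDr (block_disj pS wK)// add0r.
have xT : (x + x') *m (S + S') = b + b' by rewrite mulmxDl m1// m2// xS xS'.
have [l ul] := nonzero_coord u0.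
have [symS _ _] := pS.
have ub : dot u (b + b') = 0.
  by rewrite dotDr (good_orth symS uS xS) (dot_disj uK bK' dK) addr0.
apply: (@q_two_nullities _ _ _ (border v (S + S') (b + b') (dot (x + x') (b + b'))) s) => //.
- exact: border_block.
- have := @nullity_pivoted _ _ (border v (S + S') (b + b') (dot (x + x') (b + b')))
    [:: (unit_row R v - (x + x'), v); (u, l)]; rewrite /=; apply.
    split=> //.
    + rewrite mxE unit_rowE eqxx [X in _ + X]mxE xv subr0; exact: oner_neq0.
    + by move=> w j; rewrite inE => /eqP[-> _]; rewrite uK.
  move=> w j; rewrite !inE => /orP[]/eqP[-> _]; first exact: border_null.
  by apply: border_null0; rewrite ?uK ?m1.
- have := @nullity_pivoted1 _ _ (border v (S + S') (b + b') (dot (x + x') (b + b')) - s%:M)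
    [:: (z, k); (indicator R K2, k2); (indicator R K3, k3)] (unit_row R v); rewrite /=; apply.
    have kK : k \in K by apply: contraNT zk => /zK ->.
    split=> // [w j|].
      rewrite !inE => /orP[]/eqP[-> _]; rewrite mxE.
        by rewrite (disjointFr d2 kK).
      by rewrite (disjointFr d3 kK).
    split=> // [|w j|].
    + by rewrite mxE kK2 oner_neq0.
    + by rewrite inE => /eqP[-> _]; rewrite mxE (disjointFr d23 kK2).
    + by split=> //; rewrite mxE kK3 oner_neq0.
  have i2 : supp K' (indicator R K2) by apply: (suppS (finset.subsetUl _ _)); exact: supp_ind.
  have i3 : supp K' (indicator R K3) by apply: (suppS (finset.subsetUr _ _)); exact: supp_ind.
  have clsub K0 : cut_part v K0 -> K0 \subset K' -> indicator R K0 *m S' = s *: indicator R K0.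
    move=> [_ clK0] sK0; apply: eigS' => // a c aK' cK' aK0 Gac.
    by apply: clK0 Gac _ => //; apply: contraNneq vK' => <-.
  move=> w j; rewrite !inE => /or3P[]/eqP[-> _]; apply: eigen_line.
  + by rewrite zK.
  + by rewrite m1.
  + by rewrite i2.
  + by rewrite m2// clsub// finset.subsetUl.
  + by rewrite i3.
  + by rewrite m2// clsub// finset.subsetUr.
Qed.

(** The null vectors of the two blocks, and the one that the preimage of the attachment
    vector provides, give nullity three. *)
Lemma q_two_good v K K' :
  cut_part v K -> good v K -> good v K' ->
  [disjoint K & K'] -> K :|: K' = ~: [set v] -> (q R G + 2 <= n)%N.
Proof.
move=> clK [S [b [u [x [[pS bK bN] [u0 uK uS] [xK xS]]]]]].
move=> [S' [b' [u' [x' [[pS' bK' bN'] [u0' uK' uS'] [xK' xS']]]]]] dK KE.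
have [vK clK'] := clK.
have vK' : v \notin K' by apply: (@cut_vertex_notin v K' K); rewrite finset.setUC.
have pT := block_split clK dK KE pS pS'.
have NT : nbr_pattern G v (b + b') by exact: (split_nbrs KE).
have bv : (b + b') 0 v = 0 by rewrite mxE bK ?bK' ?addr0.
have xv : (x + x') 0 v = 0 by rewrite mxE xK ?xK' ?addr0.
have dK' : [disjoint K' & K] by rewrite disjoint_sym.
have m1 w : supp K w -> w *m (S + S') = w *m S.
  by move=> wK; rewrite mulmxDr (block_disj pS' wK)// addr0.
have m2 w : supp K' w -> w *m (S + S') = w *m S'.
  by move=> wK; rewrite mulmxDr (block_disj pS wK)// add0r.
have xT : (x + x') *m (S + S') = b + b' by rewrite mulmxDl m1// m2// xS xS'.
have [l ul] := nonzero_coord u0; have [l' ul'] := nonzero_coord u0'.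
have [symS _ _] := pS; have [symS' _ _] := pS'.
have ub : dot u (b + b') = 0.
  by rewrite dotDr (good_orth symS uS xS) (dot_disj uK bK' dK) addr0.
have ub' : dot u' (b + b') = 0.
  by rewrite dotDr (good_orth symS' uS' xS') (dot_disj uK' bK dK') addr0.
apply: (@q_nullity _ _ _ (border v (S + S') (b + b') (dot (x + x') (b + b')))).
  exact: border_block.
have := @nullity_pivoted _ _ (border v (S + S') (b + b') (dot (x + x') (b + b')))
    [:: (unit_row R v - (x + x'), v); (u, l); (u', l')]; rewrite /=; apply.
  split=> [|w j|].
  + by rewrite mxE unit_rowE eqxx [X in _ + X]mxE xv subr0 oner_neq0.
  + by rewrite !inE => /orP[]/eqP[-> _]; rewrite ?uK ?uK'.
  + split=> // w j; rewrite inE => /eqP[-> _]; rewrite uK'//.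
    have lK : l \in K by apply: contraNT ul => /uK ->.
    by rewrite (disjointFr dK lK).
move=> w j; rewrite !inE => /or3P[]/eqP[-> _]; first exact: border_null.
  by apply: border_null0; rewrite ?uK ?m1.
by apply: border_null0; rewrite ?uK' ?m2.
Qed.

Lemma q_good_all v : good v (~: [set v]) -> (q R G + 1 <= n)%N.
Proof.
move=> [S [b [u [x [[pS bK bN] [u0 uK uS] [xK xS]]]]]].
have vK : v \notin ~: [set v] by rewrite !inE eqxx.
have bv : b 0 v = 0 by rewrite bK.
have [l ul] := nonzero_coord u0; have [symS _ _] := pS.
have ub := good_orth symS uS xS.
apply: (@q_nullity _ _ _ (border v S b (dot x b))).
  by apply: border_block => // i iv; apply: bN; rewrite !inE.
have := @nullity_pivoted _ _ (border v S b (dot x b))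
    [:: (unit_row R v - x, v); (u, l)]; rewrite /=; apply.
  split=> // [|w j].
  + by rewrite mxE unit_rowE eqxx mxE xK// subr0 oner_neq0.
  + by rewrite inE => /eqP[-> _]; rewrite uK.
move=> w j; rewrite !inE => /orP[]/eqP[-> _]; first by apply: border_null; rewrite ?xK.
by apply: border_null0; rewrite ?uK.
Qed.

(** Two neighbours of v allow an attachment vector of sum zero with the required nonzero
    entries. It is in the range of the Laplacian of the connected set K. *)
Lemma good_loop v K i j : connected G K -> i \in K -> j \in K -> i != j -> G v i -> G v j ->
  good v K.
Proof.
move=> cK iK jK ij vi vj.
pose m : R := \sum_(k in K | k != i) (G v k)%:R.
have m0 : m != 0.
  rewrite gt_eqF// /m (bigD1 j) ?jK 1?eq_sym//= vj ltr_pwDl// sumr_ge0// => k _.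
pose b : 'rV[R]_n := \row_k if k == i then - m else if k \in K then (G v k)%:R else 0.
have bK : supp K b.
  by move=> k kK; rewrite mxE (negPf kK); case: eqVneq kK => // ->; rewrite iK.
have [x xL xK] : exists2 x, x *m lap R G K = b & supp K x.
  apply: lap_range => //; rewrite (bigD1 i)//= mxE eqxx addrC; apply/eqP; rewrite subr_eq0.
  apply/eqP; apply: eq_bigr => k /andP[kK ki]; by rewrite mxE (negPf ki) kK.
exists (lap R G K), b, (indicator R K), x; split; split=> //.
- exact: lap_block.
- move=> k kK; rewrite mxE; case: (eqVneq k i) => [->|ki]; first by rewrite oppr_eq0 m0 vi.
  by rewrite kK pnatr_eq0 eqb0 negbK.
- by apply: contra_eq_neq (_ : indicator R K 0 i = 1) => [->|]; rewrite mxE ?iK// eq_sym oner_neq0.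
- exact: supp_ind.
- exact: lap_ind.
Qed.

(** If the unit vector of t is not in the range of S, adding 1 to the diagonal entry of S at
    t brings it there, and u remains a null vector because it vanishes at t. *)
Lemma good_pendant v K S u t : block G K S -> supp K u -> u != 0 -> u *m S = 0 -> u 0 t = 0 ->
  t \in K -> (forall i, i \in K -> G v i = (i == t)) -> good v K.
Proof.
move=> pS uK u0 uS ut tK vt; have [symS GS S0] := pS.
suff [S' [x [pS' uS' xS']]] : exists S' x, [/\ block G K S', u *m S' = 0 & x *m S' = unit_row R t].
  exists S', (unit_row R t), u, (restr K x); split; split=> //.
  - by move=> i; rewrite unit_rowE; case: eqVneq => // ->; rewrite tK.
  - by move=> i iK; rewrite unit_rowE pnatr_eq0 eqb0 negbK vt.
  - exact: supp_restr.
  - by rewrite (restr_mul _ pS').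
have [[x xS]|no] := boolp.pselect (exists x, x *m S = unit_row R t); first by exists S, x.
(* Failing to be in the range is witnessed by a null vector that does not vanish at t. *)
have [z [zS zt]] : exists z, z *m S = 0 /\ z 0 t != 0.
  apply: boolp.contrapT => nz; apply: no; apply: sym_range => // z zS.
  rewrite dot_unit_row; apply/eqP; apply: boolp.contrapT => /negP zt.
  by apply: nz; exists z.
pose S' := S + (unit_row R t)^T *m unit_row R t.
have mS' w : w *m S' = w *m S + w 0 t *: unit_row R t by rewrite mulmxDr mul_outer dot_unit_row.
have symS' : S'^T = S' by rewrite raddfD/= trmx_mul trmxK symS.
have [x xS'] : exists x, x *m S' = unit_row R t.
  apply: sym_range => // w wS'; rewrite dot_unit_row.
  have : dot (w *m S') z = 0 by rewrite wS' dot0l.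
  rewrite mS' dotDl dot_sym// zS dot0r add0r dotZl dotC dot_unit_row => /eqP.
  by rewrite mulf_eq0 (negPf zt) orbF => /eqP.
exists S', x; split=> //; last by rewrite mS' uS ut scale0r addr0.
split=> // [i j iK jK ij|i j iK].
  rewrite !mxE big_ord1 !mxE !eqxx /=; have [it|_] := eqVneq i t; last by rewrite mul0r addr0 GS.
  by rewrite -it (eq_sym j) (negPf ij) mulr0 addr0 GS.
rewrite !mxE big_ord1 !mxE !eqxx /= S0// add0r.
by case: eqVneq iK => [->|_ _]; rewrite ?tK// mul0r.
Qed.

End CutVertex.

(** * Pairs of semidefinite blocks *)

Section Poincare.
Variable R : realType.
Variable T : finType.
Variable r : rel T.

Definition energy (y : T -> R) := \sum_i \sum_(j | r i j) (y i - y j) ^+ 2.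

Lemma energy_ge0 y : 0 <= energy y.
Proof. by apply: sumr_ge0 => i _; apply: sumr_ge0 => j _; exact: sqr_ge0. Qed.

Lemma energy_edge y i j : r i j -> (y i - y j) ^+ 2 <= energy y.
Proof.
move=> rij; rewrite /energy (bigD1 i)//= (bigD1 j)//= -addrA lerDl addr_ge0//.
  by apply: sumr_ge0 => k _; exact: sqr_ge0.
by apply: sumr_ge0 => k _; apply: sumr_ge0 => l _; exact: sqr_ge0.
Qed.

(** The difference of the values at the ends of a path is the sum of the differences along
    its edges. *)
Lemma poincare_connect i j : connect r i j ->
  exists2 C : R, 0 <= C & forall y, (y i - y j) ^+ 2 <= C * energy y.
Proof.
move=> /connectP[s]; elim: s i => [|k s IH] i /=.
  by move=> _ ->; exists 0 => // y; rewrite subrr expr0n mul0r.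
move=> /andP[rik /IH{}IH] /IH[C C0 kj]; exists (2 + 2 * C) => [|y]; first by lra.
have := energy_edge y rik; have := kj y.
have : (y i - y j) ^+ 2 <= 2 * (y i - y k) ^+ 2 + 2 * (y k - y j) ^+ 2.
  rewrite -subr_ge0.
  have -> : 2 * (y i - y k) ^+ 2 + 2 * (y k - y j) ^+ 2 - (y i - y j) ^+ 2
          = ((y i - y k) - (y k - y j)) ^+ 2 by ring.
  exact: sqr_ge0.
by lra.
Qed.

Lemma poincare (K : {set T}) : (forall i j, i \in K -> j \in K -> connect r i j) ->
  exists2 C : R, 0 <= C &
    forall y, \sum_(i in K) \sum_(j in K) (y i - y j) ^+ 2 <= C * energy y.
Proof.
move=> cK.
have /boolp.choice[C HC] : forall ij : T * T, exists C : R, 0 <= C /\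
    (ij.1 \in K -> ij.2 \in K -> forall y, (y ij.1 - y ij.2) ^+ 2 <= C * energy y).
  move=> [i j]; have [/andP[iK jK]|nK] := boolP ((i \in K) && (j \in K)).
    by have [C C0 HC] := poincare_connect (cK i j iK jK); exists C.
  by exists 0; split=> // iK jK; rewrite iK jK in nK.
exists (\sum_(i in K) \sum_(j in K) C (i, j)) => [|y].
  by apply: sumr_ge0 => i _; apply: sumr_ge0 => j _; case: (HC (i, j)).
rewrite mulr_suml; apply: ler_sum => i iK; rewrite mulr_suml; apply: ler_sum => j jK.
by case: (HC (i, j)) => _; apply.
Qed.

End Poincare.

Section Pieces.
Variable R : realType.
Variable n : nat.
Variable G : graph n.
Implicit Types (S : 'M[R]_n) (K : {set 'I_n}) (v i j : 'I_n) (u x z b p : 'rV[R]_n).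

(** The input for q_two_diagonals before bordering: two blocks on K with the same
    off-diagonal part, one positive semidefinite with the line of p as kernel, the other
    negative semidefinite with the line of s as kernel and with the smaller diagonal. Pairs
    of definite blocks are the case p = s = 0. *)
Definition semidefinite_pair K p s Q1 (d : 'rV[R]_n) :=
  [/\ block G K Q1, supp K p /\ supp K s,
      (forall i, i \in K -> 0 < d 0 i) /\ supp K d,
      [/\ p *m Q1 = 0, forall z, 0 <= dot (z *m Q1) z &
          forall z, supp K z -> dot (z *m Q1) z = 0 -> exists a, z = a *: p]
    & [/\ s *m (Q1 - diag_mx d) = 0, forall z, dot (z *m (Q1 - diag_mx d)) z <= 0 &
          forall z, supp K z -> dot (z *m (Q1 - diag_mx d)) z = 0 -> exists a, z = a *: s]].

Lemma dot_diag d z : dot (z *m diag_mx d) z = \sum_i d 0 i * z 0 i ^+ 2.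
Proof. by rewrite dotE; apply: eq_bigr => i _; rewrite mul_mx_diag mxE; ring. Qed.

(** If L = Deg - A is the Laplacian of K, then L + 1 is positive definite, and lowering its
    diagonal by 2 Deg + 2 gives -(Deg + A) - 1, which is negative definite. *)
Lemma definite_pair K : exists Q1 d, semidefinite_pair K 0 0 Q1 d.
Proof.
pose deg i : R := \sum_(j in K) (G i j)%:R.
pose I_K : 'M[R]_n := diag_mx (indicator R K).
pose d : 'rV[R]_n := \row_i if i \in K then 2 * deg i + 2 else 0.
have deg0 i : 0 <= deg i by apply: sumr_ge0.
pose Q1 := lap R G K + I_K.
have zI z : dot (z *m I_K) z = \sum_(i in K) z 0 i ^+ 2.
  rewrite dot_diag [RHS]big_mkcond; apply: eq_bigr => i _; rewrite mxE.
  by case: ifP; rewrite ?mul1r ?mul0r.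
have zI0 z : 0 <= \sum_(i in K) z 0 i ^+ 2 by apply: sumr_ge0 => i _; exact: sqr_ge0.
have zIz z : supp K z -> \sum_(i in K) z 0 i ^+ 2 <= 0 -> exists a, z = a *: (0 : 'rV[R]_n).
  move=> zK z0; exists 0; rewrite scaler0; apply/rowP => i; rewrite mxE.
  have [iK|/zK//] := boolP (i \in K).
  have /eqP : \sum_(i in K) z 0 i ^+ 2 = 0 by apply/eqP; rewrite eq_le z0 zI0.
  rewrite psumr_eq0 => [/allP/(_ i (mem_index_enum _))|j _]; last exact: sqr_ge0.
  by rewrite iK /= sqrf_eq0 => /eqP.
have form1 z : \sum_(i in K) z 0 i ^+ 2 <= dot (z *m Q1) z.
  by rewrite mulmxDr dotDl zI lerDr lap_form_ge0.
have form2 z : dot (z *m (Q1 - diag_mx d)) z <= - \sum_(i in K) z 0 i ^+ 2.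
  rewrite mulmxBr mulmxDr dotBl dotDl zI lap_form dot_diag.
  have -> : \sum_i d 0 i * z 0 i ^+ 2 =
     2^-1 * \sum_(i in K) \sum_(j in K) 2 * ((G i j)%:R * (z 0 i ^+ 2 + z 0 j ^+ 2))
     + 2 * \sum_(i in K) z 0 i ^+ 2.
    have -> : \sum_(i in K) \sum_(j in K) 2 * ((G i j)%:R * (z 0 i ^+ 2 + z 0 j ^+ 2)) =
       \sum_(i in K) \sum_(j in K) 2 * ((G i j)%:R * z 0 i ^+ 2)
       + \sum_(i in K) \sum_(j in K) 2 * ((G j i)%:R * z 0 i ^+ 2).
      rewrite [X in _ = _ + X]exchange_big -big_split; apply: eq_bigr => i _.
      by rewrite -big_split; apply: eq_bigr => j _ /=; ring.
    have E (F : 'I_n -> 'I_n -> R) : (forall i j, F i j = (G i j)%:R) ->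
       \sum_(i in K) \sum_(j in K) 2 * (F i j * z 0 i ^+ 2) =
       \sum_(i in K) 2 * deg i * z 0 i ^+ 2.
      move=> FE; apply: eq_bigr => i _; rewrite /deg mulr_sumr mulr_suml.
      by apply: eq_bigr => j _; rewrite FE mulrA.
    rewrite (E (fun i j => (G i j)%:R))// (E (fun i j => (G j i)%:R)); last by move=> i j; rewrite adj_sym.
    rewrite -mulr2n -(mulr_natl (\sum_(i in K) _)) mulKf ?pnatr_eq0// mulr_sumr -big_split/=.
    rewrite [LHS](bigID (mem K)) /= [X in _ + X]big1 ?addr0 => [|i /negPf iK]; last first.
      by rewrite mxE iK mul0r.
    by apply: eq_bigr => i iK; rewrite mxE iK; ring.
  suff : \sum_(i in K) \sum_(j in K) (G i j)%:R * (z 0 i - z 0 j) ^+ 2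
      <= \sum_(i in K) \sum_(j in K) 2 * ((G i j)%:R * (z 0 i ^+ 2 + z 0 j ^+ 2)) by lra.
  apply: ler_sum => i _; apply: ler_sum => j _; case: (G i j); last by rewrite !mul0r mulr0.
  have := sqr_ge0 (z 0 i + z 0 j); rewrite !mul1r.
  have -> : (z 0 i + z 0 j) ^+ 2 = 2 * (z 0 i ^+ 2 + z 0 j ^+ 2) - (z 0 i - z 0 j) ^+ 2 by ring.
  by lra.
have s0 : supp K (0 : 'rV[R]_n) by move=> i _; rewrite mxE.
exists Q1, d; split.
- have [symL GL L0] := lap_block R G K; split.
  + by rewrite raddfD/= symL tr_diag_mx.
  + by move=> i j iK jK ij; rewrite mxE [X in _ + X]mxE (negPf ij) mulr0n addr0 GL.
  + by move=> i j iK; rewrite mxE L0// add0r !mxE (negPf iK) mul0rn.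
- by [].
- split=> [i iK|i /negPf iK]; rewrite mxE iK//; have := deg0 i; lra.
- split=> [|z|z zK z0]; first by rewrite mul0mx.
    exact: le_trans (zI0 z) (form1 z).
  by apply: zIz => //; have := form1 z; rewrite z0.
- split=> [|z|z zK z0]; first by rewrite mul0mx.
    by apply: le_trans (form2 z) _; rewrite oppr_le0.
  by apply: zIz => //; have := form2 z; rewrite z0 oppr_ge0.
Qed.

Definition bichrom K (c : 'I_n -> bool) : rel 'I_n :=
  fun i j => [&& i \in K, j \in K, G i j & c i != c j].

Definition connecting_coloring K c :=
  forall i j, i \in K -> j \in K -> connect (bichrom K c) i j.

Definition sign_row K (c : 'I_n -> bool) : 'rV[R]_n :=
  \row_i if i \in K then (-1) ^+ c i else 0.

(** Let bichromatic edges have weight 1 and the other edges a small weight e. With a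
    positive kernel vector p, all terms of the form are nonnegative. With the sign vector of
    the colouring as kernel vector, the bichromatic terms become negative, and by the
    Poincare inequality they outweigh the other terms. The diagonals differ at i by the sum
    of a_ij (p_j / p_i - s_j / s_i): a bichromatic edge contributes more than 1, and every
    other edge more than -e. *)
Lemma coloring_pair K c p k l : connecting_coloring K c -> k \in K -> l \in K -> k != l ->
  supp K p -> (forall i, i \in K -> 0 < p 0 i) ->
  exists Q1 d, semidefinite_pair K p (sign_row K c) Q1 d.
Proof.
move=> gc kK lK kl pK p0.
have [C C0 HC] := poincare R gc.
(* Small enough for the Poincare constant C and for at most n monochromatic edges at a
   vertex. *)
pose e : R := (2 * (C + n%:R + 1))^-1.
have e0 : 0 < e by rewrite invr_gt0; have := ler0n R n; lra.
have eE : e * (2 * (C + n%:R + 1)) = 1 by rewrite mulVf// gt_eqF//; have := ler0n R n; lra.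
clearbody e.
have [en eC] : e * n%:R < 1 /\ e * C <= 2^-1.
  have h1 := mulr_ge0 (ltW e0) C0; have h2 := mulr_ge0 (ltW e0) (ler0n R n).
  have h3 : 2 * (e * C) + 2 * (e * n%:R) + 2 * e = 1 by rewrite -[RHS]eE; ring.
  by split; lra.
pose a i j : R := if G i j then if c i != c j then 1 else e else 0.
have a0 i j : 0 <= a i j by rewrite /a; case: ifP => // _; case: ifP => // _; exact: ltW.
have wa : weights G K a.
  split=> [i j|i|i j _ _]; rewrite /a ?adj_irrefl//.
    by rewrite (adj_sym _ j) (eq_sym (c j)).
  by case: ifP => _; rewrite ?eqxx//; case: ifP => _; rewrite ?oner_neq0 ?(gt_eqF e0).
pose s := sign_row K c.
have sK : supp K s by move=> i /negPf iK; rewrite mxE iK.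
have s0 i : i \in K -> s 0 i != 0 by move=> iK; rewrite mxE iK signr_eq0.
have p0' i : i \in K -> p 0 i != 0 by move=> /p0; exact: lt0r_neq0.
have sij i j : i \in K -> j \in K -> s 0 i * s 0 j = if c i != c j then -1 else 1.
  by move=> iK jK; rewrite !mxE iK jK -signr_addb; case: (c i); case: (c j).
have sV i : i \in K -> (s 0 i)^-1 = s 0 i by move=> iK; rewrite mxE iK invr_sign.
pose d : 'rV[R]_n := \row_i if i \in K then
   \sum_(j in K) a i j * (p 0 j / p 0 i - s 0 j / s 0 i) else 0.
have Q2E : weighted_lap K a p - diag_mx d = weighted_lap K a s.
  by rewrite -(weighted_lap_sub wa p0' s0) opprB addrC subrK.
have constK (y : 'I_n -> R) : (forall i j, bichrom K c i j -> y i = y j) ->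
    forall i, i \in K -> y i = y k.
  move=> ye i iK; have /connectP[t] := gc i k iK kK.
  elim: t i {iK} => [|j t IH] i /=; first by move=> _ ->.
  by move=> /andP[/ye-> jt] tE; apply: IH.
exists (weighted_lap K a p), d; split.
- exact: weighted_lap_block.
- by [].
- split=> [i iK|i /negPf iK]; rewrite mxE iK//.
  have [j ij] : exists j, bichrom K c i j.
    have [m mK im] : exists2 m, m \in K & i != m.
      by have [ik|ik] := eqVneq i k; [exists l; rewrite ?ik|exists k].
    have /connectP[[|j t] /=] := gc i m iK mK; first by move=> _ mi; rewrite mi eqxx in im.
    by move=> /andP[ij _] _; exists j.
  have /and4P[_ jK Gij cij] := ij.
  have term m : m \in K -> - e <= a i m * (p 0 m / p 0 i - s 0 m / s 0 i).
    move=> mK; rewrite sV// sij//.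
    have : 0 < p 0 m / p 0 i by rewrite divr_gt0 ?p0.
    rewrite /a (eq_sym (c m)); case: ifP => _; last by rewrite mul0r oppr_le0 ltW.
    by case: ifP => _; nra.
  rewrite (bigD1 j)//=.
  have tj : 1 <= a i j * (p 0 j / p 0 i - s 0 j / s 0 i).
    rewrite sV// sij// /a Gij cij eq_sym cij mul1r opprK lerDr.
    by rewrite ltW// divr_gt0 ?p0.
  have : - (e * n%:R) <= \sum_(m in K | m != j) a i m * (p 0 m / p 0 i - s 0 m / s 0 i).
    apply: le_trans (_ : \sum_(m in K | m != j) - e <= _); last first.
      by apply: ler_sum => m /andP[mK _]; exact: term.
    rewrite sumr_const -[X in _ <= X]mulr_natr mulNr lerN2.
    apply: ler_wpM2l; rewrite ?(ltW e0)// ler_nat.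
    by rewrite -[X in (_ <= X)%N]card_ord max_card.
  by lra.
- split=> [|z|z zK].
  + exact: (weighted_lap_ker wa p0').
  + rewrite (weighted_lap_form _ wa p0') mulr_ge0 ?invr_ge0//.
    apply: sumr_ge0 => i iK; apply: sumr_ge0 => j jK.
    by rewrite mulr_ge0 ?sqr_ge0// mulr_ge0// mulr_ge0 ?ltW ?p0.
  + rewrite (weighted_lap_form _ wa p0') => /eqP; rewrite mulf_eq0 invr_eq0 pnatr_eq0 /= => z0.
    have pos i j : i \in K -> j \in K ->
        0 <= a i j * (p 0 i * p 0 j) * (z 0 i / p 0 i - z 0 j / p 0 j) ^+ 2.
      by move=> iK jK; rewrite mulr_ge0 ?sqr_ge0// mulr_ge0// mulr_ge0 ?ltW ?p0.
    exists (z 0 k / p 0 k); apply/rowP => i; rewrite mxE.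
    have [iK|iK] := boolP (i \in K); last by rewrite (zK i iK) (pK i iK) mulr0.
    rewrite -(constK (fun i => z 0 i / p 0 i) _ i iK) ?divfK ?p0'//.
    move=> {iK}i j /and4P[iK jK Gij cij]; apply/eqP; rewrite -subr_eq0.
    move: z0; rewrite psumr_eq0 => [/allP/(_ i (mem_index_enum _))|m mK]; last first.
      by apply: sumr_ge0 => l' l'K; exact: pos.
    rewrite iK /= psumr_eq0 => [/allP/(_ j (mem_index_enum _))|m mK]; last exact: pos.
    by rewrite jK /= /a Gij cij mul1r !mulf_eq0 (negPf (p0' i iK)) (negPf (p0' j jK)) /= orbb.
- have form2 z : dot (z *m weighted_lap K a s) z
      <= - (4^-1 * energy (bichrom K c) (fun i => z 0 i / s 0 i)).
    set y := fun i => _; rewrite (weighted_lap_form _ wa s0).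
    have -> : \sum_(i in K) \sum_(j in K)
        a i j * (s 0 i * s 0 j) * (z 0 i / s 0 i - z 0 j / s 0 j) ^+ 2 =
        \sum_(i in K) \sum_(j in K) (if bichrom K c i j then - (y i - y j) ^+ 2 else 0)
      + \sum_(i in K) \sum_(j in K) (if G i j && (c i == c j) then e * (y i - y j) ^+ 2 else 0).
      rewrite -big_split; apply: eq_bigr => i iK; rewrite -big_split; apply: eq_bigr => j jK.
      rewrite sij// /a /bichrom iK jK /=; case: (G i j) => /=; last by rewrite !mul0r addr0.
      by case: eqVneq => /= _; rewrite /y; ring.
    have -> : \sum_(i in K) \sum_(j in K) (if bichrom K c i j then - (y i - y j) ^+ 2 else 0)
       = - energy (bichrom K c) y.
      rewrite /energy -sumrN [LHS]big_mkcond; apply: eq_bigr => i _; case: ifPn => iK.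
        rewrite -sumrN [LHS]big_mkcond [RHS]big_mkcond; apply: eq_bigr => j _.
        by rewrite /bichrom iK /=; case: (j \in K).
      by rewrite big_pred0 ?oppr0// => j; rewrite /bichrom (negPf iK).
    have : \sum_(i in K) \sum_(j in K) (if G i j && (c i == c j) then e * (y i - y j) ^+ 2 else 0)
       <= e * C * energy (bichrom K c) y.
      rewrite -mulrA; apply: le_trans (_ : _ <= e * \sum_(i in K) \sum_(j in K) (y i - y j) ^+ 2) _.
        rewrite mulr_sumr; apply: ler_sum => i _; rewrite mulr_sumr; apply: ler_sum => j _.
        by case: ifP => // _; rewrite mulr_ge0 ?sqr_ge0// ltW.
      by apply: ler_wpM2l; rewrite ?HC// ltW.
    have : e * C * energy (bichrom K c) y <= 2^-1 * energy (bichrom K c) y.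
      by apply: ler_wpM2r => //; exact: energy_ge0.
    by lra.
  rewrite Q2E; split=> [|z|z zK z0]; first exact: (weighted_lap_ker wa s0).
    apply: le_trans (form2 z) _; rewrite oppr_le0 mulr_ge0 ?energy_ge0// invr_ge0//.
  exists (z 0 k / s 0 k); apply/rowP => i; rewrite mxE.
  have [iK|iK] := boolP (i \in K); last by rewrite (zK i iK) (sK i iK) mulr0.
  rewrite -(constK (fun i => z 0 i / s 0 i) _ i iK) ?divfK ?s0//.
  move=> {iK}i j bij; apply/eqP; rewrite -subr_eq0 -sqrf_eq0 eq_le sqr_ge0 andbT.
  have := energy_edge (fun i => z 0 i / s 0 i) bij.
  have := form2 z; rewrite z0; have := energy_ge0 (bichrom K c) (fun i => z 0 i / s 0 i).
  by lra.
Qed.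

End Pieces.

(** * Neighbours of equal colour *)

Section Centre.
Variable R : realType.
Variable n : nat.
Variable G : graph n.
Implicit Types (S : 'M[R]_n) (K : {set 'I_n}) (v i j : 'I_n) (u x z b p d : 'rV[R]_n).

Lemma block_sub_diag K Q d : block G K Q -> supp K d -> block G K (Q - diag_mx d).
Proof.
move=> [symQ GQ Q0] dK; split; first by rewrite raddfB/= symQ tr_diag_mx.
  by move=> i j iK jK ij; rewrite !mxE (negPf ij) mulr0n subr0 GQ.
by move=> i j iK; rewrite !mxE Q0// dK// mul0rn subrr.
Qed.

Lemma nullity2_centre v S b u x : block G (~: [set v]) S -> b 0 v = 0 ->
  u != 0 -> u 0 v = 0 -> u *m S = 0 -> dot u b = 0 ->
  x 0 v = 0 -> x *m S = b -> (1 < \rank (kermx (border v S b (dot x b))))%N.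
Proof.
move=> pS bv u0 uv uS ub xv xS; have [l ul] := nonzero_coord u0.
have := @nullity_pivoted _ _ (border v S b (dot x b)) [:: (unit_row R v - x, v); (u, l)].
rewrite /=; apply.
  split=> // [|w j]; last by rewrite inE => /eqP[-> _].
  by rewrite mxE unit_rowE eqxx mxE xv subr0 oner_neq0.
move=> w j; rewrite !inE => /orP[]/eqP[-> _]; first exact: border_null pS _ _ _.
exact: border_null0.
Qed.

(** Both bordered matrices have nullity two, with the diagonal entries x1.b and x2.b at v.
    The last hypothesis makes the difference of the diagonals positive at v as well. *)
Lemma q_two_borders v Q d b u1 u2 x1 x2 : block G (~: [set v]) Q ->
  (forall i, i != v -> 0 < d 0 i) -> d 0 v = 0 ->
  b 0 v = 0 -> nbr_pattern G v b ->
  [/\ u1 != 0, u1 0 v = 0, u1 *m Q = 0 & dot u1 b = 0] ->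
  [/\ u2 != 0, u2 0 v = 0, u2 *m (Q - diag_mx d) = 0 & dot u2 b = 0] ->
  x1 0 v = 0 -> x1 *m Q = b -> x2 0 v = 0 -> x2 *m (Q - diag_mx d) = b ->
  dot x2 b < dot x1 b -> (q R G + 2 <= n)%N.
Proof.
move=> pQ d0 dv bv bN [u10 u1v u1Q u1b] [u20 u2v u2Q u2b] x1v x1Q x2v x2Q x12.
have pQ2 : block G (~: [set v]) (Q - diag_mx d).
  by apply: block_sub_diag => // i; rewrite !inE negbK => /eqP ->.
apply: (@q_two_diagonals _ _ _ (border v Q b (dot x1 b))
   (border v (Q - diag_mx d) b (dot x2 b)) (d + (dot x1 b - dot x2 b) *: unit_row R v)).
- exact: border_block.
- move=> i; rewrite mxE [X in _ + X]mxE unit_rowE; case: eqVneq => [->|/d0 di].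
    by rewrite dv add0r mulr1 subr_gt0.
  by rewrite mulr0 addr0.
- have -> : diag_mx (d + (dot x1 b - dot x2 b) *: unit_row R v) =
      diag_mx d + (dot x1 b - dot x2 b) *: ((unit_row R v)^T *m unit_row R v).
    apply/matrixP => i j; rewrite !mxE big_ord1 !mxE !eqxx /=.
    case: (eqVneq i j) => [<-|ij]; first by rewrite !mulr1n; case: (i == v); rewrite ?mulr1 ?mulr0.
    rewrite !mulr0n add0r; case: (eqVneq i v) => [iv|_]; last by rewrite mul0r mulr0.
    by rewrite -iv (eq_sym j) (negPf ij) !mulr0.
  rewrite /border scalerBl; set E := (unit_row R v)^T *m unit_row R v; set B := (unit_row R v)^T *m b.
  set B' := b^T *m unit_row R v; set D := diag_mx d.
  by apply/matrixP => i j; rewrite !mxE; ring.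
- exact: nullity2_centre u1v u1Q u1b x1v x1Q.
- exact: nullity2_centre u2v u2Q u2b x2v x2Q.
Qed.

(** If x Q = b, then x.b is the value at x of the positive semidefinite form of Q. *)
Lemma pair_range1 K p s Q d b : semidefinite_pair G K p s Q d -> supp K b -> dot p b = 0 ->
  exists x, [/\ supp K x, x *m Q = b, 0 <= dot x b & b != 0 -> 0 < dot x b].
Proof.
move=> [pQ [pK _] _ [pQ0 Qge0 Qker] _] bK pb; have [symQ _ _] := pQ.
have [|x xQ] := sym_range (b := b) symQ.
  move=> z zQ; have [|a za] := Qker (restr K z) (supp_restr _).
    by rewrite (restr_mul _ pQ) zQ dot0l.
  have -> : dot z b = dot (restr K z) b.
    rewrite !dotE; apply: eq_bigr => i _; rewrite mxE.
    by case: ifPn => // iK; rewrite bK// !mulr0.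
  by rewrite za dotZl pb mulr0.
have rQ : restr K x *m Q = b by rewrite (restr_mul _ pQ).
have x0 : 0 <= dot (restr K x) b by rewrite -[X in dot _ X]rQ dotC; exact: Qge0.
exists (restr K x); split=> //; first exact: supp_restr.
move=> b0; rewrite lt_def x0 andbT; apply: contraNneq b0 => xb.
have [|a xa] := Qker (restr K x) (supp_restr _).
  by rewrite rQ dotC xb.
by rewrite -rQ xa -scalemxAl pQ0 scaler0.
Qed.

Lemma pair_range2 K p s Q d b : semidefinite_pair G K p s Q d -> supp K b -> dot s b = 0 ->
  exists x, [/\ supp K x, x *m (Q - diag_mx d) = b & dot x b <= 0].
Proof.
move=> [pQ [_ sK] [d0 dK] _ [sQ0 Qle0 Qker]] bK sb.
have pQ2 := block_sub_diag pQ dK; have [symQ _ _] := pQ2.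
have [|x xQ] := sym_range (b := b) symQ.
  move=> z zQ; have [|a za] := Qker (restr K z) (supp_restr _).
    by rewrite (restr_mul _ pQ2) zQ dot0l.
  have -> : dot z b = dot (restr K z) b.
    rewrite !dotE; apply: eq_bigr => i _; rewrite mxE.
    by case: ifPn => // iK; rewrite bK// !mulr0.
  by rewrite za dotZl sb mulr0.
have rQ : restr K x *m (Q - diag_mx d) = b by rewrite (restr_mul _ pQ2).
exists (restr K x); split=> //; first exact: supp_restr.
by rewrite -[X in dot _ X]rQ dotC; exact: Qle0.
Qed.

Lemma split_diag (Q Q' : 'M[R]_n) d d' :
  (Q + Q') - diag_mx (d + d') = (Q - diag_mx d) + (Q' - diag_mx d').
Proof. by rewrite raddfD/= opprD addrACA. Qed.

(** The rest of G - v receives a definite pair. It moves x1.b - x2.b in the right direction,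
    and it does so strictly if v has a neighbour outside C. *)
Lemma q_pair v C Q d b u1 u2 x1 x2 : cut_part G v C -> block G C Q -> supp C d ->
  (forall i, i \in C -> 0 < d 0 i) -> supp C b -> (forall i, i \in C -> (b 0 i != 0) = G v i) ->
  [/\ u1 != 0, supp C u1, u1 *m Q = 0 & dot u1 b = 0] ->
  [/\ u2 != 0, supp C u2, u2 *m (Q - diag_mx d) = 0 & dot u2 b = 0] ->
  supp C x1 -> x1 *m Q = b -> supp C x2 -> x2 *m (Q - diag_mx d) = b ->
  dot x2 b <= dot x1 b ->
  dot x2 b < dot x1 b \/ (exists2 i, i \notin v |: C & G v i) -> (q R G + 2 <= n)%N.
Proof.
move=> clC pQ dC d0 bC bN [u10 u1C u1Q u1b] [u20 u2C u2Q u2b] x1C x1Q x2C x2Q x12 strict.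
have [vC _] := clC; pose C' := ~: (v |: C).
have dis : [disjoint C & C'] by rewrite disjoints_subset finset.setCK finset.subsetUr.
have dis' : [disjoint C' & C] by rewrite disjoint_sym.
have CE : C :|: C' = ~: [set v].
  by apply/setP => i; rewrite !inE negb_or; case: eqVneq => [->|_]; rewrite ?(negPf vC) ?orbN.
have [Q' [d' pair']] := definite_pair R G C'.
have [pQ' _ [d'0 d'C] _ _] := pair'.
pose b' := restr C' (adj_row R G v).
have b'C : supp C' b' by exact: supp_restr.
have b'N i : i \in C' -> (b' 0 i != 0) = G v i.
  by move=> iC'; rewrite mxE iC' mxE pnatr_eq0 eqb0 negbK.
have [|x1' [x1C' x1Q' x1b' x1s]] := pair_range1 pair' b'C; first exact: dot0l.
have [|x2' [x2C' x2Q' x2b']] := pair_range2 pair' b'C; first exact: dot0l.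
have vC' : v \notin C' by rewrite !inE eqxx.
have pT := block_split clC dis CE pQ pQ'.
have dT := split_diag Q Q' d d'.
have pQ2 := block_sub_diag pQ dC; have pQ2' := block_sub_diag pQ' d'C.
have at_v w w' : supp C w -> supp C' w' -> (w + w') 0 v = 0.
  by move=> wC wC'; rewrite mxE wC// wC'// addr0.
have dotDD w w' : supp C w -> supp C' w' -> dot (w + w') (b + b') = dot w b + dot w' b'.
  move=> wC wC'; rewrite dotDl !dotDr (dot_disj wC b'C dis) (dot_disj wC' bC dis').
  by rewrite addr0 add0r.
have s0 : supp C' (0 : 'rV[R]_n) by move=> i _; rewrite mxE.
apply: (@q_two_borders v (Q + Q') (d + d') (b + b') (u1 + 0) (u2 + 0) (x1 + x1') (x2 + x2')) => //.
- move=> i iv; rewrite mxE; have : i \in C :|: C' by rewrite CE !inE.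
  rewrite inE => /orP[] iC.
    by rewrite [X in _ + X]d'C ?addr0 ?d0// (disjointFr dis iC).
  by rewrite dC ?add0r ?d'0// (disjointFl dis iC).
- exact: at_v.
- exact: at_v.
- exact: (split_nbrs CE).
- split; [by rewrite addr0|exact: at_v| |by rewrite dotDD// u1b dot0l addr0].
  by rewrite addr0 mulmxDr u1Q (block_disj pQ' u1C dis') addr0.
- split; [by rewrite addr0|exact: at_v| |by rewrite dotDD// u2b dot0l addr0].
  by rewrite addr0 dT mulmxDr u2Q (block_disj pQ2' u2C dis') addr0.
- exact: at_v.
- rewrite mulmxDr !mulmxDl x1Q x1Q' (block_disj pQ' x1C dis') (block_disj pQ x1C' dis).
  by rewrite addr0 add0r.
- exact: at_v.
- rewrite dT mulmxDr !mulmxDl x2Q x2Q' (block_disj pQ2' x2C dis') (block_disj pQ2 x2C' dis).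
  by rewrite addr0 add0r.
- rewrite !dotDD//; case: strict => [lt12|[i iC vi]].
    by rewrite ltr_leD// (le_trans x2b').
  rewrite ler_ltD// (le_lt_trans x2b')// x1s//.
  have iC' : i \in C' by rewrite inE.
  by apply: contraTneq vi => b'0; rewrite -b'N// b'0 mxE eqxx.
Qed.

(** The attachment vector is b_i = g_i s_i, where s is the sign vector and the entries g_i
    on the neighbours of v have sum zero and are positive except at l. So b is orthogonal to
    s. As k and l have the same colour, b_k and b_l have opposite signs, and a positive
    vector p orthogonal to b is obtained by adjusting its entries at k and l. *)
Lemma q_same_colour v C c k l : cut_part G v C -> connecting_coloring G C c ->
  k \in C -> l \in C -> k != l -> G v k -> G v l -> c k = c l -> (q R G + 2 <= n)%N.
Proof.
move=> clC gc kC lC kl vk vl ckl; have [vC _] := clC.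
pose s := sign_row R C c.
have sC : supp C s by move=> i /negPf iC; rewrite mxE iC.
have ss i : i \in C -> s 0 i * s 0 i = 1.
  by move=> iC; rewrite mxE iC -signr_addb addbb.
have skl : s 0 k = s 0 l by rewrite !mxE kC lC ckl.
pose m : R := \sum_(i in C | i != l) (G v i)%:R.
have m1 : 1 <= m.
  by rewrite /m (bigD1 k) ?kC//= vk lerDl sumr_ge0.
pose g i : R := if i == l then - m else (G v i)%:R.
pose b : 'rV[R]_n := \row_i (g i * s 0 i).
have bC : supp C b by move=> i iC; rewrite mxE sC// mulr0.
(* The contribution of all i other than k and l to p.b, which the entries of p at k and l
   have to cancel. *)
pose B := \sum_(i | (i \in C) && (i != l) && (i != k)) b 0 i.
pose p : 'rV[R]_n := \row_i if i == k then m * (`|B| + 1) - s 0 k * B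
   else if i == l then `|B| + 1 else if i \in C then 1 else 0.
have pC : supp C p.
  by move=> i iC; rewrite mxE (negPf iC); case: eqVneq iC => [->|_]; [rewrite kC|case: eqVneq => // ->; rewrite lC].
have lk : l != k by rewrite eq_sym.
have sB : s 0 k * B <= `|B|.
  apply: le_trans (ler_norm _) _; rewrite normrM.
  have -> : `|s 0 k| = 1 by rewrite mxE kC normr_sign.
  by rewrite mul1r.
have p0 i : i \in C -> 0 < p 0 i.
  move=> iC; have B0 := normr_ge0 B; rewrite mxE; case: ifP => _; first by nra.
  by case: ifP => _; [lra|rewrite iC].
have pb : dot p b = 0.
  have -> : dot p b = \sum_(i in C) p 0 i * b 0 i.
    by rewrite dotE [RHS]big_mkcond; apply: eq_bigr => i _; case: ifPn => // iC; rewrite pC// mul0r.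
  rewrite (bigD1 l)//= (bigD1 k)/=; last by rewrite kC.
  have -> : \sum_(i | (i \in C) && (i != l) && (i != k)) p 0 i * b 0 i = B.
    apply: eq_bigr => i /andP[/andP[iC il] ik].
    by rewrite [p 0 i]mxE (negPf il) (negPf ik) iC mul1r.
  rewrite ![p 0 _]mxE ![b 0 _]mxE /g !eqxx (negPf lk) (negPf kl) vk -skl.
  have := ss k kC; set sk := s 0 k => sk1; rewrite mul1r mulrBl.
  have -> : sk * B * sk = B by rewrite mulrAC sk1 mul1r.
  by ring.
have sb : dot s b = 0.
  have -> : dot s b = \sum_(i in C) g i.
    rewrite dotE [RHS]big_mkcond; apply: eq_bigr => i _; case: ifPn => iC.
      by rewrite [b 0 i]mxE mulrCA ss// mulr1.
    by rewrite sC// mul0r.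
  rewrite (bigD1 l)//= /g eqxx addrC; apply/eqP; rewrite subr_eq0; apply/eqP.
  by apply: eq_bigr => i /andP[_ /negPf ->].
have [Q [d pair]] := coloring_pair gc kC lC kl pC p0.
have [pQ _ [d0 dC] [pQ0 _ _] [sQ0 _ _]] := pair.
have [x1 [x1C x1Q _ x1b]] := pair_range1 pair bC pb.
have [x2 [x2C x2Q x2b]] := pair_range2 pair bC sb.
have bN i : i \in C -> (b 0 i != 0) = G v i.
  move=> iC; have si : s 0 i != 0.
    by apply: contra_eq_neq (ss i iC) => ->; rewrite mul0r eq_sym oner_neq0.
  rewrite [b 0 i]mxE mulf_eq0 (negPf si) orbF /g; case: (eqVneq i l) => [->|_].
    by rewrite oppr_eq0 gt_eqF ?vl// (lt_le_trans ltr01).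
  by rewrite pnatr_eq0 eqb0 negbK.
have b0 : b != 0.
  by have := bN k kC; rewrite vk; apply: contraTneq => ->; rewrite mxE eqxx.
have x12 : dot x2 b < dot x1 b by apply: le_lt_trans x2b (x1b b0).
apply: (q_pair (u1 := p) (u2 := s) clC pQ dC d0 bC bN _ _ x1C x1Q x2C x2Q (ltW x12)); last by left.
- split=> //; have := p0 k kC; apply: contraTneq => ->; by rewrite mxE ltxx.
- split=> //; have := ss k kC; apply: contra_eq_neq => ->; by rewrite mxE mul0r eq_sym oner_neq0.
Qed.

End Centre.

(** * Gluing across a bridge *)

Section Bridge.
Variable R : realType.
Variable n : nat.
Variable G : graph n.
Implicit Types (S : 'M[R]_n) (K X Y : {set 'I_n}) (v i j : 'I_n) (u z b p d : 'rV[R]_n).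

(** The rank-one term g^T g accounts for the edge xy and kills every vector with equal
    entries at x and y. *)
Lemma glue_null X Y QX QY p q' x y : block G X QX -> block G Y QY -> [disjoint X & Y] ->
  supp X p -> p *m QX = 0 -> supp Y q' -> q' *m QY = 0 -> x \in X -> y \in Y -> p 0 x = q' 0 y ->
  let g := unit_row R x - unit_row R y in (p + q') *m (QX + QY + g^T *m g) = 0.
Proof.
move=> pX pY XY pXs pQ qYs qQ xX yY pq g.
have YX : [disjoint Y & X] by rewrite disjoint_sym.
rewrite mulmxDr mul_outer dotBr !dot_unit_row !mxE.
rewrite (pXs y) ?(disjointFl XY yY)// (qYs x) ?(disjointFr XY xX)// pq addr0 add0r subrr scale0r addr0.
rewrite mulmxDr !mulmxDl pQ qQ (block_disj pX qYs XY) (block_disj pY pXs YX).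
by rewrite !addr0.
Qed.

(** A unit flow from x1 to x2 is composed of a flow in X, the edge xy and a flow in Y. A
    multiple of the null vector p shifts the potential on X so that the drop across xy is t.
    The edge contributes 1 to the energy, for either sign t. *)
Lemma glue_flow X Y QX QY p t x1 x y x2 eX eY :
  block G X QX -> block G Y QY -> [disjoint X & Y] ->
  supp X p -> p *m QX = 0 -> p 0 x != 0 -> t * t = 1 ->
  supp X eX -> eX *m QX = unit_row R x1 - t *: unit_row R x ->
  supp Y eY -> eY *m QY = t *: unit_row R y - unit_row R x2 ->
  x1 \in X -> x \in X -> y \in Y -> x2 \in Y -> p 0 x1 = t * p 0 x ->
  let g := unit_row R x - unit_row R y in
  exists2 e, e *m (QX + QY + g^T *m g) = unit_row R x1 - unit_row R x2 & supp (X :|: Y) e /\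
    dot e (unit_row R x1 - unit_row R x2) = dot eX (unit_row R x1 - t *: unit_row R x)
       + dot eY (t *: unit_row R y - unit_row R x2) + 1.
Proof.
move=> pX pY XY pXs pQ px tt eXs eXQ eYs eYQ x1X xX yY x2Y px1 g.
have YX : [disjoint Y & X] by rewrite disjoint_sym.
pose k := (t - eX 0 x + eY 0 y) / p 0 x.
pose e := eX + k *: p + eY.
have [xY yX x1Y x2X] : [/\ x \notin Y, y \notin X, x1 \notin Y & x2 \notin X].
  by rewrite (disjointFr XY xX) (disjointFl XY yY) (disjointFr XY x1X) (disjointFl XY x2Y).
have eg : dot e g = t.
  rewrite dotBr !dot_unit_row !mxE (eYs x)// (eXs y)// (pXs y)// /k.
  by field.
have kpQ : (k *: p) *m QX = 0 by rewrite -scalemxAl pQ scaler0.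
have kps : supp X (k *: p) by exact: suppZ.
exists e; last split.
- rewrite mulmxDr mul_outer eg /e mulmxDr !mulmxDl eXQ eYQ kpQ.
  rewrite (block_disj pX eYs XY) (block_disj pY eXs YX) (block_disj pY kps YX).
  rewrite /g; apply/rowP => i; rewrite !mxE; ring.
- rewrite /e; apply: suppD; first apply: suppD; first apply: suppS eXs.
  + exact: finset.subsetUl.
  + by apply: suppS kps; exact: finset.subsetUl.
  + by apply: suppS eYs; exact: finset.subsetUr.
- have -> : unit_row R x1 - unit_row R x2 = (unit_row R x1 - t *: unit_row R x) + (t *: unit_row R y - unit_row R x2) + t *: g.
    by rewrite /g; apply/rowP => i; rewrite !mxE; ring.
  rewrite dotDr dotZr eg tt; congr (_ + 1).
  rewrite /e dotDr !dotDl dotZl.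
  have -> : dot p (unit_row R x1 - t *: unit_row R x) = 0.
    by rewrite dotBr dotZr !dot_unit_row px1 subrr.
  have -> : dot eY (unit_row R x1 - t *: unit_row R x) = 0.
    by rewrite dotBr dotZr !dot_unit_row !eYs// mulr0 subrr.
  have -> : dot eX (t *: unit_row R y - unit_row R x2) = 0.
    by rewrite dotBr dotZr !dot_unit_row !eXs// mulr0 subrr.
  rewrite dotZl.
  have -> : dot p (t *: unit_row R y - unit_row R x2) = 0.
    by rewrite dotBr dotZr !dot_unit_row !pXs// mulr0 subrr.
  by rewrite !mulr0 !addr0 !add0r.
Qed.

(** The pairs on X and Y, with constant positive kernel vectors, are glued by the same term
    for the edge xy. The attachment vector of opposite units at x1 and x2 is orthogonal to
    the constant vector and, since these vertices have the same colour, to the sign vector.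
    By glue_flow the edge contributes equally to both energies, so it drops out of the
    comparison of the energies, which the pair on X makes strict if x1 and x differ. *)
Lemma q_bridge v X Y c x1 x y x2 m1 m2 :
  cut_part G v (X :|: Y) -> [disjoint X & Y] -> connecting_coloring G X c -> connecting_coloring G Y c ->
  x1 \in X -> x \in X -> y \in Y -> x2 \in Y ->
  m1 \in X -> m1 != x -> m2 \in Y -> m2 != y ->
  (forall i j, i \in X -> j \in Y -> G i j = (i == x) && (j == y)) ->
  (forall i, i \in X -> G v i = (i == x1)) -> (forall i, i \in Y -> G v i = (i == x2)) ->
  c x = c y -> c x1 = c x2 ->
  x1 != x \/ (exists2 i, i \notin v |: (X :|: Y) & G v i) -> (q R G + 2 <= n)%N.
Proof.
move=> clC XY gX gY x1X xX yY x2Y m1X m1x m2Y m2y GXY vX vY cxy c12 strict.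
have YX : [disjoint Y & X] by rewrite disjoint_sym.
have one_gt0 K i : i \in K -> 0 < indicator R K 0 i by move=> iK; rewrite mxE iK ltr01.
have [QX [dX pairX]] := coloring_pair gX m1X xX m1x (@supp_ind R _ X) (one_gt0 X).
have [QY [dY pairY]] := coloring_pair gY m2Y yY m2y (@supp_ind R _ Y) (one_gt0 Y).
have [pQX [pX sX] [dX0 dXs] [pX0 _ _] [sX0 _ _]] := pairX.
have [pQY [pY sY] [dY0 dYs] [pY0 _ _] [sY0 _ _]] := pairY.
have [xY yX x1Y x2X] : [/\ x \notin Y, y \notin X, x1 \notin Y & x2 \notin X].
  by rewrite (disjointFr XY xX) (disjointFl XY yY) (disjointFr XY x1X) (disjointFl XY x2Y).
pose C := X :|: Y; pose g := unit_row R x - unit_row R y.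
pose b := unit_row R x1 - unit_row R x2.
pose Q := QX + QY + g^T *m g.
pose d := dX + dY.
pose s1 : R := (-1) ^+ c x1 * (-1) ^+ c x.
have s11 : s1 * s1 = 1.
  by rewrite /s1 -signr_addb -signr_addb addbb.
have QE2 : Q - diag_mx d = (QX - diag_mx dX) + (QY - diag_mx dY) + g^T *m g.
  by rewrite /Q /d raddfD/=; apply/matrixP => i j; rewrite !mxE; ring.
have pQ : block G C Q.
  have [symX GX X0] := pQX; have [symY GY Y0] := pQY.
  have symg : (g^T *m g)^T = g^T *m g by rewrite trmx_mul trmxK.
  have symQ : Q^T = Q by rewrite /Q 2!raddfD/= symX symY symg.
  split.
  - exact: symQ.
  - move=> i j; rewrite !inE.
    have gE k : g 0 k = (k == x)%:R - (k == y)%:R by rewrite !mxE !eqxx.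
    have outer k l : (g^T *m g) k l = g 0 k * g 0 l by rewrite mxE big_ord1 mxE.
    have cross k l : k \in X -> l \in Y -> k != l -> (Q k l != 0) = G k l.
      move=> kX lY _; rewrite mxE outer !gE [(QX + QY) k l]mxE.
      have kY : k \notin Y by rewrite (disjointFr XY kX).
      have lX : l \notin X by rewrite (disjointFl XY lY).
      rewrite (symE symX) X0// Y0// GXY// !add0r.
      have -> : (k == y) = false by apply: contraNF kY => /eqP->.
      have -> : (l == x) = false by apply: contraNF lX => /eqP->.
      by rewrite subr0 sub0r mulrN oppr_eq0 -natrM pnatr_eq0 mulnb eqb0 negbK.
    move=> /orP[iX|iY] /orP[jX|jY] ij.
    + rewrite mxE outer !gE [(QX + QY) i j]mxE Y0 ?(disjointFr XY iX)// addr0.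
      have -> : (i == y) = false by apply: contraNF yX => /eqP<-.
      have -> : (j == y) = false by apply: contraNF yX => /eqP<-.
      rewrite !subr0 -natrM mulnb.
      have -> : (i == x) && (j == x) = false.
        by apply: contraNF ij => /andP[/eqP-> /eqP->].
      by rewrite addr0 GX.
    + exact: cross.
    + rewrite adj_sym -cross//; last by rewrite eq_sym.
      by rewrite (symE symQ).
    + rewrite mxE outer !gE [(QX + QY) i j]mxE X0 ?(disjointFl XY iY)// add0r.
      have -> : (i == x) = false by apply: contraNF xY => /eqP<-.
      have -> : (j == x) = false by apply: contraNF xY => /eqP<-.
      rewrite !sub0r mulrNN -natrM mulnb.
      have -> : (i == y) && (j == y) = false.
        by apply: contraNF ij => /andP[/eqP-> /eqP->].
      by rewrite addr0 GY.
  - move=> i j; rewrite inE negb_or => /andP[iX iY].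
    rewrite !mxE big_ord1 !mxE X0// Y0// !add0r.
    have -> : (i == x) = false by apply: contraNF iX => /eqP->.
    have -> : (i == y) = false by apply: contraNF iY => /eqP->.
    by rewrite !andbF subrr mul0r.
have dC : supp C d.
  by apply: suppD; [apply: suppS dXs; exact: finset.subsetUl|apply: suppS dYs; exact: finset.subsetUr].
have d0 i : i \in C -> 0 < d 0 i.
  rewrite inE mxE => /orP[iX|iY].
    by rewrite (dYs i) ?addr0 ?dX0// (disjointFr XY iX).
  by rewrite (dXs i) ?add0r ?dY0// (disjointFl XY iY).
have x12 : x1 != x2 by apply: contraNneq x1Y => ->.
have bE i : b 0 i = (i == x1)%:R - (i == x2)%:R by rewrite !mxE !eqxx.
have bC : supp C b.
  move=> i; rewrite inE negb_or bE => /andP[iX iY].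
  have -> : (i == x1) = false by apply: contraNF iX => /eqP->.
  have -> : (i == x2) = false by apply: contraNF iY => /eqP->.
  by rewrite subrr.
have bN i : i \in C -> (b 0 i != 0) = G v i.
  rewrite inE bE => /orP[iX|iY].
    have -> : (i == x2) = false by apply: contraNF x2X => /eqP<-.
    by rewrite subr0 vX// pnatr_eq0 eqb0 negbK.
  have -> : (i == x1) = false by apply: contraNF x1Y => /eqP<-.
  by rewrite sub0r oppr_eq0 vY// pnatr_eq0 eqb0 negbK.
pose sr K := sign_row R K c.
have srE K i : i \in K -> sr K 0 i = (-1) ^+ c i by move=> iK; rewrite mxE iK.
have evs K i : i \in K -> supp K (unit_row R i).
  by move=> iK j; rewrite unit_rowE; case: eqVneq => // ->; rewrite iK.
have sub_supp K (i j : 'I_n) (a a' : R) : i \in K -> j \in K -> supp K (a *: unit_row R i - a' *: unit_row R j).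
  by move=> iK jK; apply: suppD; [|apply: suppN]; apply: suppZ; exact: evs.
have oneev i : unit_row R i = 1 *: unit_row R i by rewrite scale1r.
have bX t : supp X (unit_row R x1 - t *: unit_row R x) by rewrite oneev; exact: sub_supp.
have bY t : supp Y (t *: unit_row R y - unit_row R x2) by rewrite (oneev x2); exact: sub_supp.
have [|e1 [e1s e1Q e1ge e1gt]] := pair_range1 pairX (bX 1).
  by rewrite dotBr dotZr !dot_unit_row !mxE x1X xX mulr1 subrr.
have [|f1 [f1s f1Q f1ge _]] := pair_range1 pairY (bY 1).
  by rewrite dotBr dotZr !dot_unit_row !mxE yY x2Y mulr1 subrr.
have [|e2 [e2s e2Q e2le]] := pair_range2 pairX (bX s1).
  by rewrite dotBr dotZr !dot_unit_row !srE// /s1 -mulrA -signr_addb addbb mulr1 subrr.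
have [|f2 [f2s f2Q f2le]] := pair_range2 pairY (bY s1).
  by rewrite dotBr dotZr !dot_unit_row !srE// /s1 -cxy -c12 -mulrA -signr_addb addbb mulr1 subrr.
have pQX2 := block_sub_diag pQX dXs; have pQY2 := block_sub_diag pQY dYs.
have [||z1 z1Q [z1s z1E]] := glue_flow pQX pQY XY pX pX0 _ (mulr1 1) e1s e1Q f1s f1Q x1X xX yY x2Y.
- by rewrite mxE xX oner_neq0.
- by rewrite !mxE x1X xX mulr1.
have [||z2 z2Q [z2s z2E]] := glue_flow pQX2 pQY2 XY sX sX0 _ s11 e2s e2Q f2s f2Q x1X xX yY x2Y.
- by rewrite srE// signr_eq0.
- by rewrite !srE// /s1 -mulrA -signr_addb addbb mulr1.
have z12 : dot z2 b <= dot z1 b by rewrite z1E z2E; lra.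
have nullb K i (w : 'rV[R]_n) : w 0 i != 0 -> w != 0 by apply: contraNneq => ->; rewrite mxE.
apply: (q_pair (u1 := indicator R X + indicator R Y) (u2 := sr X + sr Y) clC pQ dC d0 bC bN
          _ _ z1s z1Q z2s _ z12).
- split.
  + apply: (nullb X x1); rewrite !mxE x1X (negPf x1Y) addr0; exact: oner_neq0.
  + by apply: suppD; [apply: suppS pX; exact: finset.subsetUl|apply: suppS pY; exact: finset.subsetUr].
  + by apply: (glue_null pQX pQY) => //; rewrite !mxE xX yY.
  + by rewrite dotBr !dot_unit_row !mxE x1X x2Y (negPf x1Y) (negPf x2X) addr0 add0r subrr.
- split.
  + apply: (nullb X x1); rewrite mxE srE// (sY x1)// addr0; by rewrite signr_eq0.
  + by apply: suppD; [apply: suppS sX; exact: finset.subsetUl|apply: suppS sY; exact: finset.subsetUr].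
  + by rewrite QE2; apply: (glue_null pQX2 pQY2) => //; rewrite !srE// cxy.
  + rewrite dotBr !dot_unit_row [(sr X + sr Y) 0 x1]mxE [(sr X + sr Y) 0 x2]mxE.
    by rewrite (sY x1)// (sX x2)// !srE// c12 addr0 add0r subrr.
- by rewrite QE2.
- case: strict => [x1x|rest]; [left|by right].
  rewrite z1E z2E; suff : 0 < dot e1 (unit_row R x1 - 1 *: unit_row R x) by lra.
  apply: e1gt; apply: (nullb X x1); rewrite !mxE !eqxx (negPf x1x) mulr0 subr0; exact: oner_neq0.
Qed.

Lemma lap_closed K : (forall i j, i \in K -> G i j -> j \in K) -> indicator R K *m lap R G [set: 'I_n] = 0.
Proof. by move=> clK; apply: lap_ind => i j _ _; exact: clK. Qed.

(** The Laplacian of G kills the indicators of the unions of components. *)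
Lemma q_three_closed (Ks : seq ({set 'I_n} * 'I_n)) :
  all (fun Kk : {set 'I_n} * 'I_n => Kk.2 \in Kk.1) Ks ->
  pairwise (fun A B : {set 'I_n} * 'I_n => [disjoint A.1 & B.1]) Ks ->
  (forall Kk i j, Kk \in Ks -> i \in Kk.1 -> G i j -> j \in Kk.1) ->
  (q R G + (size Ks).-1 <= n)%N.
Proof.
move=> kK disj clK; have GL := block_setT (lap_block R G [set: 'I_n]).
case: (posnP (size Ks)) => [->|s0].
  have := q_le_q_mx GL; have := q_mx_excess (lap R G [set: 'I_n]) (s := [::]) isT.
  by rewrite big_nil !addn0; lia.
apply: (q_nullity GL); rewrite prednK// -(size_map (fun Kk : {set 'I_n} * 'I_n => (indicator R Kk.1, Kk.2))).
apply: nullity_pivoted; first exact: ind_pivoted.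
move=> u i /mapP[[K k] KKs [-> _]] /=; apply: lap_closed => a c; exact: clK KKs.
Qed.

(** Blocks scaled to have the eigenvalues 0 and 1 on both sides. *)
Lemma q_two_edges K1 K2 i1 j1 i2 j2 :
  (forall i j, i \in K1 -> G i j -> j \in K1) ->
  [disjoint K1 & K2] -> K1 :|: K2 = [set: 'I_n] ->
  i1 \in K1 -> j1 \in K1 -> G i1 j1 ->
  i2 \in K2 -> j2 \in K2 -> G i2 j2 -> (q R G + 2 <= n)%N.
Proof.
move=> cl1 d12 KE iK1 jK1 G1 iK2 jK2 G2.
have d21 : [disjoint K2 & K1] by rewrite disjoint_sym.
have [S1 [z1 [k1 [p1 L1 zS1 zK1 zk1]]]] := unit_lap R iK1 jK1 G1.
have [S2 [z2 [k2 [p2 L2 zS2 zK2 zk2]]]] := unit_lap R iK2 jK2 G2.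
have pS : block G [set: 'I_n] (S1 + S2).
  rewrite -KE; apply: block_union => // i j iK jK; apply/negP => /(cl1 i j iK).
  by rewrite (disjointFl d12 jK).
have m1 u : supp K1 u -> u *m (S1 + S2) = u *m S1.
  by move=> uK; rewrite mulmxDr (block_disj p2 uK d21) addr0.
have m2 u : supp K2 u -> u *m (S1 + S2) = u *m S2.
  by move=> uK; rewrite mulmxDr (block_disj p1 uK d12) add0r.
apply: (@q_two_nullities _ _ _ (S1 + S2) 1).
- exact: block_setT.
- exact: oner_neq0.
- have := @nullity_pivoted _ _ (S1 + S2) [:: (indicator R K1, i1); (indicator R K2, i2)].
  rewrite /=; apply.
    split; first by rewrite mxE iK1 oner_neq0.
      by move=> w j; rewrite inE => /eqP[-> _]; rewrite mxE (disjointFr d12 iK1).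
    by split=> //; rewrite mxE iK2 oner_neq0.
  move=> w j; rewrite !inE => /orP[]/eqP[-> _].
    by rewrite m1 ?L1//; exact: supp_ind.
  by rewrite m2 ?L2//; exact: supp_ind.
- have := @nullity_pivoted _ _ (S1 + S2 - 1%:M) [:: (z1, k1); (z2, k2)].
  rewrite /=; apply.
    split=> // w j; rewrite inE => /eqP[-> _].
    have kK : k1 \in K1 by apply: contraNT zk1 => /zK1 ->.
    by rewrite zK2// (disjointFr d12 kK).
  move=> w j; rewrite !inE => /orP[]/eqP[-> _]; rewrite mulmxBr mulmx1.
    by rewrite m1// zS1 subrr.
  by rewrite m2// zS2 subrr.
Qed.

End Bridge.

(** * Components and induced paths *)

Section Connectivity.
Variable n : nat.
Variable G : graph n.
Implicit Types (K L U : {set 'I_n}) (v i j k w : 'I_n) (s : seq 'I_n).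

Lemma connect_crossing (r : rel 'I_n) U i j : connect r i j -> i \in U -> j \notin U ->
  exists a b, [/\ a \in U, b \notin U & r a b].
Proof.
move=> /connectP[s]; elim: s i => [|k s IH] i /=; first by move=> _ -> ->.
move=> /andP[rik ks] jE iU jU; have [kU|kU] := boolP (k \in U); first exact: (IH k).
by exists i, k.
Qed.

Lemma connect_map (r r' : rel 'I_n) (f : 'I_n -> 'I_n) i j :
  (forall a b, r a b -> connect r' (f a) (f b)) -> connect r i j -> connect r' (f i) (f j).
Proof.
move=> rr' /connectP[s]; elim: s i => [|k s IH] i /=; first by move=> _ ->.
by move=> /andP[/rr' rik /IH{}IH] /IH; apply: connect_trans.
Qed.

Lemma connect_subrel (r r' : rel 'I_n) i j : subrel r r' -> connect r i j -> connect r' i j.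
Proof. by move=> rr'; apply: (connect_map (f := id)) => a b /rr' /connect1. Qed.

Lemma within_sym K : symmetric (within G K).
Proof. by move=> i j; rewrite /within adj_sym andbCA. Qed.

Lemma withinC K i j : connect (within G K) i j = connect (within G K) j i.
Proof. exact: (sym_connect_sym (within_sym K)). Qed.

Definition component K i : {set 'I_n} := [set j in K | connect (within G K) i j].

Lemma component_sub K i : component K i \subset K.
Proof. by apply/fintype.subsetP => j; rewrite inE => /andP[]. Qed.

Lemma mem_component K i : i \in K -> i \in component K i.
Proof. by move=> iK; rewrite inE iK connect0. Qed.

Lemma component_closed K k i j : i \in component K k -> j \in K -> G i j ->
  j \in component K k.
Proof.
rewrite !inE => /andP[iK ki] jK Gij; rewrite jK /=; apply: connect_trans ki _.
by apply: connect1; rewrite /within iK jK.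
Qed.

Lemma component_connected K k : connected G (component K k).
Proof.
have to_k i : i \in component K k -> connect (within G (component K k)) k i.
  rewrite inE => /andP[_ /connectP[s]]; rewrite /= => ks ->.
  elim/last_ind: s ks => [|s x IH] //=; rewrite rcons_path last_rcons => /andP[ks sx].
  apply: connect_trans (IH ks) (connect1 _); case/and3P: sx => lK xK Glx.
  have kl : connect (within G K) k (last k s) by apply/connectP; exists s.
  rewrite /within !inE lK xK kl Glx /= andbT; apply: connect_trans kl (connect1 _).
  by rewrite /within lK xK.
by move=> i j /to_k ki /to_k kj; apply: connect_trans kj; rewrite withinC.
Qed.

Lemma component_cut_part v k : cut_part G v (component (~: [set v]) k).
Proof.
split; first by rewrite inE !inE eqxx.
by move=> i j ik Gij jv; apply: (component_closed ik); rewrite ?inE.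
Qed.

Lemma component_min v U k : cut_part G v U -> k \in U -> component (~: [set v]) k \subset U.
Proof.
move=> [vU cut_partU] kU; apply/fintype.subsetP => j; rewrite inE => /andP[_ kj].
apply: contraLR isT => jU; have [a [b [aU bU /and3P[_ bv Gab]]]] := connect_crossing kj kU jU.
by rewrite (cut_partU a b aU Gab) in bU; move: bv; rewrite !inE.
Qed.

Lemma connected_singleton K k : connected G K -> k \in K ->
  K = [set k] \/ exists2 i, i \in K & G k i.
Proof.
move=> cK kK; have [/forall_inP K1|] := boolP [forall i in K, i == k].
  by left; apply/setP => i; rewrite !inE; apply/idP/eqP => [/K1/eqP|->].
move=> /forall_inPn[i iK ik]; right.
have [|a [b [/set1P-> _ /and3P[_ bK Gkb]]]] := connect_crossing (cK k i kK iK) (finset.set11 k).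
  by rewrite inE.
by exists b.
Qed.

(** The set U grows by one vertex at a time; the new vertex receives the colour that its
    chosen neighbour in U does not have. *)
Lemma exists_coloring K k : connected G K -> k \in K -> exists c, connecting_coloring G K c.
Proof.
move=> cK kK.
suff H m : exists U c, [/\ U \subset K, k \in U, connecting_coloring G U c & (m <= #|U|)%N \/ U = K].
  have [U [c [UK kU gc [lt|UE]]]] := H #|K|.+1; last by exists c; rewrite -UE.
  by move: (subset_leq_card UK); rewrite leqNgt lt.
elim: m => [|m [U [c [UK kU gc [mU|UE]]]]].
- exists [set k], (fun=> true); split; [by rewrite sub1set|by rewrite inE| |by left].
  by move=> i j /set1P-> /set1P->; exact: connect0.
- have [UE|] := eqVneq U K; first by exists U, c; split=> //; right.
  rewrite eqEsubset UK /= => /subsetPn[j jK jU].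
  have [a [b [aU bU /and3P[aK bK Gab]]]] := connect_crossing (cK k j kK jK) kU jU.
  pose c' i := if i == b then ~~ c a else c i.
  have UU' : subrel (bichrom G U c) (bichrom G (b |: U) c').
    move=> x y /and4P[xU yU Gxy cxy].
    have xb : (x == b) = false by apply: contraNF bU => /eqP<-.
    have yb : (y == b) = false by apply: contraNF bU => /eqP<-.
    by rewrite /bichrom !inE xU yU !orbT Gxy /c' xb yb.
  have ab : bichrom G (b |: U) c' a b.
    have ab : (a == b) = false by apply: contraNF bU => /eqP<-.
    by rewrite /bichrom !inE aU eqxx orbT Gab /c' ab eqxx; case: (c a).
  have ba : bichrom G (b |: U) c' b a.
    by have /and4P[p1 p2 p3 p4] := ab; rewrite /bichrom p1 p2 adj_sym p3 eq_sym.
  have to_a x : x \in b |: U -> connect (bichrom G (b |: U) c') x a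
      /\ connect (bichrom G (b |: U) c') a x.
    rewrite !inE => /orP[/eqP->|xU]; first by split; exact: connect1.
    by split; apply: connect_subrel UU' _; exact: gc.
  exists (b |: U), c'; split.
  + by rewrite subUset sub1set bK.
  + by rewrite inE kU orbT.
  + by move=> x y /to_a[xa _] /to_a[_ ay]; exact: connect_trans ay.
  + by left; rewrite cardsU1 bU.
- by exists U, c; split=> //; right.
Qed.

Lemma path_avoiding w i s : path (adj G) i s -> w \notin i :: s ->
  connect (within G (~: [set w])) i (last i s).
Proof.
elim: s i => [|j s IH] i /=; first by rewrite connect0.
move=> /andP[Gij js]; rewrite inE negb_or => /andP[wi wjs].
apply: connect_trans (connect1 _) (IH j js wjs).
move: wjs; rewrite inE negb_or => /andP[wj _].
by rewrite /within !inE eq_sym wi eq_sym wj.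
Qed.

End Connectivity.

Section InducedPaths.
Variable n : nat.
Variable G : graph n.
Implicit Types (K L U : {set 'I_n}) (v i j k w t : 'I_n) (s : seq 'I_n).

Fixpoint induced_path s : bool :=
  if s is x :: s' then
    [&& x \notin s', all (fun y => G x y == (ohead s' == Some y)) s' & induced_path s']
  else true.

Lemma induced_path_cons x s : x \notin s -> (forall y, y \in s -> G x y = (ohead s == Some y)) ->
  induced_path s -> induced_path (x :: s).
Proof. by move=> xs xy ips; rewrite /= xs ips andbT /=; apply/allP => y /xy ->. Qed.

(** Two paths that start at adjacent vertices are joined by reversing the first. *)
Lemma induced_path_catrev s1 s2 : induced_path s1 -> induced_path s2 ->
  (forall a b, a \in s1 -> b \in s2 ->
     a \notin s2 /\ G a b = (ohead s1 == Some a) && (ohead s2 == Some b)) ->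
  induced_path (catrev s1 s2).
Proof.
elim: s1 s2 => [|y s1 IH] s2 //= /and3P[ys1 /allP yadj ip1] ip2 cross.
have y2 b : b \in s2 -> y \notin s2 /\ G y b = (ohead s2 == Some b).
  by move=> bs2; have [] := cross y b (mem_head _ _) bs2; rewrite eqxx.
have ys2 : y \notin s2 by apply/negP => /[dup] /y2[/negPf->].
apply: IH => //.
  by apply: induced_path_cons => // b /y2[].
move=> a b as1; rewrite inE => /orP[/eqP->|bs2].
  split; last by rewrite eqxx andbT adj_sym (eqP (yadj a as1)).
  rewrite inE negb_or; apply/andP; split; first by apply: contraNneq ys1 => <-.
  by apply/negP => /[dup] as2 /(cross a a)[|/negP//]; rewrite inE as1 orbT.
have [|as2 ->] := cross a b _ bs2; first by rewrite inE as1 orbT.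
have ay : a != y by apply: contraNneq ys1 => <-.
split; first by rewrite inE negb_or ay.
have -> : (Some y == Some a) = false by apply/negbTE; apply: contra ay => /eqP[->].
have -> : (Some y == Some b) = false; last by rewrite andbF.
by apply/negbTE; apply: contraNneq ys2 => -[->].
Qed.

Lemma induced_path_nth x0 s (i j : nat) : induced_path s -> (i < size s)%N -> (j < size s)%N ->
  G (nth x0 s i) (nth x0 s j) = (i.+1 == j)%N || (j.+1 == i)%N.
Proof.
elim: s i j => [|x s IH] i j //= /and3P[xs /allP xadj ips].
have h (k : nat) : (k < size s)%N -> G x (nth x0 s k) = (k == 0)%N.
  move=> ks; rewrite (eqP (xadj _ (mem_nth x0 ks))).
  case: s k ks ips {xs xadj IH} => [|y s] [|k] //= ks; first by rewrite eqxx.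
  move=> /and3P[ys _ _]; apply/eqP => -[yE]; move: ys; by rewrite yE mem_nth.
case: i j => [|i] [|j] //=; rewrite ?ltnS ?eqSS.
- by rewrite adj_irrefl.
- by move=> _ js; rewrite h// eq_sym orbF.
- by move=> is' _; rewrite adj_sym h// eq_sym.
- by move=> is' js; rewrite IH.
Qed.

Lemma induced_path_uniq s : induced_path s -> uniq s.
Proof. by elim: s => //= x s IH /and3P[-> _ /IH]. Qed.

(** That is, L is a union of components of the subgraph induced on K minus w, none of which
    contains t. *)
Definition far_part K t w L := [/\ L \subset K, w \notin L, t \notin L
  & forall i j, i \in L -> j \in K -> G i j -> j != w -> j \in L].

Definition loop_at K t w := exists L i j,
  [/\ far_part K t w L, connected G L, i \in L, j \in L & [/\ i != j, G w i & G w j]].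

Definition fork_at K t w := exists L1 L2 i j,
  [/\ far_part K t w L1, far_part K t w L2, [disjoint L1 & L2], i \in L1 & [/\ j \in L2, G w i & G w j]].

(** Peel off t as long as it has a single neighbour in the rest of K and the rest is
    connected. If this stops before K is exhausted, the current end w has two neighbours
    ahead, either in one component of what remains (a loop) or in two (a fork). *)
Lemma rooted_path K t : connected G K -> t \in K ->
  (exists s, induced_path (t :: s) /\ forall i, (i \in K) = (i \in t :: s)) \/
  (exists2 w, w \in K & loop_at K t w \/ fork_at K t w).
Proof.
have [m] := ubnP #|K|; elim: m K t => // m IH K t Km cK tK.
pose K' := K :\ t.
have comp_far_part k : far_part K t t (component G K' k).
  split.
  - by apply: (subset_trans (component_sub G K' k)); exact: subD1set.
  - by rewrite !inE eqxx.
  - by rewrite !inE eqxx.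
  - by move=> i j ik jK Gij jt; apply: (component_closed ik); rewrite // !inE jt.
have nbr k : k \in K' -> exists2 i, i \in component G K' k & G t i.
  move=> kK'; have kK : k \in K by move: kK'; rewrite !inE => /andP[].
  have tk : t \notin component G K' k by rewrite !inE eqxx.
  have [a [b [ak bk /and3P[aK bK Gab]]]] :=
    connect_crossing (cK k t kK tK) (mem_component G kK') tk.
  have [bt|bt] := eqVneq b t; first by exists a => //; rewrite adj_sym -bt.
  by rewrite (component_closed ak _ Gab) ?inE ?bt in bk.
have [K'0|[k kK']] := set_0Vmem K'.
  left; exists [::]; split=> // i; rewrite inE.
  have := in_set0 i; rewrite -K'0 !inE; case: eqVneq => [->|]; rewrite ?tK//.
have [i1 i1k ti1] := nbr k kK'.
have [K'k|/subsetPn[k2 k2K' k2k]] := boolP (K' \subset component G K' k); last first.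
  right; exists t => //; right; have [i2 i2k ti2] := nbr k2 k2K'.
  exists (component G K' k), (component G K' k2), i1, i2; split; [exact: comp_far_part|exact: comp_far_part| |by []|by []].
  rewrite disjoints_subset; apply/fintype.subsetP => x; rewrite !inE => /andP[xK' kx].
  rewrite xK' /=; apply: contra k2k => k2x; rewrite inE k2K' /=.
  by apply: connect_trans kx _; rewrite withinC.
have KE : component G K' k = K' by apply/eqP; rewrite eqEsubset component_sub.
have cK' : connected G K' by rewrite -KE; exact: component_connected.
have i1K' : i1 \in K' by rewrite -KE.
have [/existsP[i2 /and3P[i2K' i12 ti2]]|uniq_nbr] :=
    boolP [exists i2, [&& i2 \in K', i1 != i2 & G t i2]].
  right; exists t => //; left; exists K', i1, i2; split=> //.
  by rewrite -KE; exact: comp_far_part.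
have tE i : i \in K' -> G t i = (i == i1).
  move=> iK'; apply/idP/eqP => [ti|->] //; apply/eqP; apply: contraNT uniq_nbr => ii1.
  by apply/existsP; exists i; rewrite iK' eq_sym ii1.
have K'm : (#|K'| < m)%N by move: Km; rewrite (cardsD1 t) tK.
have [[s [ips sE]]|[w wK' br]] := IH K' i1 K'm cK' i1K'.
  left; exists (i1 :: s); split.
    apply: induced_path_cons => //; first by rewrite -sE !inE eqxx.
    by move=> y; rewrite -sE => /tE ->; rewrite eq_sym.
  move=> i; rewrite inE -sE !inE; case: eqVneq => // ->; by rewrite tK.
right; exists w; first by move: wK'; rewrite !inE => /andP[].
have lift L : far_part K' i1 w L -> far_part K t w L.
  move=> [LK' wL i1L clL]; split=> //.
  - by apply: (subset_trans LK'); exact: subD1set.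
  - by apply/negP => /(fintype.subsetP LK'); rewrite !inE eqxx.
  - move=> i j iL jK Gij jw; have [jt|jt] := eqVneq j t; last by apply: clL Gij jw; rewrite // !inE jt.
    have := tE i (fintype.subsetP LK' i iL); rewrite -jt adj_sym Gij => /esym/eqP iE.
    by rewrite iE (negPf i1L) in iL.
case: br => [[L [i [j [rL cL iL jL ij]]]]|[L1 [L2 [i [j [r1 r2 d iL jL]]]]]].
  by left; exists L, i, j; split=> //; exact: lift.
by right; exists L1, L2, i, j; split=> //; exact: lift.
Qed.

End InducedPaths.

(** * Branching makes a part good *)

Section GoodBranches.
Variable R : realType.
Variable n : nat.
Variable G : graph n.
Implicit Types (S : 'M[R]_n) (K L : {set 'I_n}) (v i j t w : 'I_n) (u b : 'rV[R]_n).

Lemma dot_ind L b : dot (indicator R L) b = \sum_(i in L) b 0 i.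
Proof.
rewrite dotE [RHS]big_mkcond; apply: eq_bigr => i _; rewrite mxE.
by case: (i \in L); rewrite ?mul1r ?mul0r.
Qed.

Lemma lap_far_part K t w L : far_part G K t w L -> indicator R L *m lap R G (K :\ w) = 0.
Proof.
move=> [LK _ _ clL]; apply: lap_ind => i j _; rewrite !inE => /andP[jw jK] iL Gij.
exact: clL Gij jw.
Qed.

(** The Laplacian of K minus w, bordered by w, has a null vector that vanishes at t, so
    good_pendant applies. For a loop it is the indicator of L, with a border of sum zero on
    L. For a fork it is a combination of the two indicators for which the contributions at w
    cancel. *)
Lemma good_branch v K t : t \in K -> (forall i, i \in K -> G v i = (i == t)) ->
  (exists2 w, w \in K & loop_at G K t w \/ fork_at G K t w) -> good R G v K.
Proof.
move=> tK vt [w wK [[L [i [j [rL cL iL jL [ij wi wj]]]]]|[L1 [L2 [i [j [r1 r2 d iL [jL wi wj]]]]]]]].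
- have [LK wL tL clL] := rL.
  pose m : R := \sum_(k in L | k != i) (G w k)%:R.
  have m0 : m != 0.
    by rewrite gt_eqF// /m (bigD1 j) ?jL 1?eq_sym//= wj ltr_pwDl// sumr_ge0// => k _.
  pose b : 'rV[R]_n := \row_k if k == i then - m else if k \in K then (G w k)%:R else 0.
  have iw : w != i by apply: contraNneq wL => ->.
  have iK : i \in K by exact: (fintype.subsetP LK).
  have bw : b 0 w = 0 by rewrite mxE (negPf iw) wK adj_irrefl.
  have bK : supp K b.
    by move=> k kK; rewrite mxE (negPf kK); case: eqVneq kK => // ->; rewrite iK.
  have pS : block G K (border w (lap R G (K :\ w)) b 0).
    apply: border_block_in => //; first exact: lap_block.
    move=> k kK kw; rewrite mxE; case: (eqVneq k i) => [->|_]; first by rewrite oppr_eq0 m0 wi.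
    by rewrite kK pnatr_eq0 eqb0 negbK.
  apply: (good_pendant (u := indicator R L) pS _ _ _ _ tK vt).
  + by apply: (suppS LK); exact: supp_ind.
  + by apply/eqP => /rowP/(_ i)/eqP; rewrite !mxE iL oner_eq0.
  + apply: border_null0; rewrite ?(lap_far_part rL)//; first by rewrite mxE (negPf wL).
    rewrite dot_ind (bigD1 i)//= mxE eqxx addrC; apply/eqP; rewrite subr_eq0; apply/eqP.
    apply: eq_bigr => k /andP[kL ki]; by rewrite mxE (negPf ki) (fintype.subsetP LK).
  + by rewrite mxE (negPf tL).
- have [LK1 w1 t1 _] := r1; have [LK2 w2 t2 _] := r2.
  pose b := restr K (adj_row R G w).
  have bE k : k \in K -> b 0 k = (G w k)%:R by move=> kK; rewrite !mxE kK.
  have pos L k : L \subset K -> k \in L -> G w k -> 0 < dot (indicator R L) b.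
    move=> LK kL wk; rewrite dot_ind (bigD1 k)//= bE ?(fintype.subsetP LK)// wk ltr_pwDl//.
    by rewrite sumr_ge0// => l /andP[lL _]; rewrite bE ?(fintype.subsetP LK).
  have m1 := pos L1 i LK1 iL wi; have m2 := pos L2 j LK2 jL wj.
  set a1 := dot _ b in m1; set a2 := dot _ b in m2.
  have pS : block G K (border w (lap R G (K :\ w)) b 0).
    apply: border_block_in => //; first exact: lap_block.
    - exact: supp_restr.
    - by rewrite bE// adj_irrefl.
    - by move=> k kK kw; rewrite bE// pnatr_eq0 eqb0 negbK.
  apply: (good_pendant (u := a2 *: indicator R L1 - a1 *: indicator R L2) pS _ _ _ _ tK vt).
  + apply: suppD; [|apply: suppN]; apply: suppZ.
      by apply: (suppS LK1); exact: supp_ind.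
    by apply: (suppS LK2); exact: supp_ind.
  + apply/eqP => /rowP/(_ i)/eqP; rewrite !mxE iL (disjointFr d iL).
    by rewrite mulr1 mulr0 subr0 gt_eqF.
  + apply: border_null0.
    * by rewrite !mxE (negPf w1) (negPf w2) !mulr0 subrr.
    * by rewrite mulmxBl -!scalemxAl (lap_far_part r1) (lap_far_part r2) !scaler0 subrr.
    * by rewrite dotBl !dotZl -/a1 -/a2 mulrC subrr.
  + by rewrite !mxE (negPf t1) (negPf t2) !mulr0 subrr.
Qed.

(** The zero block, with attachment vector zero. *)
Lemma good_isolated v z : ~~ G v z -> good R G v [set z].
Proof.
move=> vz; exists 0, 0, (unit_row R z), 0; split; split=> //.
- split=> [|i j /set1P-> /set1P->|i j _]; rewrite ?trmx0 ?eqxx// mxE//.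
- by move=> i _; rewrite mxE.
- by move=> i /set1P->; rewrite mxE eqxx (negPf vz).
- by apply/eqP => /rowP/(_ z)/eqP; rewrite unit_rowE mxE eqxx oner_eq0.
- by move=> i; rewrite inE unit_rowE => /negPf->.
- by rewrite mulmx0.
- by move=> i _; rewrite mxE.
- by rewrite mul0mx.
Qed.

End GoodBranches.

(** * Consequences of q(G) >= n - 1 *)

Section Structure.
Variable R : realType.
Variable n : nat.
Variable G : graph n.
Hypothesis large_q : ~ (q R G + 2 <= n)%N.
Implicit Types (K L U C H T : {set 'I_n}) (v i j k t w z : 'I_n) (s : seq 'I_n).

(** All vertices but z lie on an induced path, and the neighbours of z, if any, are a vertex
    or two consecutive vertices of it. *)
Definition near_path := exists z s,
  [/\ induced_path G s, (forall i, (i \in s) = (i != z))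
    & [\/ forall i, G z i = false,
          exists s1 y s2, s = s1 ++ y :: s2 /\ forall i, G z i = (i == y)
        | exists s1 y y' s2, s = s1 ++ [:: y, y' & s2] /\
            forall i, G z i = (i == y) || (i == y')]].

Lemma no_four_parts v K1 K2 K3 K4 i1 i2 i3 i4 :
  cut_part G v K1 -> cut_part G v K2 -> cut_part G v K3 -> cut_part G v K4 ->
  [disjoint K1 & K2] -> [disjoint K1 & K3] -> [disjoint K1 & K4] ->
  [disjoint K2 & K3] -> [disjoint K2 & K4] -> [disjoint K3 & K4] ->
  i1 \in K1 -> i2 \in K2 -> i3 \in K3 -> i4 \in K4 -> False.
Proof.
move=> c1 c2 c3 c4 d12 d13 d14 d23 d24 d34 iK1 iK2 iK3 iK4; apply: large_q.
apply: (@q_four_parts _ _ _ v [:: (K1, i1); (K2, i2); (K3, i3); (K4, i4)]) => //=.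
- by rewrite iK1 iK2 iK3 iK4.
- by rewrite d12 d13 d14 d23 d24 d34.
- by move=> Kk; rewrite !inE => /or4P[]/eqP->.
Qed.

(** Two of the three neighbours have the same colour. *)
Lemma no_three_nbrs v C i j k : cut_part G v C -> connected G C ->
  i \in C -> j \in C -> k \in C -> i != j -> i != k -> j != k ->
  G v i -> G v j -> G v k -> False.
Proof.
move=> clC cC iC jC kC ij ik jk vi vj vk; apply: large_q.
have [c gc] := exists_coloring cC iC.
have [cij|cij] := eqVneq (c i) (c j); first exact: (q_same_colour R clC gc iC jC ij vi vj cij).
have [cik|cik] := eqVneq (c i) (c k); first exact: (q_same_colour R clC gc iC kC ik vi vk cik).
apply: (q_same_colour R clC gc jC kC jk vj vk).
by move: cij cik; case: (c i); case: (c j); case: (c k).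
Qed.

(** A disconnected rest would fall under q_good_two_parts, and a good one under q_two_good.
    *)
Lemma good_rest v K i k : cut_part G v K -> good R G v K -> i \in K -> G v i ->
  k \in ~: (v |: K) -> connected G (~: (v |: K)) /\ ~ good R G v (~: (v |: K)).
Proof.
set T := ~: (v |: K) => clK gK iK vi kT.
have [vK _] := clK; have clT : cut_part G v T by exact: cut_part_compl.
have dKT : [disjoint K & T] by rewrite disjoints_subset finset.setCK finset.subsetUr.
have KT : K :|: T = ~: [set v].
  by apply/setP => x; rewrite !inE negb_or; case: eqVneq => [->|_]; rewrite ?(negPf vK) ?orbN.
split; last by move=> gT; apply: large_q; exact: (q_two_good clK gK gT dKT KT).
pose K2 := component G (~: [set v]) k.
have K2T : K2 \subset T by exact: component_min.
have [TK2|/subsetPn[k3 k3T k3K2]] := boolP (T \subset K2).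
  have -> : T = K2 by apply/eqP; rewrite eqEsubset TK2.
  exact: component_connected.
have clK2 : cut_part G v K2 by exact: component_cut_part.
have kv : k != v by move: kT; rewrite !inE negb_or => /andP[].
case: large_q; apply: (@q_good_two_parts _ _ _ v K K2 (T :\: K2) i k k3) => //.
- have [vT clT'] := clT; have [_ clK2'] := clK2.
  split=> [|x y]; first by rewrite in_setD (negPf vT) andbF.
  rewrite !in_setD => /andP[xK2 xT] Gxy yv; rewrite (clT' x y)// andbT.
  apply: contra xK2 => yK2; apply: (clK2' y x yK2); first by rewrite adj_sym.
  by apply: contraNneq vT => <-.
- exact: disjointWr K2T dKT.
- by apply: disjointWr dKT; exact: subsetDl.
- by rewrite disjoints_subset; apply/fintype.subsetP => x xK2; rewrite in_setC in_setD xK2.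
- by apply: mem_component; rewrite !inE.
- by rewrite inE k3K2.
- rewrite -KT; congr (_ :|: _); apply/setP => x; rewrite in_setU in_setD.
  by have [/(fintype.subsetP K2T)|//] := boolP (x \in K2).
Qed.

(** By rooted_path and good_branch, a second neighbour of v or any branching would make the
    rest good. *)
Lemma tail_path v K i k : cut_part G v K -> good R G v K -> i \in K -> G v i ->
  k \in ~: (v |: K) -> G v k -> exists s, [/\ induced_path G (k :: s),
    forall x, (x \in ~: (v |: K)) = (x \in k :: s) &
    forall x, x \in ~: (v |: K) -> G v x = (x == k)].
Proof.
set T := ~: (v |: K) => clK gK iK vi kT vk.
have [cT ngT] := good_rest clK gK iK vi kT.
have vkE x : x \in T -> G v x = (x == k).
  move=> xT; apply/idP/eqP => [vx|-> //]; apply/eqP/negPn/negP => xk; apply: ngT.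
  exact: (good_loop R cT xT kT xk).
have [[s [ips sE]]|br] := rooted_path cT kT; first by exists s.
by case: ngT; exact: good_branch kT vkE br.
Qed.

End Structure.

(** * Forests *)

Section Trees.
Variable n : nat.
Variable G : graph n.
Implicit Types (K L U C H T : {set 'I_n}) (v i j k t w z : 'I_n) (s l : seq 'I_n).

Lemma join_path v l2 l3 : induced_path G l2 -> induced_path G l3 ->
  (forall a b, a \in l2 -> b \in l3 -> a != b /\ ~~ G a b) ->
  (forall a, a \in l2 -> a != v /\ G v a = (ohead l2 == Some a)) ->
  (forall a, a \in l3 -> a != v /\ G v a = (ohead l3 == Some a)) ->
  induced_path G (catrev l2 (v :: l3)).
Proof.
move=> ip2 ip3 cross v2 v3; apply: induced_path_catrev => //.
  apply: induced_path_cons => //; first by apply/negP => /v3[]; rewrite eqxx.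
  by move=> y /v3[].
move=> a b a2; rewrite inE => /orP[/eqP->|b3].
  have [av va] := v2 a a2; rewrite adj_sym va eqxx andbT; split=> //.
  by rewrite inE negb_or av; apply/negP => /(cross a a a2)[]; rewrite eqxx.
have [ab Gab] := cross a b a2 b3; have [av _] := v2 a a2; have [bv _] := v3 b b3; split.
  by rewrite inE negb_or av; apply/negP => /(cross a a a2)[]; rewrite eqxx.
have -> : (ohead (v :: l3) == Some b) = false; last by rewrite andbF (negPf Gab).
by apply/negbTE; apply: contra bv => /eqP[->].
Qed.

Lemma cut_part_cross v K2 K3 a b : cut_part G v K2 -> cut_part G v K3 -> [disjoint K2 & K3] ->
  a \in K2 -> b \in K3 -> a != b /\ ~~ G a b.
Proof.
move=> cl2 [v3 _] d a2 b3; split; last exact: (cut_part_nadj cl2 v3 d).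
by apply: contraTneq b3 => <-; rewrite (disjointFr d a2).
Qed.

Lemma part_nbr H v K k : connected G H -> v \in H -> K \subset H -> cut_part G v K -> k \in K ->
  exists2 i, i \in K & G v i.
Proof.
move=> cH vH KH [vK clK] kK.
have [a [b [aK bK /and3P[_ _ Gab]]]] := connect_crossing (cH k v (fintype.subsetP KH k kK) vH) kK vK.
exists a => //; have [<-|bv] := eqVneq b v; first by rewrite adj_sym.
by rewrite (clK a b) in bK.
Qed.

Lemma far_part_cut_part v K t w L : cut_part G v K -> w \in K -> (forall i, i \in K -> G v i = (i == t)) ->
  far_part G K t w L -> cut_part G w L.
Proof.
move=> [vK clK] wK vt [LK wL tL clL]; split=> // i j iL Gij jw.
have iK := fintype.subsetP LK i iL.
have [jv|jv] := eqVneq j v; last by apply: (clL i j) => //; exact: clK Gij jv.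
by have := vt i iK; rewrite adj_sym -jv Gij => /esym/eqP it; rewrite it (negPf tL) in iL.
Qed.

(** The two hypotheses exclude cycles and vertices of degree three: around t there are at
    most two components, and each is a path attached by its end, by rooted_path. *)
Lemma tree_path H t : connected G H -> (forall i j, i \in H -> G i j -> j \in H) -> t \in H ->
  (forall w L i j, w \in H -> L \subset H -> cut_part G w L -> connected G L ->
     i \in L -> j \in L -> i != j -> G w i -> G w j -> False) ->
  (forall w L1 L2 L3 i1 i2 i3, w \in H -> L1 \subset H -> L2 \subset H -> L3 \subset H ->
     cut_part G w L1 -> cut_part G w L2 -> cut_part G w L3 ->
     [disjoint L1 & L2] -> [disjoint L1 & L3] -> [disjoint L2 & L3] ->
     i1 \in L1 -> i2 \in L2 -> i3 \in L3 -> False) ->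
  exists s, induced_path G s /\ forall i, (i \in H) = (i \in s).
Proof.
move=> cH clH tH noloop nofork.
have leg K k : K \subset H -> cut_part G t K -> connected G K -> k \in K ->
  exists i s, [/\ induced_path G (i :: s), forall x, (x \in K) = (x \in i :: s)
     & forall x, x \in K -> G t x = (x == i)].
  move=> KH clK cK kK; have [tK _] := clK.
  have [i iK ti] := part_nbr cH tH KH clK kK.
  have tE x : x \in K -> G t x = (x == i).
    move=> xK; apply/idP/eqP => [tx|-> //]; apply/eqP/negPn/negP => xi.
    exact: (noloop t K x i).
  have [[s [ips sE]]|[w wK br]] := rooted_path cK iK; first by exists i, s.
  have wH := fintype.subsetP KH w wK.
  have sub L : far_part G K i w L -> L \subset H by case=> LK _ _ _; exact: subset_trans LK KH.
  have cll L := far_part_cut_part (L := L) clK wK tE.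
  case: br => [[L [x [y [rL cL xL yL [xy wx wy]]]]]|[L1 [L2 [x [y [r1 r2 d xL [yL _ _]]]]]]].
    by case: (noloop w L x y wH (sub L rL) (cll L rL) cL xL yL xy wx wy).
  have [L1K w1 i1 _] := r1; have [L2K w2 i2 _] := r2.
  have [_ c1] := cll _ r1; have [_ c2] := cll _ r2.
  case: (nofork w L1 L2 (H :\: (w |: (L1 :|: L2))) x y t wH) => //.
  - exact: sub _ r1.
  - exact: sub _ r2.
  - exact: subsetDl.
  - split; first by rewrite !inE eqxx.
    move=> a b; rewrite !inE !negb_or => /andP[/and3P[aw a1 a2] aH] Gab bw.
    rewrite bw (clH a b aH Gab) andbT /=; apply/andP; split.
      by apply: contra a1 => b1; apply: (c1 b a b1 _ aw); rewrite adj_sym.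
    by apply: contra a2 => b2; apply: (c2 b a b2 _ aw); rewrite adj_sym.
  - by rewrite disjoints_subset; apply/fintype.subsetP => a a1; rewrite !inE a1 orbT.
  - by rewrite disjoints_subset; apply/fintype.subsetP => a a2; rewrite !inE a2 !orbT.
  - rewrite !inE tH andbT !negb_or; apply/and3P; split.
    + by apply: contraNneq tK => ->.
    + by apply: contra tK => /(fintype.subsetP L1K).
    + by apply: contra tK => /(fintype.subsetP L2K).
pose Ht := H :\ t.
have clHt : cut_part G t Ht.
  by split=> [|i j]; rewrite !inE ?eqxx// => /andP[_ iH] Gij ->; exact: clH Gij.
have HtH : Ht \subset H by exact: subD1set.
pose comp k := component G (~: [set t]) k.
have compS k : k \in Ht -> comp k \subset Ht by exact: component_min.
have mem_comp k : k \in Ht -> k \in comp k.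
  by move=> kH; apply: mem_component; move: kH; rewrite !inE => /andP[].
have [Ht0|[k1 k1H]] := set_0Vmem Ht.
  exists [:: t]; split=> // i; rewrite inE.
  by have := in_set0 i; rewrite -Ht0 !inE; case: eqVneq => [->|]; rewrite ?tH.
have cl1 : cut_part G t (comp k1) by exact: component_cut_part.
have [t1 [s1 [ip1 s1E t1E]]] := leg (comp k1) k1 (subset_trans (compS k1 k1H) HtH) cl1
   (@component_connected _ _ _ _) (mem_comp k1 k1H).
have nt k i : k \in Ht -> i \in comp k -> i != t.
  by move=> kH /(fintype.subsetP (compS k kH)); rewrite !inE => /andP[].
have [Hk1|/subsetPn[k2 k2H k2k1]] := boolP (Ht \subset comp k1).
  exists (t :: t1 :: s1); split.
    apply: (@join_path t [::] (t1 :: s1)) => // a; rewrite -s1E => a1.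
    by rewrite (nt k1)//; split=> //; rewrite (t1E a a1) /= eq_sym; apply/eqP/eqP => [->|[->]].
  have HE : comp k1 = Ht by apply/eqP; rewrite eqEsubset Hk1 compS.
  move=> i; rewrite in_cons -s1E HE in_setD1; case: eqVneq => // ->; by rewrite tH.
have cl2 : cut_part G t (comp k2) by exact: component_cut_part.
have d12 : [disjoint comp k1 & comp k2].
  rewrite disjoints_subset; apply/fintype.subsetP => x; rewrite !inE => /andP[xt k1x].
  rewrite xt /=; apply: contra k2k1 => k2x; rewrite !inE; move: k2H; rewrite !inE => /andP[-> _] /=.
  by apply: connect_trans k1x _; rewrite withinC.
have [t2 [s2 [ip2 s2E t2E]]] := leg (comp k2) k2 (subset_trans (compS k2 k2H) HtH) cl2
   (@component_connected _ _ _ _) (mem_comp k2 k2H).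
exists (catrev (t1 :: s1) (t :: t2 :: s2)); split.
  apply: join_path => //.
  - by move=> a b; rewrite -s1E -s2E; exact: cut_part_cross cl1 cl2 d12.
  - move=> a; rewrite -s1E => a1; rewrite (nt k1)//; split=> //.
    by rewrite (t1E a a1) /= eq_sym; apply/eqP/eqP => [->|[->]].
  - move=> a; rewrite -s2E => a1; rewrite (nt k2)//; split=> //.
    by rewrite (t2E a a1) /= eq_sym; apply/eqP/eqP => [->|[->]].
have [Hk12|/subsetPn[k3 k3H k3k]] := boolP (Ht \subset comp k1 :|: comp k2).
  have HE : comp k1 :|: comp k2 = Ht by apply/eqP; rewrite eqEsubset Hk12 subUset !compS.
  move=> i; rewrite catrevE mem_cat mem_rev -s1E in_cons -s2E orbCA -in_setU HE in_setD1.
  by case: eqVneq => // ->; rewrite tH.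
clearbody Ht.
case: (nofork t (comp k1) (comp k2) (Ht :\: (comp k1 :|: comp k2)) k1 k2 k3 tH) => //.
- exact: subset_trans (compS _ _) HtH.
- exact: subset_trans (compS _ _) HtH.
- by apply: (subset_trans _ HtH); exact: subsetDl.
- have [tn c1] := cl1; have [_ c2] := cl2; have [tHt clHt'] := clHt.
  split=> [|x y]; first by rewrite in_setD (negPf tHt) andbF.
  rewrite !in_setD !in_setU !negb_or => /andP[/andP[x1 x2] xH] Gxy yt.
  rewrite (clHt' x y)// andbT; have xt : x != t by apply: contraNneq tHt => <-.
  apply/andP; split.
    by apply: contra x1 => y1; apply: (c1 y x y1 _ xt); rewrite adj_sym.
  by apply: contra x2 => y2; apply: (c2 y x y2 _ xt); rewrite adj_sym.
- by rewrite disjoints_subset; apply/fintype.subsetP => x xK; rewrite in_setC in_setD in_setU xK.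
- by rewrite disjoints_subset; apply/fintype.subsetP => x xK; rewrite in_setC in_setD in_setU xK orbT.
- exact: mem_comp.
- exact: mem_comp.
- by rewrite in_setD k3k.
Qed.

End Trees.

(** * Cycles *)

Section Bridges.
Variable n : nat.
Variable G : graph n.
Implicit Types (K L U C H T X Y : {set 'I_n}) (v i j k t w z a b : 'I_n) (s l : seq 'I_n).

Definition minus_edge C a b : rel 'I_n := fun i j =>
  within G C i j && ~~ [|| (i == a) && (j == b) | (i == b) && (j == a)].

Lemma minus_edge_sym C a b : symmetric (minus_edge C a b).
Proof.
by move=> i j; rewrite /minus_edge within_sym orbC (andbC (i == b)) (andbC (i == a)).
Qed.

Definition side C a b : {set 'I_n} := [set i in C | connect (minus_edge C a b) a i].

Definition flip X (c : 'I_n -> bool) i := if i \in X then c i else ~~ c i.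

(** Retracting C onto X, with all of Y sent to a, maps bichromatic edges to bichromatic
    edges or to points, so X remains connected by its bichromatic edges; the same holds for
    Y. Flipping the colours on Y gives a and b the same colour, as q_bridge requires. *)
Lemma side_split C c a b : connecting_coloring G C c -> a \in C -> b \in C -> G a b ->
  c a != c b -> ~~ connect (minus_edge C a b) a b ->
  let X := side C a b in let Y := C :\: X in
  [/\ a \in X, b \in Y,
      connecting_coloring G X (flip X c), connecting_coloring G Y (flip X c)
    & forall i j, i \in X -> j \in Y -> G i j = (i == a) && (j == b)].
Proof.
move=> gc aC bC Gab cab nab X Y.
have aX : a \in X by rewrite inE aC connect0.
have bX : b \notin X by rewrite inE bC.
have bY : b \in Y by rewrite in_setD bX.
have XC : X \subset C by apply/fintype.subsetP => i; rewrite inE => /andP[].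
have memY i : (i \in Y) = (i \in C) && (i \notin X) by rewrite in_setD andbC.
have cross i j : i \in X -> j \in C -> j \notin X -> G i j -> i = a /\ j = b.
  rewrite !inE => /andP[iC ai] jC; rewrite jC /= => aj Gij.
  have : ~~ minus_edge C a b i j by apply: contra aj => wij; apply: connect_trans ai (connect1 wij).
  rewrite /minus_edge /within iC jC Gij /= negbK => /orP[/andP[/eqP-> /eqP->]//|].
  by move=> /andP[/eqP ib _]; rewrite ib (negPf nab) in ai.
have cross' i j : i \in X -> j \in Y -> G i j -> i = a /\ j = b.
  by move=> iX; rewrite memY => /andP[jC jX]; exact: cross.
split=> //.
- have retr i j : bichrom G C c i j ->
      connect (bichrom G X (flip X c)) (if i \in X then i else a) (if j \in X then j else a).
    move=> /and4P[iC jC Gij cij].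
    case: ifPn => iX; case: ifPn => jX; last exact: connect0.
    + by apply: connect1; rewrite /bichrom iX jX Gij /flip iX jX.
    + by have [-> _] := cross i j iX jC jX Gij; exact: connect0.
    + by have [] := cross j i jX iC iX; rewrite 1?adj_sym// => -> _; exact: connect0.
  move=> i j iX jX.
  have := connect_map retr (gc i j (fintype.subsetP XC i iX) (fintype.subsetP XC j jX)).
  by rewrite iX jX.
- have retr i j : bichrom G C c i j ->
      connect (bichrom G Y (flip X c)) (if i \in X then b else i) (if j \in X then b else j).
    move=> /and4P[iC jC Gij cij].
    case: ifPn => iX; case: ifPn => jX; first exact: connect0.
    + by have [_ ->] := cross i j iX jC jX Gij; exact: connect0.
    + by have [] := cross j i jX iC iX; rewrite 1?adj_sym// => _ ->; exact: connect0.
    + apply: connect1; rewrite /bichrom !memY iC jC iX jX Gij /flip (negPf iX) (negPf jX) /=.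
      by move: cij; case: (c i); case: (c j).
  move=> i j; rewrite !memY => /andP[iC iX] /andP[jC jX].
  have := connect_map retr (gc i j iC jC).
  by rewrite (negPf iX) (negPf jX).
- by move=> i j iX jY; apply/idP/andP => [/(cross' i j iX jY)[-> ->]//|[/eqP-> /eqP->]].
Qed.

End Bridges.

Section Connected.
Variable R : realType.
Variable n : nat.
Variable G : graph n.
Hypothesis large_q : ~ (q R G + 2 <= n)%N.
Hypothesis connG : connected G [set: 'I_n].
Implicit Types (K L U C H T X Y : {set 'I_n}) (v i j k t w z a b : 'I_n) (s l : seq 'I_n).

Lemma part_has_nbr v K k : cut_part G v K -> k \in K -> exists2 i, i \in K & G v i.
Proof. by move=> clK kK; apply: (part_nbr connG _ _ clK kK); rewrite ?inE. Qed.

Lemma three_legs_near_path v z K2 K3 t2 s2 t3 s3 : induced_path G (t2 :: s2) -> induced_path G (t3 :: s3) ->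
  (forall x, (x \in K2) = (x \in t2 :: s2)) -> (forall x, (x \in K3) = (x \in t3 :: s3)) ->
  (forall x, x \in K2 -> G v x = (x == t2)) -> (forall x, x \in K3 -> G v x = (x == t3)) ->
  cut_part G v [set z] -> cut_part G v K2 -> cut_part G v K3 -> [disjoint K2 & K3] ->
  z \notin K2 -> z \notin K3 -> (forall x, x \in [set z] :|: (K2 :|: K3) = (x != v)) ->
  near_path G.
Proof.
move=> ip2 ip3 E2 E3 v2 v3 clz cl2 cl3 d23 z2 z3 cover.
have [vz clz'] := clz; have [vK2 _] := cl2; have [vK3 _] := cl3.
exists z, (catrev (t2 :: s2) (v :: t3 :: s3)); split.
- apply: join_path => //.
  + by move=> a b; rewrite -E2 -E3; exact: cut_part_cross cl2 cl3 d23.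
  + move=> a; rewrite -E2 => a2; split; first by apply: contraNneq vK2 => <-.
    by rewrite v2//= eq_sym; apply/eqP/eqP => [->|[->]].
  + move=> a; rewrite -E3 => a3; split; first by apply: contraNneq vK3 => <-.
    by rewrite v3//= eq_sym; apply/eqP/eqP => [->|[->]].
- move=> i; rewrite catrevE mem_cat mem_rev -E2 in_cons -E3.
  have := cover i; rewrite !in_setU in_set1.
  have [->|iv] := eqVneq i v; first by rewrite orbT => _; apply/esym; move: vz; rewrite in_set1.
  have [->|iz] := eqVneq i z; first by rewrite (negPf z2) (negPf z3).
  by rewrite /=.
- constructor 2; exists (rev (t2 :: s2)), v, (t3 :: s3); split; first by rewrite catrevE.
  move=> i; have [->|iv] := eqVneq i v.
    have [x /set1P-> vx] := part_has_nbr clz (finset.set11 z).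
    by rewrite adj_sym.
  apply/negbTE/negP => Gzi.
  have := clz' z i (finset.set11 z) Gzi iv; rewrite in_set1 => /eqP iz.
  by rewrite iz adj_irrefl in Gzi.
Qed.

(** No component of G - w contains two neighbours of w, so G has no cycle. *)
Definition no_loops := forall w L i j, cut_part G w L -> connected G L ->
  i \in L -> j \in L -> i != j -> G w i -> G w j -> False.

(** There are exactly three components of G - v, by no_four_parts. None of them is good, by
    q_good_two_parts, so each is a path attached to v by its end. They do not all have an
    edge, by q_three_edges, so one of them is a single vertex, which serves as z. *)
Lemma three_parts_near_path v L1 L2 L3 i1 i2 i3 : no_loops ->
  cut_part G v L1 -> cut_part G v L2 -> cut_part G v L3 ->
  [disjoint L1 & L2] -> [disjoint L1 & L3] -> [disjoint L2 & L3] ->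
  i1 \in L1 -> i2 \in L2 -> i3 \in L3 -> near_path G.
Proof.
move=> noloop c1 c2 c3 d12 d13 d23 iL1 iL2 iL3.
pose comp k := component G (~: [set v]) k.
have [K1 [K2 [K3 [[k1 k2 k3] [K12 K13 K23] cover [cn1 cn2 cn3] [iK1 iK2 iK3]]]]] :
  exists K1 K2 K3, [/\ [/\ cut_part G v K1, cut_part G v K2 & cut_part G v K3],
     [/\ [disjoint K1 & K2], [disjoint K1 & K3] & [disjoint K2 & K3]],
     forall x, x \in K1 :|: (K2 :|: K3) = (x != v),
     [/\ connected G K1, connected G K2 & connected G K3] & [/\ i1 \in K1, i2 \in K2 & i3 \in K3]].
  have sub L i (cL : cut_part G v L) (iL : i \in L) : comp i \subset L by exact: component_min.
  have mem L i (cL : cut_part G v L) (iL : i \in L) : i \in comp i.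
    by apply: mem_component; have [vL _] := cL; rewrite !inE; apply: contraNneq vL => <-.
  exists (comp i1), (comp i2), (comp i3).
  have s1 := sub _ _ c1 iL1; have s2 := sub _ _ c2 iL2; have s3 := sub _ _ c3 iL3.
  have e12 : [disjoint comp i1 & comp i2] by exact: disjointW s1 s2 d12.
  have e13 : [disjoint comp i1 & comp i3] by exact: disjointW s1 s3 d13.
  have e23 : [disjoint comp i2 & comp i3] by exact: disjointW s2 s3 d23.
  have cc i : cut_part G v (comp i) by exact: component_cut_part.
  split=> //; last 2 first.
  - by split; exact: component_connected.
  - by split; [exact: mem iL1|exact: mem iL2|exact: mem iL3].
  move=> x; apply/idP/idP => [|xv].
    have vn i : v \notin comp i by have [] := cc i.
    by apply: contraTneq => ->; rewrite !in_setU !negb_or !vn.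
  apply/negPn/negP => xK.
  have clR : cut_part G v (~: (v |: (comp i1 :|: (comp i2 :|: comp i3)))).
    by apply: cut_part_compl; apply: cut_partU; [|apply: cut_partU].
  apply: (no_four_parts large_q (cc i1) (cc i2) (cc i3) clR e12 e13 _ e23 _ _ (mem _ _ c1 iL1)
     (mem _ _ c2 iL2) (mem _ _ c3 iL3) (i4 := x)).
  - by rewrite disjoints_subset; apply/fintype.subsetP => y yK; rewrite !in_setC negbK in_setU1 in_setU yK orbT.
  - by rewrite disjoints_subset; apply/fintype.subsetP => y yK; rewrite !in_setC negbK in_setU1 !in_setU yK !orbT.
  - by rewrite disjoints_subset; apply/fintype.subsetP => y yK; rewrite !in_setC negbK in_setU1 !in_setU yK !orbT.
  - by rewrite in_setC in_setU1 negb_or xv.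
have coverE : K1 :|: (K2 :|: K3) = ~: [set v].
  by apply/setP => x; rewrite cover in_setC in_set1.
have sym (A B : {set 'I_n}) : [disjoint A & B] -> [disjoint B & A] by rewrite disjoint_sym.
have ng K K' K'' k k' k'' : cut_part G v K -> cut_part G v K' -> cut_part G v K'' ->
    [disjoint K & K'] -> [disjoint K & K''] -> [disjoint K' & K''] ->
    k \in K -> k' \in K' -> k'' \in K'' ->
    K :|: (K' :|: K'') = K1 :|: (K2 :|: K3) -> ~ good R G v K.
  move=> cK cK' cK'' e e' e'' kK kK' kK'' KE gK; apply: large_q.
  have [i iK vi] := part_has_nbr cK kK.
  apply: (q_good_two_parts cK gK iK vi cK' cK'' e e' e'' kK' kK'').
  by rewrite KE coverE.
have leg K k : cut_part G v K -> connected G K -> k \in K -> ~ good R G v K ->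
   exists t s, [/\ induced_path G (t :: s), forall x, (x \in K) = (x \in t :: s)
     & forall x, x \in K -> G v x = (x == t)].
  move=> cK cnK kK ngK; have [t tK vt] := part_has_nbr cK kK.
  have tE x : x \in K -> G v x = (x == t).
    move=> xK; apply/idP/eqP => [vx|-> //]; apply/eqP/negPn/negP => xt.
    exact: (noloop v K x t).
  have [[s [ips sE]]|br] := rooted_path cnK tK; first by exists t, s.
  by case: ngK; exact: good_branch tK tE br.
have [t1 [s1 [ip1 E1 v1]]] := leg K1 i1 k1 cn1 iK1
  (ng K1 K2 K3 i1 i2 i3 k1 k2 k3 K12 K13 K23 iK1 iK2 iK3 erefl).
have [t2 [s2 [ip2 E2 v2]]] : exists t s, [/\ induced_path G (t :: s), forall x, (x \in K2) = (x \in t :: s)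
     & forall x, x \in K2 -> G v x = (x == t)].
  apply: (leg K2 i2) => //.
  by apply: (ng K2 K1 K3 i2 i1 i3) => //; [exact: sym|rewrite finset.setUCA].
have [t3 [s3 [ip3 E3 v3]]] : exists t s, [/\ induced_path G (t :: s), forall x, (x \in K3) = (x \in t :: s)
     & forall x, x \in K3 -> G v x = (x == t)].
  apply: (leg K3 i3) => //.
  apply: (ng K3 K1 K2 i3 i1 i2) => //; [exact: sym|exact: sym|].
  by rewrite finset.setUC finset.setUA.
have notin K K' x : [disjoint K & K'] -> x \in K -> x \notin K'.
  by move=> e xK; rewrite (disjointFr e xK).
have [K1E|[j1 jK1 G1]] := connected_singleton cn1 iK1.
  apply: (@three_legs_near_path v i1 K2 K3 t2 s2 t3 s3); rewrite -?K1E//.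
  - exact: notin K12 iK1.
  - exact: notin K13 iK1.
have [K2E|[j2 jK2 G2]] := connected_singleton cn2 iK2.
  apply: (@three_legs_near_path v i2 K1 K3 t1 s1 t3 s3); rewrite -?K2E//.
  - exact: notin (sym _ _ K12) iK2.
  - exact: notin K23 iK2.
  - by rewrite finset.setUCA.
have [K3E|[j3 jK3 G3]] := connected_singleton cn3 iK3.
  apply: (@three_legs_near_path v i3 K1 K2 t1 s1 t2 s2); rewrite -?K3E//.
  - exact: notin (sym _ _ K13) iK3.
  - exact: notin (sym _ _ K23) iK3.
  - by rewrite finset.setUC -finset.setUA.
case: large_q; apply: (q_three_edges R k1 k2 k3 K12 K13 K23 _ iK1 jK1 G1 iK2 jK2 G2 iK3 jK3 G3).
by rewrite -finset.setUA.
Qed.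

(** The graph outside B and b is connected and contains two neighbours of b, so it is good,
    and by tail_path the set B is empty or a path attached to b by its end. The same holds
    for C at c, and a serves as z. *)
Lemma triangle_near_path a b c (B C : {set 'I_n}) : G a b -> G b c -> G a c ->
  a \notin B -> b \notin B -> c \notin B -> a \notin C -> b \notin C -> c \notin C ->
  [disjoint B & C] -> (forall x, [|| x == a, x == b, x == c, x \in B | x \in C]) ->
  (forall x y, x \in B -> G x y -> y != b -> y \in B) ->
  (forall x y, x \in C -> G x y -> y != c -> y \in C) -> near_path G.
Proof.
move=> Gab Gbc Gac aB bB cB aC bC cC dBC cover clB clC.
have neq x y : G x y -> x != y by apply: contraTneq => ->; rewrite adj_irrefl.
have ab := neq _ _ Gab; have bc := neq _ _ Gbc; have ac := neq _ _ Gac.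
have tail (b' c' : 'I_n) (T : {set 'I_n}) : G a b' -> G b' c' -> G a c' ->
    a \notin T -> b' \notin T -> c' \notin T ->
    (forall x y, x \in T -> G x y -> y != b' -> y \in T) ->
    (forall x, x \notin T -> G x b' -> x = a \/ x = c') ->
    exists l, [/\ induced_path G l, forall x, (x \in T) = (x \in l)
      & forall x, x \in T -> G b' x = (ohead l == Some x)].
  move=> Gab' Gbc' Gac' aT b'T c'T clT nb'.
  have [T0|[k kT]] := set_0Vmem T.
    by exists [::]; split=> // x; rewrite T0 !inE.
  pose K := ~: (b' |: T).
  have clT' : cut_part G b' T by [].
  have clK : cut_part G b' K by exact: cut_part_compl.
  have aK : a \in K by rewrite in_setC in_setU1 negb_or neq.
  have c'K : c' \in K by rewrite in_setC in_setU1 negb_or eq_sym neq.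
  have TE : ~: (b' |: K) = T.
    apply/setP => x; rewrite !inE !negb_or negb_and !negbK.
    by have [->|//] := eqVneq x b'; rewrite (negPf b'T).
  have to_a x : x \in K -> G x b' -> connect (within G K) x a.
    move=> xK; have := xK; rewrite in_setC in_setU1 negb_or => /andP[_ xT] /(nb' x xT)[->|xc].
      exact: connect0.
    by apply: connect1; rewrite /within xK aK xc adj_sym.
  have retr x y : within G [set: 'I_n] x y ->
     connect (within G K) (if x \in K then x else a) (if y \in K then y else a).
    move=> /and3P[_ _ Gxy].
    have half z w : z \in K -> w \notin K -> G z w -> connect (within G K) z a.
      move=> zK wK Gzw; have [wb|wb] := eqVneq w b'; first by apply: to_a; rewrite -?wb.
      move: wK zK; rewrite !in_setC !in_setU1 negbK (negPf wb) /= negb_or => wT /andP[zb zT].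
      by rewrite (clT w z wT) // adj_sym in zT.
    case: ifPn => xK; case: ifPn => yK; last exact: connect0.
    + by apply: connect1; rewrite /within xK yK.
    + exact: half Gxy.
    + by rewrite withinC; apply: half yK xK _; rewrite adj_sym.
  have cK : connected G K.
    move=> x y xK yK; have := connect_map retr (connG (in_setT x) (in_setT y)).
    by rewrite xK yK.
  have gK : good R G b' K by apply: (good_loop R cK aK c'K) => //; [exact: neq|rewrite adj_sym].
  have [t tT bt] := part_has_nbr clT' kT.
  have := tail_path large_q clK gK c'K Gbc'; rewrite TE => /(_ t tT bt)[s [ips sE tE]].
  exists (t :: s); split=> // x xT; rewrite tE//= eq_sym.
  by apply/eqP/eqP => [->|[->]].
have nb x : x \notin B -> G x b -> x = a \/ x = c.
  move=> xB Gxb; have /or4P[/eqP->|/eqP xb|/eqP->|/orP[xB'|xC]] := cover x; [by left| |by right| |].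
  - by rewrite xb adj_irrefl in Gxb.
  - by rewrite xB' in xB.
  - by rewrite (clC x b xC Gxb bc) in bC.
have nc x : x \notin C -> G x c -> x = a \/ x = b.
  move=> xC Gxc; have /or4P[/eqP->|/eqP->|/eqP xc|/orP[xB|xC']] := cover x; [by left|by right| | |].
  - by rewrite xc adj_irrefl in Gxc.
  - by rewrite (clB x c xB Gxc) ?(eq_sym c)// in cB.
  - by rewrite xC' in xC.
have [lb [ipb bE bn]] := tail b c B Gab Gbc Gac aB bB cB clB nb.
have Gcb : G c b by rewrite adj_sym.
have [lc [ipc cE cn]] := tail c b C Gac Gcb Gab aC cC bC clC nc.
have lcE x : (x \in c :: lc) = (x == c) || (x \in C) by rewrite in_cons cE.
exists a, (catrev lb (b :: c :: lc)); split.
- apply: join_path => //.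
  + apply: induced_path_cons => //; first by rewrite -cE.
    by move=> y; rewrite -cE; exact: cn.
  + move=> x y; rewrite -bE lcE => xB /orP[/eqP->|yC].
      split; first by apply: contraNneq cB => <-.
      by apply/negP => Gxc; rewrite (clB x c xB Gxc) ?(eq_sym c)// in cB.
    split; first by apply: contraTneq yC => <-; rewrite (disjointFr dBC xB).
    apply/negP => Gxy; have yb : y != b by apply: contraNneq bC => <-.
    by have := disjointFr dBC (clB x y xB Gxy yb); rewrite yC.
  + move=> x; rewrite -bE => xB; split; last exact: bn.
    by apply: contraNneq bB => <-.
  + move=> x; rewrite lcE => /orP[/eqP->|xC].
      by rewrite eq_sym bc Gbc eqxx.
    split; first by apply: contraNneq bC => <-.
    rewrite /=; have -> : (Some c == Some x) = false.
      by apply/negbTE; apply: contraNneq cC => -[->].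
    by apply/negbTE; apply: contraNN bC => Gbx; apply: (clC x) => //; rewrite adj_sym.
- move=> x; rewrite catrevE mem_cat mem_rev -bE in_cons lcE.
  have [->|xa] := eqVneq x a.
    by rewrite (negPf aB) (negPf ab) (negPf ac) (negPf aC).
  by have := cover x; rewrite (negPf xa) /= => /or4P[->|->|->|->]; rewrite ?orbT.
- constructor 3; exists (rev lb), b, c, lc; split; first by rewrite catrevE.
  move=> x; apply/idP/orP => [Gax|[/eqP->|/eqP->]//].
  have /or4P[/eqP xa|->|->|/orP[xB|xC]] := cover x; [by rewrite xa adj_irrefl in Gax|by left|by right| |].
    by rewrite (clB x a xB) 1?adj_sym// in aB.
  by rewrite (clC x a xC) 1?adj_sym// in aC.
Qed.

(** The two neighbours of v in C have different colours, by q_same_colour, so the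
    bichromatic path between them has odd length. If it has at least three edges, its second
    edge is a bridge of C, since otherwise a vertex of the path would have three neighbours
    in one component, and q_bridge applies. If it is a single edge, this edge is a bridge of
    C for the same reason. Then q_bridge applies to the triangle unless one of its vertices
    has no further neighbour, which is the situation of triangle_near_path. *)
Lemma loop_near_path v C x1 x2 : cut_part G v C -> connected G C -> x1 \in C -> x2 \in C ->
  x1 != x2 -> G v x1 -> G v x2 -> near_path G.
Proof.
move=> clC cC x1C x2C x12 vx1 vx2; have [vC clC'] := clC.
have vE x : x \in C -> G v x = (x == x1) || (x == x2).
  move=> xC; apply/idP/orP => [vx|[]/eqP-> //].
  have [->|n1] := eqVneq x x1; [by left|right]; apply/negPn/negP => n2.
  apply: (no_three_nbrs large_q clC cC x1C x2C xC x12 _ _ vx1 vx2 vx); by rewrite eq_sym.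
have [c gc] := exists_coloring cC x1C.
have [cx|cx] := eqVneq (c x1) (c x2).
  by case: large_q; exact: (q_same_colour R clC gc x1C x2C x12 vx1 vx2 cx).
have neq x y : G x y -> x != y by apply: contraTneq => ->; rewrite adj_irrefl.
have vnot x : x \in C -> x != v by apply: contraTneq => ->.
have sub : subrel (bichrom G C c) (adj G) by move=> x y /and4P[].
have bC x y : bichrom G C c x y -> y \in C by case/and4P.
have minus_sub a b : subrel (minus_edge G C a b) (adj G).
  by move=> x y /andP[/and3P[]].
have minus_C a b x y : minus_edge G C a b x y -> y \in C by move=> /andP[/and3P[]].
have pathC (r : rel 'I_n) x p : (forall x y, r x y -> y \in C) -> path r x p -> all (mem C) p.
  by move=> rC; elim: p x => //= y p IH x /andP[/rC-> /IH].
have /connectP[p0 pp0 lp0] := gc x1 x2 x1C x2C.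
move: lp0; case: (shortenP pp0) => {pp0} p pp up _ lp {p0}.
case: p => [|y1 p] in pp up lp; first by rewrite lp eqxx in x12.
have pC := pathC _ _ _ bC pp.
move: pp => /= /andP[x1y1 pp].
have /and4P[_ y1C Gx1y1 cx1y1] := x1y1.
(* The form in which no_three_nbrs is used for the vertices of a cycle through v. *)
have third y K z1 z2 z3 : cut_part G y K -> connected G K -> z1 \in K -> z2 \in K -> z3 \in K ->
    z1 != z2 -> G y z1 -> G y z2 -> G y z3 -> z3 = z1 \/ z3 = z2.
  move=> clK cK k1 k2 k3 k12 g1 g2 g3.
  have [->|n1] := eqVneq z3 z1; [by left|right]; apply/eqP/negPn/negP => n2.
  by apply: (no_three_nbrs large_q clK cK k1 k2 k3 k12 _ _ g1 g2 g3); rewrite eq_sym.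
have comp_edge w i j k : i \in component G (~: [set w]) k -> G i j -> j != w ->
    j \in component G (~: [set w]) k.
  by move=> ik Gij jw; apply: (component_closed ik) => //; rewrite !inE.
have comp_path w i s k : i \in component G (~: [set w]) k -> path (adj G) i s -> w \notin i :: s ->
    last i s \in component G (~: [set w]) k.
  move=> ik pis ws; have c1 := path_avoiding pis ws.
  have : last i s \in ~: [set w].
    by rewrite !inE; apply: contraNneq ws => <-; exact: mem_last.
  move: ik; rewrite [in X in X -> _]inE => /andP[_ ki] lw; rewrite inE lw /=.
  exact: connect_trans ki c1.
have comp_rpath w i s k : last i s \in component G (~: [set w]) k -> path (adj G) i s -> w \notin i :: s ->
    i \in component G (~: [set w]) k.
  move=> ik pis ws; have c1 := path_avoiding pis ws.
  have : i \in ~: [set w].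
    by rewrite !inE; apply: contraNneq ws => <-; exact: mem_head.
  move: ik; rewrite [in X in X -> _]inE => /andP[_ ki] lw; rewrite inE lw /=.
  by apply: connect_trans ki _; rewrite withinC.
have comp_self w k : k != w -> k \in component G (~: [set w]) k.
  by move=> kw; apply: mem_component; rewrite !inE.
have flipX X x : x \in X -> flip X c x = c x by rewrite /flip => ->.
have flipY X x : x \in C :\: X -> flip X c x = ~~ c x.
  by rewrite in_setD /flip => /andP[/negPf->].
have coverXY a b : side G C a b :|: (C :\: side G C a b) = C.
  apply/setP => x; rewrite in_setU in_setD; case: (boolP (x \in side G C a b)) => //=.
  by rewrite inE => /andP[->].
have disXY a b : [disjoint side G C a b & C :\: side G C a b].
  by rewrite disjoints_subset; apply/fintype.subsetP => x xX; rewrite in_setC in_setD xX.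
have vnbr1 X : x1 \in X -> x2 \in C :\: X -> X \subset C ->
    (forall x, x \in X -> G v x = (x == x1)) /\ (forall x, x \in C :\: X -> G v x = (x == x2)).
  rewrite in_setD => x1X /andP[x2X _] XC; split=> x.
    move=> xX; rewrite vE ?(fintype.subsetP XC)//; case: (eqVneq x x2) => [xx|_]; last by rewrite orbF.
    by rewrite -xx xX in x2X.
  rewrite in_setD => /andP[xX xC]; rewrite vE//; case: (eqVneq x x1) => [xx|_] //.
  by rewrite xx x1X in xX.
have sideC a b : side G C a b \subset C by apply/fintype.subsetP => x; rewrite inE => /andP[].
case: p => [|y2 p] in pp up lp pC.
  (* The path is a single edge, and v, x1, x2 form a triangle. *)
  move: lp => /= lp; rewrite -lp in x1y1 y1C Gx1y1 cx1y1 => {lp y1 pp up pC}.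
  have nab : ~~ connect (minus_edge G C x1 x2) x1 x2.
    apply/negP => /connectP[r0 pr0 lr0]; move: lr0; case: (shortenP pr0) => {pr0} r pr ur _ lr {r0}.
    case: r => [|q1 r] in pr ur lr; first by rewrite lr eqxx in x12.
    move: pr ur lr => /= /andP[wq1 pr] /andP[x1r ur] lr.
    have x2K := comp_self x1 x2; rewrite eq_sym in x2K; have {}x2K := x2K x12.
    have vK : v \in component G (~: [set x1]) x2.
      by apply: (comp_edge _ _ _ _ x2K); rewrite 1?adj_sym// eq_sym vnot.
    have q1K : q1 \in component G (~: [set x1]) x2.
      by apply: (comp_rpath x1 q1 r); [rewrite -lr|exact: sub_path (@minus_sub _ _) _ _ pr|].
    have x2v : x2 != v by exact: vnot.
    have q1C := minus_C _ _ _ _ wq1; have Gxq := minus_sub _ _ _ _ wq1.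
    have [q1E|q1E] : q1 = x2 \/ q1 = v.
    - apply: (third x1 (component G (~: [set x1]) x2)) => //.
      + exact: component_cut_part.
      + exact: component_connected.
      + by rewrite adj_sym.
    - by move: wq1; rewrite q1E /minus_edge !eqxx andbF.
    - by rewrite q1E (negPf vC) in q1C.
  have [x1X x2Y gX gY cross] := side_split gc x1C x2C Gx1y1 cx nab.
  have XC := sideC x1 x2; have XYC := coverXY x1 x2; have dXY := disXY x1 x2.
  have [vX vY] := vnbr1 _ x1X x2Y XC.
  set X := side G C x1 x2 in x1X x2Y gX gY cross XC XYC dXY vX vY.
  set Y := C :\: X in x2Y gY cross XYC dXY vY.
  have fX := flipX X x1 x1X; have fY := flipY X x2 x2Y.
  have YC x : x \in Y -> x \in C by rewrite in_setD => /andP[].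
  have XYx x : x \in C -> x \in X \/ x \in Y.
    by rewrite -{1}XYC in_setU => /orP.
  clearbody Y; clearbody X.
  have XY x : x \in X -> x \notin Y by move=> xX; rewrite (disjointFr dXY xX).
  have YX x : x \in Y -> x \notin X by move=> xX; rewrite (disjointFl dXY xX).
  have clX x y : x \in X :\ x1 -> G x y -> y != x1 -> y \in X :\ x1.
    rewrite !in_setD1 => /andP[xx1 xX] Gxy ->/=.
    have yv : y != v.
      apply: contraNneq xx1 => yv; rewrite -vX// -yv adj_sym; exact: Gxy.
    have [//|yY] := XYx y (clC' x y (fintype.subsetP XC x xX) Gxy yv).
    by move: Gxy; rewrite (cross x y xX yY) (negPf xx1).
  have clY x y : x \in Y :\ x2 -> G x y -> y != x2 -> y \in Y :\ x2.
    rewrite !in_setD1 => /andP[xx2 xY] Gxy ->/=.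
    have yv : y != v.
      apply: contraNneq xx2 => yv; rewrite -vY// -yv adj_sym; exact: Gxy.
    have [yX|//] := XYx y (clC' x y (YC x xY) Gxy yv).
    by move: Gxy; rewrite adj_sym (cross y x yX xY) (negPf xx2) andbF.
  have [T0|[r rT]] := set_0Vmem (~: (v |: C)).
    apply: (@triangle_near_path v x1 x2 (X :\ x1) (Y :\ x2)) => //.
    - by rewrite in_setD1 negb_and; apply/orP; right; apply: contra vC => /(fintype.subsetP XC).
    - by rewrite in_setD1 eqxx.
    - by rewrite in_setD1 negb_and YX// orbT.
    - by rewrite in_setD1 negb_and; apply/orP; right; apply: contra vC => /YC.
    - by rewrite in_setD1 negb_and XY// orbT.
    - by rewrite in_setD1 eqxx.
    - by apply: disjointW dXY; exact: subD1set.
    - move=> x; rewrite !in_setD1; have [//|xv] := eqVneq x v.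
      have [//|n1] := eqVneq x x1; have [//|n2] := eqVneq x x2; rewrite /=.
      have : x \notin ~: (v |: C) by rewrite T0 inE.
      rewrite in_setC negbK in_setU1 (negPf xv) => /XYx[]->; by rewrite ?orbT.
  have [_ clT] := cut_part_compl clC.
  have vT : v \notin ~: (v |: C) by rewrite !inE eqxx.
  have CT x : x \in C -> x \notin ~: (v |: C) by move=> xC; rewrite in_setC in_setU1 xC orbT.
  have dTC : [disjoint ~: (v |: C) & C].
    by rewrite disjoint_sym disjoints_subset finset.setCK finset.subsetUr.
  have [X1|[m1 m1X]] := set_0Vmem (X :\ x1).
    apply: (@triangle_near_path x1 v x2 (~: (v |: C)) (Y :\ x2)) => //.
    - by rewrite adj_sym.
    - exact: CT.
    - exact: CT.
    - by rewrite in_setD1 negb_and XY// orbT.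
    - by rewrite in_setD1 negb_and; apply/orP; right; apply: contra vC => /YC.
    - by rewrite in_setD1 eqxx.
    - apply: disjointWr dTC; apply/fintype.subsetP => x; rewrite in_setD1 => /andP[_]; exact: YC.
    - move=> x; rewrite in_setC in_setU1 in_setD1; have [//|xv] := eqVneq x v; rewrite ?orbT//.
      have [//|n1] := eqVneq x x1; have [//|n2] := eqVneq x x2; rewrite /= ?orbT//.
      have [/XYx[xX|->]|] := boolP (x \in C); rewrite ?orbT//.
      by have := in_set0 x; rewrite -X1 in_setD1 n1 xX.
  have [Y1|[m2 m2Y]] := set_0Vmem (Y :\ x2).
    apply: (@triangle_near_path x2 v x1 (~: (v |: C)) (X :\ x1)) => //.
    - by rewrite adj_sym.
    - by rewrite adj_sym.
    - exact: CT.
    - exact: CT.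
    - by rewrite in_setD1 negb_and YX// orbT.
    - by rewrite in_setD1 negb_and; apply/orP; right; apply: contra vC => /(fintype.subsetP XC).
    - by rewrite in_setD1 eqxx.
    - apply: disjointWr dTC; apply/fintype.subsetP => x; rewrite in_setD1 => /andP[_]; exact: (fintype.subsetP XC).
    - move=> x; rewrite in_setC in_setU1 in_setD1; have [//|xv] := eqVneq x v; rewrite ?orbT//.
      have [//|n1] := eqVneq x x1; have [//|n2] := eqVneq x x2; rewrite /= ?orbT//.
      have [/XYx[->|xY]|] := boolP (x \in C); rewrite ?orbT//.
      by have := in_set0 x; rewrite -Y1 in_setD1 n2 xY.
  move: m1X m2Y; rewrite !in_setD1 => /andP[m11 m1X] /andP[m22 m2Y].
  case: large_q; apply: (@q_bridge R n G v X Y (flip X c) x1 x1 x2 x2 m1 m2) => //.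
  - by rewrite XYC.
  - by rewrite fX fY; move: cx; case: (c x1); case: (c x2).
  - by rewrite fX fY; move: cx; case: (c x1); case: (c x2).
  - right; have [w wT vw] := part_has_nbr (cut_part_compl clC) rT.
    by exists w => //; move: wT; rewrite in_setC XYC.
move: pp lp up pC => /= /andP[y1y2 pp] lp /and4P[]; rewrite !inE !negb_or.
move=> /and3P[x1y1' x1y2 x1p] /andP[y1y2' y1p] y2p up /and3P[_ y2C pC].
have /and4P[_ _ Gy1y2 cy1y2] := y1y2.
(* Otherwise the path would have two edges, and its ends would have the same colour. *)
have x2y2 : x2 != y2.
  by apply: contraNneq cx => ->; move: cx1y1 cy1y2; case: (c x1); case: (c y1); case: (c y2).
have pG : path (adj G) y2 p by exact: sub_path sub _ _ pp.
have y1yp : y1 \notin y2 :: p by rewrite inE negb_or y1y2'.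
have x1yp : x1 \notin y2 :: p by rewrite inE negb_or x1y2.
have nab : ~~ connect (minus_edge G C y1 y2) y1 y2.
  apply/negP => /connectP[r0 pr0 lr0]; move: lr0; case: (shortenP pr0) => {pr0} r pr ur _ lr {r0}.
  case: r => [|q1 r] in pr ur lr; first by rewrite lr eqxx in y1y2'.
  move: pr ur lr => /= /andP[wq1 pr] /andP[y1r ur] lr.
  have y2K : y2 \in component G (~: [set y1]) y2 by apply: comp_self; rewrite eq_sym.
  have x2K : x2 \in component G (~: [set y1]) y2 by rewrite lp; exact: comp_path.
  have vK : v \in component G (~: [set y1]) y2.
    by apply: (comp_edge _ _ _ _ x2K); rewrite 1?adj_sym// eq_sym vnot.
  have x1K : x1 \in component G (~: [set y1]) y2 by exact: (comp_edge _ _ _ _ vK).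
  have prG : path (adj G) q1 r by exact: sub_path (@minus_sub _ _) _ _ pr.
  have q1K : q1 \in component G (~: [set y1]) y2 by apply: (comp_rpath y1 q1 r) => //; rewrite -lr.
  have Gyq := minus_sub _ _ _ _ wq1.
  have [q1E|q1E] : q1 = x1 \/ q1 = y2.
  - apply: (third y1 (component G (~: [set y1]) y2)) => //.
    + exact: component_cut_part.
    + exact: component_connected.
    + by rewrite adj_sym.
  (* The second way from y1 to y2 starts with x1; its next vertex q2, together with v and
     y1, gives x1 three neighbours in one component. *)
  - subst q1; case: r => [|q2 r] in pr ur lr prG q1K y1r.
      by move: x1y2; rewrite lr /= eqxx.
    move: pr prG ur lr => /= /andP[wq2 pr] /andP[Gxq prG] /andP[x1r ur] lr.
    have vK0 : v \in component G (~: [set x1]) v by apply: comp_self; rewrite eq_sym vnot.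
    have x2K0 : x2 \in component G (~: [set x1]) v.
      by apply: (comp_edge _ _ _ _ vK0) => //; rewrite eq_sym.
    have y2K0 : y2 \in component G (~: [set x1]) v by apply: (comp_rpath x1 y2 p) => //; rewrite -lp.
    have y1K0 : y1 \in component G (~: [set x1]) v.
      by apply: (comp_edge _ _ _ _ y2K0); rewrite 1?adj_sym// eq_sym.
    have q2K0 : q2 \in component G (~: [set x1]) v by apply: (comp_rpath x1 q2 r) => //; rewrite -lr.
    have [q2E|q2E] : q2 = v \/ q2 = y1.
    + apply: (third x1 (component G (~: [set x1]) v)) => //.
      * exact: component_cut_part.
      * exact: component_connected.
      * by rewrite eq_sym vnot.
      * by rewrite adj_sym.
    + by have := minus_C _ _ _ _ wq2; rewrite q2E (negPf vC).
    + by move: y1r; rewrite q2E !inE eqxx orbT.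
  - by move: wq1; rewrite q1E /minus_edge !eqxx andbF.
have [y1X y2Y gX gY cross] := side_split gc y1C y2C Gy1y2 cy1y2 nab.
have x1X : x1 \in side G C y1 y2.
  rewrite inE x1C; apply: connect1; rewrite /minus_edge /within y1C x1C adj_sym Gx1y1 eqxx.
  by rewrite (negPf x1y2) (negPf y1y2').
have avoid z s : path (bichrom G C c) z s -> y1 \notin z :: s ->
    connect (minus_edge G C y1 y2) z (last z s).
  elim: s z => [|z' s IH] z /=; first by rewrite connect0.
  move=> /andP[/and4P[zC z'C Gzz _] ps]; rewrite inE negb_or => /andP[yz ys].
  apply: connect_trans (connect1 _) (IH z' ps ys).
  rewrite /minus_edge /within zC z'C Gzz /= (eq_sym z) (negPf yz) /=.
  by apply/negP => /andP[_ /eqP zy]; rewrite zy inE eqxx in ys.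
have x2Y : x2 \in C :\: side G C y1 y2.
  rewrite in_setD x2C andbT inE x2C /=; apply: contra nab => y1x2; apply: connect_trans y1x2 _.
  by rewrite (sym_connect_sym (minus_edge_sym _ _ _ _)) lp; exact: avoid.
have XC := sideC y1 y2; have XYC := coverXY y1 y2; have dXY := disXY y1 y2.
have [vX vY] := vnbr1 _ x1X x2Y XC.
case: large_q.
apply: (@q_bridge R n G v (side G C y1 y2) (C :\: side G C y1 y2) (flip (side G C y1 y2) c)
   x1 y1 y2 x2 x1 x2) => //.
- by rewrite XYC.
- by rewrite flipX// flipY//; move: cy1y2; case: (c y1); case: (c y2).
- by rewrite flipX// flipY//; move: cx; case: (c x1); case: (c x2).
- by left.
Qed.

End Connected.

(** * Graphs with q(G) >= n - 1 are near paths *)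

Section Dichotomy.
Variable R : realType.
Variable n : nat.
Variable G : graph n.
Implicit Types (K L U C H T X Y : {set 'I_n}) (v i j k t w z a b : 'I_n) (s l : seq 'I_n).

Lemma near_path_connected : ~ (q R G + 2 <= n)%N -> connected G [set: 'I_n] -> (0 < n)%N -> near_path G.
Proof.
move=> large_q connG n0.
have [[w [L [i [j [cL cnL iL [jL ij wi wj]]]]]]|noloop] := boolp.pselect (exists w L i j,
    [/\ cut_part G w L, connected G L, i \in L & [/\ j \in L, i != j, G w i & G w j]]).
  exact: (loop_near_path large_q connG cL cnL iL jL ij wi wj).
have noloop' : no_loops G.
  by move=> w L i j cL cnL iL jL ij wi wj; apply: noloop; exists w, L, i, j.
have [[w [L1 [L2 [L3 [i1 [i2 [i3 [[c1 c2 c3] [d12 d13 d23] [k1 k2 k3]]]]]]]]]|nofork] :=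
  boolp.pselect (exists w L1 L2 L3 i1 i2 i3, [/\ [/\ cut_part G w L1, cut_part G w L2 & cut_part G w L3],
    [/\ [disjoint L1 & L2], [disjoint L1 & L3] & [disjoint L2 & L3]]
    & [/\ i1 \in L1, i2 \in L2 & i3 \in L3]]).
  exact: (three_parts_near_path large_q connG noloop' c1 c2 c3 d12 d13 d23 k1 k2 k3).
have [s [ips sE]] : exists s, induced_path G s /\ forall i, (i \in [set: 'I_n]) = (i \in s).
  apply: (tree_path (t := Ordinal n0) connG).
  - by move=> i j; rewrite !inE.
  - by rewrite inE.
  - by move=> w L i j _ _; exact: noloop'.
  - move=> w L1 L2 L3 i1 i2 i3 _ _ _ _ c1 c2 c3 d12 d13 d23 k1 k2 k3; apply: nofork.
    by exists w, L1, L2, L3, i1, i2, i3.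
case: s ips sE => [|z s] ips sE; first by have := sE (Ordinal n0); rewrite inE.
move: ips => /= /and3P[zs /allP zadj ips].
have memE i : (i \in s) = (i != z).
  have := sE i; rewrite inE in_cons => /esym/orP; case: (eqVneq i z) => [->|iz]; last by case.
  by rewrite (negPf zs).
exists z, s; split=> //.
have GzE i : G z i = (ohead s == Some i).
  have [->|iz] := eqVneq i z; last by apply/eqP; apply: zadj; rewrite memE.
  rewrite adj_irrefl; apply/esym/negbTE; apply: contraNN zs.
  by case: (s) => //= y s' /eqP[->]; rewrite mem_head.
case: s GzE {zs zadj ips sE memE} => [|y s] GzE; first by constructor 1.
constructor 2; exists [::], y, s; split=> // i; rewrite GzE /= eq_sym.
by apply/eqP/eqP => [[->]|->].
Qed.

(** An isolated vertex z is a good part of G - w for every w. Together with another good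
    part or with three further parts this is excluded, so the rest of G is a path. *)
Lemma near_path_isolated z : ~ (q R G + 2 <= n)%N -> (forall i, ~~ G z i) -> near_path G.
Proof.
move=> large_q isoz.
have zz i : ~~ G i z by rewrite adj_sym.
pose H := ~: [set z].
have clz w : w != z -> cut_part G w [set z].
  by move=> wz; split=> [|i j /set1P->]; [rewrite in_set1|rewrite (negPf (isoz j))].
have [H0|[t tH]] := set_0Vmem H.
  exists z, [::]; split=> //; last by constructor 1 => i; exact/negbTE.
  by move=> i; have := in_set0 i; rewrite -H0 in_setC in_set1 => ->.
have cH : connected G H.
  move=> x y xH yH; apply/negPn/negP => nxy; apply: large_q.
  have xz : x != z by move: xH; rewrite in_setC in_set1.
  pose A := component G H x.
  apply: (@q_three_closed R n G [:: ([set z], z); (A, x); (H :\: A, y)]) => /=.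
  - by rewrite in_set1 eqxx (mem_component G xH) in_setD yH inE yH nxy.
  - rewrite !andbT !disjoints1 in_setD !inE eqxx !andbF /=.
    by rewrite disjoints_subset; apply/fintype.subsetP => k kA; rewrite in_setC in_setD kA.
  - have inH i : (i \in H) = (i != z) by rewrite in_setC in_set1.
    move=> Kk i j; rewrite !inE => /or3P[]/eqP-> /=.
    + by move=> /set1P->; rewrite (negPf (isoz j)).
    + move=> iA Gij; apply: (component_closed iA) => //; rewrite inH.
      by apply: contraTneq Gij => ->.
    + rewrite !in_setD => /andP[iA iH] Gij; have jH : j \in H.
        by rewrite inH; apply: contraTneq Gij => ->.
      rewrite jH andbT; apply: contra iA => jA; apply: (component_closed jA) => //.
      by rewrite adj_sym.
have [s [ips sE]] : exists s, induced_path G s /\ forall i, (i \in H) = (i \in s).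
  apply: (tree_path cH) tH _ _.
  - by move=> i j _ Gij; rewrite in_setC in_set1; apply: contraTneq Gij => ->.
  - move=> w L i j wH LH cL cnL iL jL ij wi wj.
    have gL := good_loop R cnL iL jL ij wi wj.
    have wz : w != z by move: wH; rewrite in_setC in_set1.
    have zT : z \in ~: (w |: L).
      rewrite in_setC in_setU1 negb_or eq_sym wz; apply/negP => /(fintype.subsetP LH).
      by rewrite in_setC in_set1 eqxx.
    have [cT ngT] := good_rest large_q cL gL iL wi zT.
    have [TE|[k _ Gzk]] := connected_singleton cT zT; last by rewrite (negPf (isoz k)) in Gzk.
    by apply: ngT; rewrite TE; exact: good_isolated.
  - move=> w L1 L2 L3 i1 i2 i3 wH s1 s2 s3 c1 c2 c3 d12 d13 d23 k1 k2 k3.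
    have wz : w != z by move: wH; rewrite in_setC in_set1.
    have dz L : L \subset H -> [disjoint L & [set z]].
      move=> LH; rewrite disjoint_sym disjoints1; apply/negP => /(fintype.subsetP LH).
      by rewrite in_setC in_set1 eqxx.
    exact: (no_four_parts large_q c1 c2 c3 (clz w wz) d12 d13 (dz _ s1) d23 (dz _ s2) (dz _ s3)
      k1 k2 k3 (finset.set11 z)).
exists z, s; split=> //; last by constructor 1 => i; exact/negbTE.
by move=> i; rewrite -sE in_setC in_set1.
Qed.

(** Two components with edges are excluded by q_two_edges, so a disconnected G has an
    isolated vertex. *)
Lemma near_path_dichotomy : (0 < n)%N -> ~ (q R G + 2 <= n)%N -> near_path G.
Proof.
move=> n0 large_q.
have [cG|nc] := boolp.pselect (connected G [set: 'I_n]); first exact: near_path_connected.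
have [x [y nxy]] : exists x y, ~~ connect (within G [set: 'I_n]) x y.
  apply: boolp.contrapT => nex; apply: nc => x y _ _; apply/negPn/negP => nxy.
  by apply: nex; exists x, y.
pose K := component G [set: 'I_n] x.
have clK i j : i \in K -> G i j -> j \in K by move=> iK; apply: component_closed iK _; rewrite inE.
have yK : y \notin K by rewrite inE negb_and nxy orbT.
have xK : x \in K by apply: mem_component; rewrite inE.
have [/existsP[i1 /existsP[j1 /and3P[iK jK Gij]]]|noe1] := boolP [exists i, exists j, [&& i \in K, j \in K & G i j]].
  have [/existsP[i2 /existsP[j2 /and3P[iK2 jK2 Gij2]]]|noe2] :=
      boolP [exists i, exists j, [&& i \in ~: K, j \in ~: K & G i j]].
    case: large_q; apply: (q_two_edges R (K1 := K) (K2 := ~: K) clK _ _ iK jK Gij iK2 jK2 Gij2).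
      by rewrite disjoints_subset finset.setCK.
    by rewrite finset.setUCr.
  apply: (near_path_isolated (z := y) large_q) => j; apply: contra noe2 => Gyj.
  apply/existsP; exists y; apply/existsP; exists j; rewrite !in_setC yK Gyj andbT /=.
  by apply: contra yK => jK'; apply: (clK j) => //; rewrite adj_sym.
apply: (near_path_isolated (z := x) large_q) => j; apply: contra noe1 => Gxj.
apply/existsP; exists x; apply/existsP; exists j; rewrite xK Gxj andbT /=.
exact: (clK x).
Qed.

End Dichotomy.

(** * Near paths in coordinates *)

Section Positions.
Variable n : nat.
Variable G : graph n.
Local Open Scope nat_scope.
Implicit Types (i j z : 'I_n) (s : seq 'I_n) (N : pred nat).

(** The path 0, ..., m-1 and one more vertex, numbered m, which is joined to the elements of
    N below m. *)
Definition model m N (a b : nat) : bool :=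
  if (a < m) && (b < m) then (a.+1 == b) || (b.+1 == a)
  else if a < m then N a else (b < m) && N b.

Definition modelled N (p : 'I_n -> 'I_n) :=
  injective p /\ forall i j, G i j = model n.-1 N (p i) (p j).

Lemma near_path_modelled : near_path G -> exists N p, modelled N p /\
  [\/ N = pred0, exists2 j, j < n.-1 & N = pred1 j | exists2 j, j.+1 < n.-1 & N = pred2 j j.+1].
Proof.
move=> [z [s [ips memE Nz]]].
have us := induced_path_uniq ips; have zs : z \notin s by rewrite memE eqxx.
have sizeE : size s = n.-1.
  rewrite -(card_uniqP us) -[n in RHS]card_ord -(cardC1 z).
  by apply: eq_card => i; rewrite !inE memE.
have n0 : 0 < n by case: (n) z {s ips memE Nz us zs sizeE} => [[]|].
have idx' i : index i s < n.
  by have := index_size i s; rewrite sizeE -ltnS prednK.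
pose p i : 'I_n := Ordinal (idx' i).
have lt_s i : (index i s < n.-1) = (i != z) by rewrite -sizeE index_mem memE.
have idz i : i != z -> nth z s (index i s) = i by move=> iz; rewrite nth_index ?memE.
have [N [NE Ncase]] : exists N : pred nat, (forall i, i != z -> G z i = N (index i s)) /\
   [\/ N = pred0, exists2 j, j < n.-1 & N = pred1 j | exists2 j, j.+1 < n.-1 & N = pred2 j j.+1].
  case: Nz => [z0|[s1 [y [s2 [sE zy]]]]|[s1 [y [y' [s2 [sE zy]]]]]].
  - by exists pred0; split=> [i _|]; [rewrite z0|constructor 1].
  - exists (pred1 (size s1)); split=> [i iz|]; last first.
      by constructor 2; exists (size s1); rewrite // -sizeE sE size_cat /= addnS ltnS leq_addr.
    have ys : nth z s (size s1) = y by rewrite sE nth_cat ltnn subnn.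
    have yi : index y s = size s1.
      by rewrite -ys index_uniq// sE size_cat /= addnS ltnS leq_addr.
    rewrite zy /= -yi; apply/eqP/eqP => [-> //|ii].
    by rewrite -(idz i iz) ii nth_index// sE mem_cat mem_head orbT.
  - exists (pred2 (size s1) (size s1).+1); split=> [i iz|]; last first.
      by constructor 3; exists (size s1); rewrite // -sizeE sE size_cat /= !addnS !ltnS leq_addr.
    have ys : nth z s (size s1) = y by rewrite sE nth_cat ltnn subnn.
    have ys' : nth z s (size s1).+1 = y' by rewrite sE nth_cat ltnNge leqnSn /= subSn// subnn.
    have yi : index y s = size s1.
      by rewrite -ys index_uniq// sE size_cat /=; lia.
    have yi' : index y' s = (size s1).+1.
      by rewrite -ys' index_uniq// sE size_cat /= !addnS !ltnS leq_addr.
    have iE x : x \in s -> (i == x) = (index i s == index x s).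
      move=> xs; apply/eqP/eqP => [-> //|ii].
      by rewrite -(idz i iz) ii nth_index.
    rewrite zy /= -yi' -yi !iE// sE mem_cat !inE eqxx ?orbT//.
exists N, p; split=> //; split=> [i j /(congr1 val)/= ij|i j].
  have [iz|iz] := eqVneq i z; have [jz|jz] := eqVneq j z.
  - by rewrite iz jz.
  - by have := lt_s i; rewrite ij lt_s iz eqxx jz.
  - by have := lt_s i; rewrite ij lt_s iz jz eqxx.
  - by rewrite -(idz i iz) ij idz.
rewrite /model /= !lt_s.
have [->|iz] := eqVneq i z; have [->|jz] := eqVneq j z => /=.
- exact: adj_irrefl.
- exact: NE.
- by rewrite adj_sym; exact: NE.
- by rewrite -{1}(idz i iz) -{1}(idz j jz) (induced_path_nth z ips)// index_mem memE.
Qed.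

(** Reversal of the path. *)
Lemma modelled_rev N p : modelled N p ->
  exists p', modelled (fun a => N (n.-1.-1 - a)) p'.
Proof.
move=> [injp Gp].
have bnd i : (if p i < n.-1 then n.-1.-1 - p i else p i) < n.
  have := ltn_ord (p i); case: ifP; lia.
pose p' i : 'I_n := Ordinal (bnd i).
exists p'; split=> [i j /(congr1 val)/= ij|i j].
  apply: injp; apply: val_inj => /=; have := ltn_ord (p i); have := ltn_ord (p j).
  by move: ij; case: ifP; case: ifP; lia.
rewrite Gp /model /=; have := ltn_ord (p i); have := ltn_ord (p j).
have [pi|pi] := ltnP (p i) n.-1; have [pj|pj] := ltnP (p j) n.-1 => nj ni /=.
- have -> : n.-1.-1 - p i < n.-1 by lia.
  have -> : n.-1.-1 - p j < n.-1 by lia.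
  by rewrite /=; lia.
- have -> : n.-1.-1 - p i < n.-1 by lia.
  by rewrite ltnNge pj /=; congr N; lia.
- have -> : n.-1.-1 - p j < n.-1 by lia.
  by rewrite ltnNge pi /=; congr N; lia.
- by rewrite !ltnNge pi pj.
Qed.

(** Up to reversal, the neighbours of the additional vertex lie in the first half. *)
Lemma model_cases : near_path G -> exists N p, modelled N p /\
  [\/ N = pred0, exists2 j, j.*2 < n.-1 & N = pred1 j | exists2 j, j.+1.*2 <= n.-1 & N = pred2 j j.+1].
Proof.
move=> /near_path_modelled[N [p [Np [N0|[j jn NE]|[j jn NE]]]]].
- by exists N, p; split=> //; constructor 1.
- have [j2|j2] := ltnP j.*2 n.-1; first by exists N, p; split=> //; constructor 2; exists j.
  have [p' Np'] := modelled_rev Np.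
  exists (pred1 (n.-1.-1 - j)), p'; split; last by constructor 2; exists (n.-1.-1 - j) => //; lia.
  have [ip' Gp'] := Np'; split=> // i k; rewrite Gp' /model NE /=.
  by have [h|h] := ltnP (p' i) n.-1; have [h'|h'] := ltnP (p' k) n.-1 => //=; lia.
- have [j2|j2] := leqP j.+1.*2 n.-1; first by exists N, p; split=> //; constructor 3; exists j.
  have [p' Np'] := modelled_rev Np.
  exists (pred2 (n.-1.-1 - j.+1) (n.-1.-1 - j.+1).+1), p'; split; last first.
    by constructor 3; exists (n.-1.-1 - j.+1) => //; lia.
  have [ip' Gp'] := Np'; split=> // i k; rewrite Gp' /model NE /=.
  by have [h|h] := ltnP (p' i) n.-1; have [h'|h'] := ltnP (p' k) n.-1 => //=; lia.
Qed.

End Positions.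

(** * Gram matrices of vectors in space *)

Section IntegerVectors.

Definition vec := (int * int * int)%type.
Implicit Types x y z : vec.

Definition coordinate x (k : nat) : int := if k is 0%N then x.1.1 else if k is 1%N then x.1.2 else x.2.

Definition inner x y : int := x.1.1 * y.1.1 + x.1.2 * y.1.2 + x.2 * y.2.

Lemma innerE x y : inner x y = \sum_(k < 3) coordinate x k * coordinate y k.
Proof. by rewrite !big_ord_recl big_ord0 /coordinate /= addr0 /inner addrA. Qed.

Lemma innerC x y : inner x y = inner y x.
Proof. by rewrite /inner; ring. Qed.

End IntegerVectors.

Section Frames.
Variable R : realType.
Variable n : nat.
Variable G : graph n.
Variable N : pred nat.
Variable p : 'I_n -> 'I_n.
Hypothesis Gp : modelled G N p.

Lemma sum_positions (V : zmodType) (F : 'I_n -> V) : \sum_i F (p i) = \sum_a F a.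
Proof.
have [ip _] := Gp; rewrite [RHS](reindex p)//=.
exact/onW_bij/injF_bij.
Qed.

(** Let V have the rows sqrt(c_i) w_i. The Gram matrix V V^T has the pattern of the
    complement, and its nonzero eigenvalues are those of V^T V = D E + mu u^T u. On the
    range of the projection E this is D plus a rank-one matrix, which has the eigenvalue D +
    mu u.u on the line of u and D on its complement. *)
Lemma frame_spectrum (w : nat -> vec) (c : nat -> R) (D mu : R) (E : 'M[R]_3) (u : 'rV[R]_3) :
  (forall a, (a < n)%N -> 0 < c a) ->
  (forall a b, (a < n)%N -> (b < n)%N -> a != b -> (inner (w a) (w b) == 0) = model n.-1 N a b) ->
  E *m E = E -> E^T = E -> u *m E = u ->
  (forall k l : 'I_3, \sum_(a < n) c a * (coordinate (w a) k * coordinate (w a) l)%:~R = D * E k l + mu * (u 0 k * u 0 l)) ->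
  exists2 A : 'M[R]_n, in_S (gcompl G) A &
    forall x, eigenvalue A x -> x \in [:: 0; D; D + mu * dot u u].
Proof.
move=> c0 wadj EE symE uE frame; have [ip GE] := Gp.
pose V : 'M[R]_(n, 3) := \matrix_(i, k) (Num.sqrt (c (p i)) * (coordinate (w (p i)) k)%:~R).
have sc i : Num.sqrt (c (p i)) != 0 by rewrite sqrtr_eq0 -ltNge c0.
exists (V *m V^T); first split.
- by rewrite trmx_mul trmxK.
- move=> i j ij; rewrite mxE.
  have -> : \sum_k V i k * V^T k j =
      Num.sqrt (c (p i)) * Num.sqrt (c (p j)) * (inner (w (p i)) (w (p j)))%:~R.
    rewrite innerE rmorph_sum mulr_sumr; apply: eq_bigr => k _; rewrite !mxE rmorphM/=; ring.
  rewrite !mulf_eq0 (negPf (sc i)) (negPf (sc j)) /= intr_eq0 wadj ?ltn_ord//.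
    by rewrite /= /compl_rel ij GE.
  by rewrite val_eqE (inj_eq ip).
pose F := V^T *m V.
have FE : F = D *: E + mu *: (u^T *m u).
  apply/matrixP => k l; rewrite !mxE big_ord1 !mxE -frame.
  rewrite -(sum_positions (fun a => c a * (coordinate (w a) k * coordinate (w a) l)%:~R)).
  apply: eq_bigr => i _; rewrite !mxE rmorphM/=.
  by rewrite mulrACA -expr2 sqr_sqrtr ?ltW ?c0.
have FEE : F *m E = F.
  by rewrite FE mulmxDl -!scalemxAl EE -mulmxA uE.
move=> x /eigenvalueP[y yA y0]; rewrite !inE; have [//|x0] := eqVneq x 0.
pose z := y *m V.
have zF : z *m F = x *: z by rewrite /z /F mulmxA -(mulmxA y) yA -scalemxAl.
have z0 : z != 0.
  apply: contraNneq y0 => z0; have : x *: y = 0 by rewrite -yA mulmxA -/z z0 mul0mx.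
  by move/eqP; rewrite scaler_eq0 (negPf x0).
have zE : z *m E = z.
  have -> : z = x^-1 *: (z *m F) by rewrite zF scalerA mulVf// scale1r.
  by rewrite -scalemxAl -mulmxA FEE.
have xz : x *: z = D *: z + (mu * dot z u) *: u.
  by rewrite -zF FE mulmxDr -!scalemxAr zE mul_outer scalerA.
have [zu|zu] := eqVneq (dot z u) 0.
  move: xz; rewrite zu mulr0 scale0r addr0 => /eqP; rewrite -subr_eq0 -scalerBl.
  by rewrite scaler_eq0 (negPf z0) orbF subr_eq0 => /eqP ->; rewrite eqxx.
have /eqP := congr1 (fun v => dot v u) xz.
rewrite dotDl !dotZl (_ : _ + _ = (D + mu * dot u u) * dot z u); last by ring.
by rewrite -subr_eq0 -mulrBl mulf_eq0 (negPf zu) orbF subr_eq0 => ->; rewrite orbT.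
Qed.

(** The hypotheses of frame_spectrum for integral data, to be decided by computation. The
    weights come with the vectors, and E is the diagonal matrix with the entries 1, 1, e. *)
Definition frame_check (ws : seq (nat * vec)) (D e mu : int) (u : vec) : bool :=
  [&& size ws == n, all (fun x => (0 < x.1)%N) ws, (e == 1) || (e == 0) && (coordinate u 2 == 0),
   all (fun a => all (fun b => (a != b) ==>
     ((inner (nth (0%N, (0, 0, 0)) ws a).2 (nth (0%N, (0, 0, 0)) ws b).2 == 0) == model n.-1 N a b))
     (iota 0 n)) (iota 0 n) &
   all (fun k => all (fun l =>
     foldr (fun x acc => x.1%:Z * (coordinate x.2 k * coordinate x.2 l) + acc) 0 ws
       == D * (if k == l then if k == 2%N then e else 1 else 0) + mu * (coordinate u k * coordinate u l))
     (iota 0 3)) (iota 0 3)].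

Lemma frame_checkP ws D e mu u : frame_check ws D e mu u ->
  exists2 A : 'M[R]_n, in_S (gcompl G) A &
    forall x, eigenvalue A x -> x \in [:: 0; D%:~R; (D + mu * inner u u)%:~R].
Proof.
case/and5P=> /eqP sz /allP pos eE /allP adjE /allP frE.
pose x0 : nat * vec := (0%N, (0, 0, 0)).
pose w a := (nth x0 ws a).2; pose c a : R := (nth x0 ws a).1%:R.
pose E : 'M[R]_3 := \matrix_(k, l) (if k == l then if k == 2%N :> nat then e%:~R else 1 else 0).
pose ur : 'rV[R]_3 := \row_k (coordinate u k)%:~R.
have uu : dot ur ur = (inner u u)%:~R.
  rewrite dotE innerE rmorph_sum; apply: eq_bigr => k _; by rewrite !mxE rmorphM.
have diagE : E = diag_mx (\row_k if k == 2%N :> nat then e%:~R else 1).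
  apply/matrixP => k l; rewrite !mxE; case: (eqVneq k l) => _; by rewrite ?mulr1n ?mulr0n.
have iotaP k : (k \in iota 0 3) = (k < 3)%N by rewrite mem_iota.
have e3 (k : 'I_3) : (k : nat) \in iota 0 3 by rewrite iotaP.
have foldE (F : nat * vec -> int) l : foldr (fun x acc => F x + acc) 0 l = \sum_(x <- l) F x.
  by elim: l => [|x l IH]; rewrite ?big_nil ?big_cons //= IH.
have [||||||A SA EA] := @frame_spectrum w c D%:~R mu%:~R E ur.
- by move=> a an; rewrite ltr0n pos// mem_nth ?sz.
- move=> a b an bn ab.
  have ai : a \in iota 0 n by rewrite mem_iota.
  have bi : b \in iota 0 n by rewrite mem_iota.
  by have /allP/(_ b bi) := adjE a ai; rewrite ab => /eqP.
- rewrite diagE mulmx_diag; congr diag_mx; apply/rowP => k; rewrite !mxE.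
  case: ifP => _; last by rewrite mulr1.
  by move: eE => /orP[/eqP->|/andP[/eqP-> _]]; rewrite ?mulr1 ?mulr0.
- by rewrite diagE tr_diag_mx.
- rewrite diagE; apply/rowP => k; rewrite mul_mx_diag !mxE; case: ifP => [/eqP k2|_]; last by rewrite mulr1.
  by move: eE => /orP[/eqP->|/andP[/eqP-> /eqP u2]]; rewrite ?mulr1// k2 u2 mul0r.
- move=> k l; rewrite !mxE.
  transitivity ((\sum_(x <- ws) x.1%:Z * (coordinate x.2 k * coordinate x.2 l))%:~R : R).
    rewrite rmorph_sum (big_nth x0) sz big_mkord; apply: eq_bigr => a _.
    by rewrite rmorphM /=.
  have /allP/(_ l (e3 l))/eqP := frE k (e3 k); rewrite -foldE => ->.
  rewrite rmorphD !rmorphM /=; congr (_ * _ + _).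
  by rewrite (val_eqE k l); case: ifP => _ //; case: ifP.
exists A => // x /EA.
have -> : (D + mu * inner u u)%:~R = D%:~R + mu%:~R * (inner u u)%:~R :> R by rewrite intrD intrM.
by rewrite uu.
Qed.

Lemma q_compl_frame ws D e mu u : frame_check ws D e mu u -> (q R (gcompl G) <= 3)%N.
Proof.
move=> /frame_checkP[A SA EA]; apply: leq_trans (q_le_q_mx SA) _.
exact: (q_mx_le_size EA).
Qed.

Lemma q_compl_tight_frame ws D e : frame_check ws D e 0 (0, 0, 0) -> (q R (gcompl G) <= 2)%N.
Proof.
move=> /frame_checkP[A SA EA]; apply: leq_trans (q_le_q_mx SA) _.
apply: (@q_mx_le_size _ _ _ [:: 0; D%:~R]) => x /EA.
by rewrite mul0r addr0 !inE orbb.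
Qed.

Definition combination n' (M : nat -> nat -> int) (u : nat -> int) (b : nat) : int :=
  foldr (fun a acc => u a * M a b + acc) 0 (iota 0 n').

(** The hypotheses of q_two_diagonals for integral data: M has the pattern of the
    complement, u1 and w1 are null vectors of M, and u2 and w2 are null vectors of M with
    its diagonal lowered by d. Position i and position j serve as pivots. *)
Definition completions_check (M : nat -> nat -> int) (d u1 w1 u2 w2 : nat -> int) (i j : nat) : bool :=
  [&& all (fun a => all (fun b => (M a b == M b a) &&
         ((a != b) ==> ((M a b != 0) == ~~ model n.-1 N a b))) (iota 0 n)) (iota 0 n),
   all (fun a => 0 < d a) (iota 0 n), (i < n)%N && (j < n)%N,
   [&& w1 i != 0, u1 i == 0, u1 j != 0, w2 i != 0, u2 i == 0 & u2 j != 0] &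
   all (fun b => let M' a b := M a b - (if a == b then d a else 0) in
     [&& combination n M u1 b == 0, combination n M w1 b == 0,
         combination n M' u2 b == 0 & combination n M' w2 b == 0]) (iota 0 n)].

Lemma q_compl_completions M d u1 w1 u2 w2 i j :
  completions_check M d u1 w1 u2 w2 i j -> (q R (gcompl G) + 2 <= n)%N.
Proof.
move=> /and5P[/allP MP /allP d0 /andP[i_n j_n] /and5P[w1i u1i u1j w2i /andP[u2i u2j]] /allP comb].
have [ip GE] := Gp.
have it a : (a \in iota 0 n) = (a < n)%N by rewrite mem_iota.
have itp k : nat_of_ord (p k) \in iota 0 n by rewrite it.
have [f pf fp] : bijective p by exact: injF_bij.
pose S1 : 'M[R]_n := \matrix_(k, l) (M (p k) (p l))%:~R.
pose dr : 'rV[R]_n := \row_k (d (p k))%:~R.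
pose row (u : nat -> int) : 'rV[R]_n := \row_k (u (p k))%:~R.
have combE (M' : nat -> nat -> int) (u : nat -> int) (S : 'M[R]_n) :
    (forall k l, S k l = (M' (p k) (p l))%:~R) ->
    (forall b, (b < n)%N -> combination n M' u b = 0) -> row u *m S = 0.
  move=> SE u0; apply/rowP => l; rewrite !mxE.
  transitivity ((combination n M' u (p l))%:~R : R); last by rewrite u0.
  have foldE (F : nat -> int) s : foldr (fun a acc => F a + acc) 0 s = \sum_(a <- s) F a.
    by elim: s => [|x s IH]; rewrite ?big_nil ?big_cons //= IH.
  rewrite /combination foldE -[n in iota 0 n]subn0 big_mkord.
  rewrite -(sum_positions (fun a => u a * M' a (p l))) rmorph_sum.
  by apply: eq_bigr => k _; rewrite mxE SE rmorphM.
have comb' b : (b < n)%N -> _ := fun bn => comb b (etrans (it b) bn).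
have nullity (S : 'M[R]_n) u w : row u *m S = 0 -> row w *m S = 0 -> w i != 0 -> u i = 0 -> u j != 0 ->
    (1 < \rank (kermx S))%N.
  move=> uS wS wi ui uj.
  have := @nullity_pivoted _ _ S [:: (row w, f (Ordinal i_n)); (row u, f (Ordinal j_n))].
  rewrite /=; apply.
    by split=> [|x k|]; rewrite ?inE ?mxE ?fp ?intr_eq0// => /eqP[-> _]; rewrite mxE fp /= ui.
  by move=> x k; rewrite !inE => /orP[]/eqP[-> _].
apply: (@q_two_diagonals _ _ _ S1 (S1 - diag_mx dr) dr) => //.
- split; first by apply/matrixP => k l; rewrite !mxE; have /allP/(_ _ (itp l))/andP[/eqP-> _] := MP _ (itp k).
  move=> k l kl; rewrite mxE intr_eq0 /= /compl_rel kl GE.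
  have /allP/(_ _ (itp l))/andP[_] := MP _ (itp k).
  by rewrite val_eqE (inj_eq ip) kl => /eqP.
- by move=> k; rewrite mxE ltr0z d0.
- apply: (nullity _ u1 w1) => //; last exact/eqP.
    by apply: (combE M) => [k l|b /comb'/and4P[/eqP]//]; rewrite mxE.
  by apply: (combE M) => [k l|b /comb'/and4P[_ /eqP]//]; rewrite mxE.
- have SE k l : (S1 - diag_mx dr) k l =
      (M (p k) (p l) - (if p k == p l :> nat then d (p k) else 0))%:~R.
    rewrite !mxE rmorphB /= val_eqE (inj_eq ip); congr (_ - _).
    by case: eqVneq => _; rewrite ?mulr1n ?mulr0n.
  apply: (nullity _ u2 w2) => //; last exact/eqP.
    by apply: (combE (fun a b => M a b - (if a == b then d a else 0)) _ _ SE) => b /comb'/and4P[_ _ /eqP].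
  by apply: (combE (fun a b => M a b - (if a == b then d a else 0)) _ _ SE) => b /comb'/and4P[_ _ _ /eqP].
Qed.

End Frames.

(** * Vectors in general position *)

Section GenericVectors.
Implicit Types (x y z : vec) (w : nat -> vec) (a b k m : nat).

Definition cross x y : vec :=
  (x.1.2 * y.2 - x.2 * y.1.2, x.2 * y.1.1 - x.1.1 * y.2, x.1.1 * y.1.2 - x.1.2 * y.1.1).

Definition lin x (t : int) y : vec := (x.1.1 + t * y.1.1, x.1.2 + t * y.1.2, x.2 + t * y.2).

Ltac unfold_vec := rewrite /inner /cross /lin /=.

Lemma inner_lin x t y z : inner z (lin x t y) = inner z x + t * inner z y.
Proof. by unfold_vec; ring. Qed.

Lemma inner_cross_lin x t y z v : inner z (cross v (lin x t y)) = inner z (cross v x) + t * inner z (cross v y).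
Proof. by unfold_vec; ring. Qed.

Lemma inner_crossl x y : inner (cross x y) x = 0.
Proof. by unfold_vec; ring. Qed.

Lemma inner_crossr x y : inner (cross x y) y = 0.
Proof. by unfold_vec; ring. Qed.

Lemma det_swap x y z : inner z (cross x y) = - inner z (cross y x).
Proof. by unfold_vec; ring. Qed.

Lemma inner_neq0 x y : inner y x != 0 -> inner x x != 0.
Proof.
apply: contraNneq => xx; move: xx; rewrite /inner; case: x => -[x1 x2] x3 /=.
move=> xx; have [h1 h2 h3] : [/\ x1 * x1 = 0, x2 * x2 = 0 & x3 * x3 = 0].
  by have := sqr_ge0 x1; have := sqr_ge0 x2; have := sqr_ge0 x3; rewrite !expr2; split; lia.
move/eqP: h1; move/eqP: h2; move/eqP: h3; rewrite !mulf_eq0 !orbb => /eqP-> /eqP-> /eqP->.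
by rewrite !mulr0.
Qed.

(** A value t larger than the absolute values of all constant terms is a root of none of the
    affine functions, whose coefficients are integers. *)
Lemma exists_common_nonzero (s : seq (int * int)) :
  all (fun e => (e.1 != 0) || (e.2 != 0)) s ->
  exists t : int, all (fun e => e.1 + t * e.2 != 0) s.
Proof.
move=> s0; pose T : int := \sum_(e <- s) `|e.1|.
have T0 : 0 <= T by apply: sumr_ge0 => e _; exact: normr_ge0.
exists (T + 1); apply/allP => e es; have := allP s0 e es.
have eT : `|e.1| <= T.
  rewrite /T (big_rem e es) /= lerDl sumr_ge0// => f _; exact: normr_ge0.
have [->|e2] := eqVneq e.2 0; first by rewrite mulr0 addr0 orbF.
move=> _; apply: contraTneq eT => /eqP; rewrite addr_eq0 => /eqP ->.
rewrite normrN normrM -ltNge (ger0_norm (_ : 0 <= T + 1)) ?addr_ge0//.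
have e21 : 1 <= `|e.2| by rewrite -gtz0_ge1 normr_gt0.
by apply: (@lt_le_trans _ _ (T + 1)); [rewrite ltrDl|rewrite ler_peMr// addr_ge0].
Qed.

(** The orthogonality pattern of a path. The last condition leaves room for extensions: a
    plane spanned by two consecutive vectors contains none of the others. *)
Definition path_vectors w m := [/\
  forall a b, (a < m)%N -> (b < m)%N -> a != b ->
    (inner (w a) (w b) == 0) = (a.+1 == b)%N || (b.+1 == a)%N,
  forall a, (a < m)%N -> inner (w a) (w a) != 0 &
  forall a k, (a.+1 < m)%N -> (k < m)%N -> k != a -> k != a.+1 ->
    inner (w k) (cross (w a) (w a.+1)) != 0].

Lemma lagrange x y : inner x y = 0 -> inner (cross x y) (cross x y) = inner x x * inner y y.
Proof.
move=> xy; have -> : inner (cross x y) (cross x y) = inner x x * inner y y - inner x y ^+ 2.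
  by unfold_vec; ring.
by rewrite xy expr0n subr0.
Qed.

(** With u and v the last two vectors and b their cross product, all vectors u + t b are
    orthogonal to v. Every other condition on the new vector says that an affine function of
    t does not vanish, and none of these functions is identically zero. *)
Lemma extend_path_vectors w m : (2 < m)%N -> path_vectors w m ->
  exists x, path_vectors (fun k => if k == m then x else w k) m.+1.
Proof.
case: m => [|[|[|m]]] // _ [adjw selfw detw].
pose u := w m.+1; pose v := w m.+2; pose b := cross u v.
have uv : inner u v = 0 by apply/eqP; rewrite adjw ?eqxx//; lia.
have uu : inner u u != 0 by exact: selfw.
have vv : inner v v != 0 by exact: selfw.
have bb : inner b b != 0 by rewrite lagrange// mulf_neq0.
have bu : inner b u = 0 by exact: inner_crossl.
have bv : inner b v = 0 by exact: inner_crossr.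
(* Conditions on the new vector x: x is not orthogonal to w_i; x is not in the plane of w_i
   and w_i+1; w_i is not in the plane of v and x. *)
pose s1 := [seq (inner (w i) u, inner (w i) b) | i <- iota 0 m.+2].
pose s2 := [seq (inner u (cross (w i) (w i.+1)), inner b (cross (w i) (w i.+1))) | i <- iota 0 m.+2].
pose s3 := [seq (inner (w i) (cross v u), inner (w i) (cross v b)) | i <- iota 0 m.+2].
have iotaE i : (i \in iota 0 m.+2) = (i < m.+2)%N by rewrite mem_iota.
have [t] : exists t : int, all (fun e => e.1 + t * e.2 != 0) (s1 ++ s2 ++ s3).
  apply: exists_common_nonzero; rewrite !all_cat; apply/and3P; split; apply/allP => _ /mapP[i + ->] /=;
      rewrite iotaE ltnS leq_eqVlt => /orP[/eqP->|im].
  - by rewrite uu.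
  - by rewrite detw ?orbT//; lia.
  - by rewrite bb orbT.
  - have [->|im'] := eqVneq i m.
      apply/orP; right.
      have -> : inner b (cross (w m) (w m.+1)) = - (inner (w m) v * inner u u).
        have -> : inner b (cross (w m) (w m.+1)) = inner (w m) u * inner u v - inner (w m) v * inner u u.
          by rewrite /b -/u; unfold_vec; ring.
        by rewrite uv mulr0 sub0r.
      by rewrite oppr_eq0 mulf_neq0// adjw//; lia.
    by apply/orP; left; apply: detw; lia.
  - apply/orP; right.
    have -> : inner (w m.+1) (cross v b) = inner u u * inner v v - inner u v ^+ 2.
      by rewrite -/u /b; unfold_vec; ring.
    by rewrite uv expr0n subr0 mulf_neq0.
  - apply/orP; left; rewrite det_swap oppr_eq0.
    by apply: detw; lia.
rewrite !all_cat => /and3P[/allP h1 /allP h2 /allP h3].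
pose x := lin u t b.
have x1 i : (i < m.+2)%N -> inner (w i) x != 0.
  move=> im; rewrite inner_lin; apply: (h1 (inner (w i) u, inner (w i) b)).
  by apply/mapP; exists i; rewrite ?iotaE.
have x2 i : (i < m.+2)%N -> inner x (cross (w i) (w i.+1)) != 0.
  move=> im; rewrite innerC inner_lin (innerC _ u) (innerC _ b).
  apply: (h2 (inner u (cross (w i) (w i.+1)), inner b (cross (w i) (w i.+1)))).
  by apply/mapP; exists i; rewrite ?iotaE.
have x3 i : (i < m.+2)%N -> inner (w i) (cross v x) != 0.
  move=> im; rewrite inner_cross_lin; apply: (h3 (inner (w i) (cross v u), inner (w i) (cross v b))).
  by apply/mapP; exists i; rewrite ?iotaE.
have xv : inner v x = 0 by rewrite inner_lin innerC uv innerC bv mulr0 addr0.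
have lt3 a : (a < m.+4)%N -> a != m.+3 -> (a < m.+3)%N.
  by rewrite ltnS leq_eqVlt => /orP[/eqP->|//]; rewrite eqxx.
have newadj a : (a < m.+3)%N -> (inner (w a) x == 0) = (a.+1 == m.+3)%N.
  rewrite ltnS leq_eqVlt => /orP[/eqP->|am]; first by rewrite -/v xv eqxx eqxx.
  by rewrite (negPf (x1 a am)); apply/esym/negbTE/eqP; lia.
exists x; split.
- move=> a c am cm ac; have [aE|a3] := eqVneq a m.+3; have [cE|c3] := eqVneq c m.+3.
  + by rewrite aE cE eqxx in ac.
  + rewrite innerC newadj ?lt3// aE.
    by have -> : (m.+4 == c)%N = false by apply/eqP; lia.
  + rewrite newadj ?lt3// cE.
    by have -> : (m.+4 == a)%N = false by [apply/eqP; lia]; rewrite orbF.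
  + exact: adjw (lt3 _ am a3) (lt3 _ cm c3) ac.
- move=> a am; have [aE|a3] := eqVneq a m.+3; last exact/selfw/lt3.
  by apply: (@inner_neq0 _ u); exact: x1.
- move=> a k am km ka ka1.
  have -> : (a == m.+3) = false by apply/eqP; lia.
  have [kE|k3] := eqVneq k m.+3.
    have -> : (a.+1 == m.+3) = false by apply/eqP; move/eqP: ka1; lia.
    by apply: x2; move/eqP: ka1; lia.
  have [aE|a3] := eqVneq a.+1 m.+3; last first.
    by apply: detw => //; [move/eqP: a3; lia|exact: lt3].
  have -> : a = m.+2 by lia.
  by apply: x3; move/eqP: ka; move/eqP: k3; lia.
Qed.

(** Besides the orthogonality pattern of a path, these vectors satisfy core_coefP and
    core_weightP. *)
Definition core : seq vec :=
  [:: (1, 0, 0); (0, 1, 0); (1, 0, 1); (-1, 1, 1); (-1, -3%:Z, 2); (1, 1, 2)].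

Lemma core_path_vectors : path_vectors (nth (0, 0, 0) core) 6.
Proof.
have forall6 (P : pred nat) : all P (iota 0 6) -> forall a, (a < 6)%N -> P a.
  by move=> /allP P6 a a6; apply: P6; rewrite mem_iota.
pose w := nth ((0, 0, 0) : vec) core; split=> [a b a6 b6 ab|a a6|a k a6 k6 ka ka1].
- have H : all (fun a => all (fun b => (a != b) ==>
     ((inner (w a) (w b) == 0) == ((a.+1 == b) || (b.+1 == a))%N)) (iota 0 6)) (iota 0 6) by vm_compute.
  by have := forall6 _ (forall6 _ H a a6) b b6; rewrite ab => /eqP.
- have H : all (fun a => inner (w a) (w a) != 0) (iota 0 6) by vm_compute.
  exact: forall6 _ H a a6.
- have H : all (fun a => all (fun k => [&& a.+1 < 6, k != a & k != a.+1]%N ==>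
     (inner (w k) (cross (w a) (w a.+1)) != 0)) (iota 0 6)) (iota 0 6) by vm_compute.
  by have := forall6 _ (forall6 _ H a (ltnW a6)) k k6; rewrite a6 ka ka1.
Qed.

Lemma exists_path_vectors m : (5 < m)%N ->
  exists2 w, path_vectors w m & forall k, (k < 6)%N -> w k = nth (0, 0, 0) core k.
Proof.
move=> m6; rewrite -(subnK m6); elim: (m - 6)%N => [|d [w wm wc]].
  by exists (nth (0, 0, 0) core) => //; exact: core_path_vectors.
have [|x xm] := extend_path_vectors _ wm; first by lia.
exists (fun k => if k == (d + 6)%N then x else w k) => // k k6.
have -> : (k == d + 6)%N = false by apply/eqP; lia.
exact: wc.
Qed.

(** For two neighbours x is their cross product, for one neighbour a generic vector
    orthogonal to it, and for none a generic combination of the first two vectors. *)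
Lemma attach_vector w m (N : pred nat) : (2 < m)%N -> path_vectors w m ->
  [\/ N = pred0, exists2 j, (j < m)%N & N = pred1 j | exists2 j, (j.+1 < m)%N & N = pred2 j j.+1] ->
  exists x, inner x x != 0 /\ forall a, (a < m)%N -> (inner (w a) x == 0) = N a.
Proof.
move=> m2 [adjw selfw detw] Ncase.
suff [x xN] : exists x, forall a, (a < m)%N -> (inner (w a) x == 0) = N a.
  exists x; split=> //.
  have [a am Na] : exists2 a, (a < m)%N & ~~ N a.
    case: Ncase => [->|[j jm ->]|[j jm ->]]; first by exists 0%N => //; lia.
      by case: j jm => [|j] jm; [exists 1%N => //; lia|exists 0%N => //; lia].
    by case: j jm => [|j] jm; [exists 2%N => //; lia|exists 0%N => //; lia].
  by apply: (@inner_neq0 _ (w a)); rewrite xN.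
have generic u v : (forall a, (a < m)%N -> ~~ N a -> (inner (w a) u != 0) || (inner (w a) v != 0)) ->
    (forall a, (a < m)%N -> N a -> inner (w a) u = 0 /\ inner (w a) v = 0) ->
    exists x, forall a, (a < m)%N -> (inner (w a) x == 0) = N a.
  move=> uv0 uvN; pose s := [seq (inner (w a) u, inner (w a) v) | a <- iota 0 m & ~~ N a].
  have [|t /allP tP] := @exists_common_nonzero s.
    apply/allP => _ /mapP[a + ->]; rewrite mem_filter mem_iota => /andP[Na am] /=.
    exact: uv0.
  exists (lin u t v) => a am; rewrite inner_lin.
  have [Na|Na] := boolP (N a); first by have [-> ->] := uvN a am Na; rewrite mulr0 addr0 eqxx.
  apply/negbTE; apply: (tP (inner (w a) u, inner (w a) v)).
  by apply/mapP; exists a => //; rewrite mem_filter Na mem_iota.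
case: Ncase => [NE|[j jm NE]|[j jm NE]].
- apply: (generic (w 0%N) (w 1%N)) => [a am _|a am]; last by rewrite NE.
  have [->|a0] := eqVneq a 0%N; first by rewrite selfw//; lia.
  have [->|a1] := eqVneq a 1%N; first by rewrite selfw ?orbT//; lia.
  rewrite adjw//; last by lia.
  by apply/orP; left; move/eqP: a0; move/eqP: a1; lia.
- have [j1|j1] := ltnP j.+1 m.
    apply: (generic (w j.+1) (cross (w j) (w j.+1))) => a am; rewrite NE /= => aj.
      have [->|aj1] := eqVneq a j.+1; first by rewrite selfw.
      by rewrite detw ?orbT.
    rewrite (eqP aj) innerC; split; last by rewrite innerC inner_crossl.
    by apply/eqP; rewrite adjw ?eqxx ?orbT//; apply/eqP; lia.
  case: j jm NE j1 => [|j] jm NE j1; first by lia.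
  apply: (generic (w j) (cross (w j) (w j.+1))) => a am; rewrite NE /= => aj.
    have [->|aj1] := eqVneq a j; first by rewrite selfw//; lia.
    by rewrite detw ?orbT.
  rewrite (eqP aj) innerC; split; last by rewrite innerC inner_crossr.
  by apply/eqP; rewrite adjw ?eqxx ?orbT//; [lia|apply/eqP; lia].
- exists (cross (w j) (w j.+1)) => a am; rewrite NE /=.
  have [->|aj] := eqVneq a j; first by rewrite innerC inner_crossl eqxx.
  have [->|aj1] := eqVneq a j.+1; first by rewrite innerC inner_crossr eqxx.
  by apply/negbTE; exact: detw.
Qed.

End GenericVectors.

(** * Complements of near paths with at least seven vertices *)

Section LargeComplement.
Variable R : realType.
Variable n : nat.
Variable G : graph n.

Lemma q_le_n : (q R G <= n)%N.
Proof.
have := @q_three_closed R n G [::] isT isT; rewrite addn0; apply.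
by move=> Kk i j; rewrite in_nil.
Qed.

(** The squares of the core vectors are a basis of the symmetric forms on the space; these
    are the coordinates of S in that basis, times the common denominator 48. *)
Definition core_coef (S : nat -> nat -> R) : seq R :=
  let xx := S 0%N 0%N in let yy := S 1%N 1%N in let zz := S 2%N 2%N in
  let xy := S 0%N 1%N in let xz := S 0%N 2%N in let yz := S 1%N 2%N in
  [:: 48 * xx - 30 * zz + 60 * xy - 18 * xz + 24 * yz;
      48 * yy - 42 * zz - 12 * xy + 42 * xz + 24 * yz;
      12 * zz - 56 * xy + 36 * xz - 32 * yz;
      12 * zz - 24 * xy - 12 * xz;
      3 * zz + 2 * xy - 3 * xz - 4 * yz;
      3 * zz + 18 * xy - 3 * xz + 12 * yz].

Definition core_weight : seq R := [:: 6; 2; 4; 4; 1; 1].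

Lemma core_coefP S k l : (forall k l, S k l = S l k) -> (k < 3)%N -> (l < 3)%N ->
  \sum_(a < 6) (core_coef S)`_a * (coordinate (nth (0, 0, 0) core a) k * coordinate (nth (0, 0, 0) core a) l)%:~R
  = 48 * S k l.
Proof.
move=> symS; rewrite !big_ord_recr big_ord0 /=.
by case: k => [|[|[|k]]] //; case: l => [|[|[|l]]] // _ _;
  rewrite /coordinate /= ?(symS 1%N 0%N) ?(symS 2%N 0%N) ?(symS 2%N 1%N); ring.
Qed.

(** The identity is a combination of the squares of the core vectors with positive
    coefficients, so it stays one after a small perturbation of the form. *)
Lemma core_weightP k l : (k < 3)%N -> (l < 3)%N ->
  \sum_(a < 6) core_weight`_a * (coordinate (nth (0, 0, 0) core a) k * coordinate (nth (0, 0, 0) core a) l)%:~R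
  = 16 * (k == l)%:R.
Proof.
rewrite !big_ord_recr big_ord0 /=.
by case: k => [|[|[|k]]] //; case: l => [|[|[|l]]] // _ _; rewrite /coordinate /=; ring.
Qed.

Lemma core_weight_ge1 a : (a < 6)%N -> 1 <= core_weight`_a.
Proof. by case: a => [|[|[|[|[|[|a]]]]]] //= _; lra. Qed.

Lemma attached_pattern (w : nat -> vec) x m N :
  (forall a b, (a < m)%N -> (b < m)%N -> a != b ->
    (inner (w a) (w b) == 0) = (a.+1 == b)%N || (b.+1 == a)%N) ->
  (forall a, (a < m)%N -> (inner (w a) x == 0) = N a) ->
  forall a b, (a <= m)%N -> (b <= m)%N -> a != b ->
    (inner (if a == m then x else w a) (if b == m then x else w b) == 0) = model m N a b.
Proof.
move=> adjw xN a b am bm ab; rewrite /model.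
have [aE|am'] := eqVneq a m; have [bE|bm'] := eqVneq b m.
- by rewrite aE bE eqxx in ab.
- have bm2 : (b < m)%N by rewrite ltn_neqAle bm'.
  by rewrite aE ltnn bm2 /= innerC xN.
- have am2 : (a < m)%N by rewrite ltn_neqAle am'.
  by rewrite bE ltnn am2 /= xN.
- have bm2 : (b < m)%N by rewrite ltn_neqAle bm'.
  have am2 : (a < m)%N by rewrite ltn_neqAle am'.
  by rewrite am2 bm2 /= adjw.
Qed.

(** Let all vectors outside the core have the weight 48 e. Subtracting e times the core
    coordinates of the sum of their squares from the core weights keeps the total equal to
    16 times the identity, and the weights remain positive for small e. *)
Lemma q_compl_large N p : (6 < n)%N -> modelled G N p ->
  [\/ N = pred0, exists2 j, (j < n.-1)%N & N = pred1 j
    | exists2 j, (j.+1 < n.-1)%N & N = pred2 j j.+1] ->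
  (q R (gcompl G) <= 2)%N.
Proof.
move=> n6 Gp Ncase; set m := n.-1 in Ncase.
have nm : n = m.+1 by rewrite prednK//; lia.
have m5 : (5 < m)%N by lia.
have [w [adjw selfw detw] wcore] := exists_path_vectors m5.
have [x [x0 xN]] := attach_vector (ltnW (ltnW (ltnW m5))) (And3 adjw selfw detw) Ncase.
pose w' a := if a == m then x else w a.
pose S k l : R := \sum_(6 <= a < n) (coordinate (w' a) k * coordinate (w' a) l)%:~R.
have symS k l : S k l = S l k by apply: eq_bigr => a _; rewrite mulrC.
pose T := \sum_(a < 6) `|(core_coef S)`_a|.
have T0 : 0 <= T by apply: sumr_ge0.
pose e : R := (1 + T)^-1.
have e0 : 0 < e by rewrite invr_gt0; lra.
pose c (a : nat) : R := if (a < 6)%N then core_weight`_a - e * (core_coef S)`_a else 48 * e.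
have cpos a : 0 < c a.
  rewrite /c; case: ifP => a6; last by lra.
  have aT : `|(core_coef S)`_a| <= T by rewrite /T (bigD1 (Ordinal a6))//= lerDl sumr_ge0.
  have : 1 <= core_weight`_a :> R by exact: core_weight_ge1.
  have : e * (core_coef S)`_a < 1.
    apply: (@le_lt_trans _ _ (e * T)).
      by rewrite ler_pM2l//; apply: le_trans aT; exact: ler_norm.
    rewrite /e mulrC ltr_pdivrMr; lra.
  lra.
have w'core a : (a < 6)%N -> w' a = nth (0, 0, 0) core a.
  by move=> a6; rewrite /w' (_ : (a == m) = false) ?wcore//; apply/eqP; lia.
have [||||||A SA EA] := @frame_spectrum R n G N p Gp w' c 16 0 1%:M 0.
- by move=> a _; exact: cpos.
- move=> a b an bn ab; apply: (attached_pattern adjw xN _ _ ab); lia.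
- by rewrite mulmx1.
- by rewrite trmx1.
- by rewrite mulmx1.
- move=> k l; rewrite mul0r addr0 !mxE.
  rewrite -(big_mkord xpredT (fun a => c a * (coordinate (w' a) k * coordinate (w' a) l)%:~R)) (@big_cat_nat _ _ _ 6)//=; last by lia.
  have -> : \sum_(6 <= a < n) c a * (coordinate (w' a) k * coordinate (w' a) l)%:~R = 48 * e * S k l.
    rewrite /S mulr_sumr [LHS]big_nat [RHS]big_nat; apply: eq_bigr => a /andP[a6 _].
    by rewrite /c ltnNge a6.
  rewrite big_mkord.
  transitivity (16 * (k == l :> nat)%:R - e * (48 * S k l) + 48 * e * S k l :> R); last first.
    by rewrite -mulr_natr; ring.
  rewrite -(core_weightP (ltn_ord k) (ltn_ord l)) -(core_coefP symS (ltn_ord k) (ltn_ord l)).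
  rewrite [e * \sum__ _]mulr_sumr -sumrB; congr (_ + _); apply: eq_bigr => a _.
  by rewrite /c ltn_ord w'core//; ring.
apply: leq_trans (q_le_q_mx SA) _; apply: (@q_mx_le_size _ _ _ [:: 0; 16]) => y /EA.
by rewrite mul0r addr0 !inE orbb.
Qed.

Lemma model_connected N p (v : 'I_n) : modelled G N p -> p v = n.-1 :> nat -> connected G (~: [set v]).
Proof.
move=> [ip GE] pv.
have bij : bijective p by exact: injF_bij.
have [f pf fp] := bij.
have low i : i \in ~: [set v] -> (p i < n.-1)%N.
  rewrite !inE => iv; have := ltn_ord (p i); have : p i != p v by rewrite (inj_eq ip).
  rewrite -val_eqE /= pv; lia.
suff H k : forall i j, i \in ~: [set v] -> j \in ~: [set v] -> (p j = p i + k :> nat)%N ->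
    connect (within G (~: [set v])) i j.
  move=> i j iK jK; have [ij|/ltnW ji] := leqP (p i) (p j).
    by apply: (H (p j - p i)%N) => //; rewrite subnKC.
  by rewrite withinC; apply: (H (p i - p j)%N) => //; rewrite subnKC.
elim: k => [|k IH] i j iK jK pij.
  by rewrite (_ : i = j) ?connect0//; apply/ip/val_inj; rewrite /= pij addn0.
have jl := low j jK.
have hn : (p i + k < n)%N by have := ltn_ord (p j); lia.
pose j' := f (Ordinal hn); have pj' : p j' = (p i + k)%N :> nat by rewrite fp.
have j'K : j' \in ~: [set v].
  by rewrite !inE; apply/negP => /eqP j'v; move: pv; rewrite -j'v pj'; lia.
apply: connect_trans (IH i j' iK j'K pj') (connect1 _).
by rewrite /within j'K jK GE /model low// jl /= pj' pij addnS eqxx.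
Qed.

(** If z is isolated, the Laplacian has nullity two. If z hangs from an inner vertex of the
    path, this vertex cuts off three parts. If z has two neighbours, G - z is connected and
    good. *)
Lemma q_modelled_lt N p : (1 < n)%N -> modelled G N p ->
  [\/ N = pred0, exists2 j, (0 < j)%N && (j.+1 < n.-1)%N & N = pred1 j
    | exists2 j, (j.+1 < n.-1)%N & N = pred2 j j.+1] ->
  (q R G + 1 <= n)%N.
Proof.
move=> n1 Gp; have [ip GE] := Gp.
have [f pf fp] : bijective p by exact: injF_bij.
have mn : (n.-1 < n)%N by rewrite prednK// ltnW.
pose v := f (Ordinal mn); have pv : p v = n.-1 :> nat by rewrite fp.
have cH := model_connected Gp pv.
have posv i : i != v -> (p i < n.-1)%N.
  move=> iv; have : p i != p v by rewrite (inj_eq ip).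
  by rewrite -val_eqE /= pv; have := ltn_ord (p i); lia.
case=> [NE|[j /andP[j0 jn] NE]|[j jn NE]].
- have n0 : (0 < n)%N by lia.
  pose y := f (Ordinal n0); have py : p y = 0%N :> nat by rewrite fp.
  have viso i : G v i = false.
    by rewrite GE /model pv ltnn /= NE /= andbF.
  apply: (@q_three_closed R n G [:: ([set v], v); (~: [set v], y)]) => /=.
  + rewrite !inE eqxx /= andbT; apply/negP => /eqP yv; move: pv; rewrite -yv py; lia.
  + by rewrite !andbT disjoints1 !inE negbK.
  + move=> Kk a b; rewrite !inE => /orP[]/eqP-> /=.
      by move=> /set1P->; rewrite viso.
    by rewrite !inE => _; apply: contraTneq => ->; rewrite adj_sym viso.
- have jn' : (j < n)%N by lia.
  have j1n : (j.+1 < n)%N by lia.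
  have j2n : (j.-1 < n)%N by lia.
  pose y := f (Ordinal jn'); have py : p y = j :> nat by rewrite fp.
  pose K1 := [set i | (p i < j)%N]; pose K2 := [set i | (j < p i)%N && (p i < n.-1)%N].
  apply: (@q_three_parts R n G y [:: ([set v], v); (K1, f (Ordinal j2n)); (K2, f (Ordinal j1n))]) => //=.
  + by rewrite !inE eqxx !fp /= jn ltnS leqnn; lia.
  + rewrite !andbT !disjoints1 !inE pv.
    have -> : [disjoint K1 & K2].
      by rewrite disjoints_subset; apply/fintype.subsetP => i; rewrite !inE; lia.
    by lia.
  + have neq i : i != y -> p i != j :> nat.
      by move=> iy; have : p i != p y by [rewrite (inj_eq ip)]; rewrite -val_eqE /= py.
    move=> Kk; rewrite !inE => /or3P[]/eqP-> /=; split; rewrite ?inE.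
    * by apply/eqP => yv; move: pv; rewrite -yv py; lia.
    * move=> a b /set1P-> ; rewrite GE /model pv ltnn /= NE /=.
      by move=> /andP[_ /eqP pb] /neq; rewrite pb eqxx.
    * by rewrite py ltnn.
    * move=> a b; rewrite !inE GE /model NE /= => aj + /neq bj.
      have := ltn_ord (p b); have -> : (p a < n.-1)%N by lia.
      by case: ifP => /=; lia.
    * by rewrite py ltnn.
    * move=> a b; rewrite !inE GE /model NE /= => /andP[aj an] + /neq bj.
      by rewrite an /=; case: ifP => /=; lia.
- apply: (@q_good_all R n G v).
  have jn' : (j < n)%N by lia.
  have j1n : (j.+1 < n)%N by lia.
  have notv k (kn : (k < n)%N) : (k < n.-1)%N -> f (Ordinal kn) \in ~: [set v].
    by move=> kl; rewrite !inE; apply/negP => /eqP kv; move: pv; rewrite -kv fp /=; lia.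
  apply: (good_loop R cH (notv j jn' _) (notv j.+1 j1n _)); rewrite ?GE /model ?pv ?fp ?ltnn /= ?NE /=; try lia.
  by rewrite (can_eq fp); apply/negP => /eqP/(congr1 val) /=; lia.
Qed.

End LargeComplement.

Lemma giso_modelled n (G H : graph n.+1) (r : rel nat) N p (h : nat -> nat) :
  modelled G N p -> (forall i j, H i j = r i j) ->
  all (fun a => all (fun b => (h a < n.+1)%N && (r (h a) (h b) == model n N a b) &&
    ((h a == h b) ==> (a == b))) (iota 0 n.+1)) (iota 0 n.+1) ->
  giso G H.
Proof.
move=> [ip GE] Hr /allP hP.
have hp i j : [/\ (h (p i) < n.+1)%N, r (h (p i)) (h (p j)) = model n N (p i) (p j)
    & h (p i) = h (p j) -> p i = p j].
  have /allP/(_ (p j)) := hP (p i) (etrans (mem_iota 0 n.+1 (p i)) (ltn_ord (p i))).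
  move=> /(_ (etrans (mem_iota 0 n.+1 (p j)) (ltn_ord (p j)))) /andP[/andP[lt /eqP rE] /implyP hE].
  by split=> // /eqP/hE/eqP ?; exact: val_inj.
pose f i : 'I_n.+1 := inord (h (p i)).
have fE i : f i = h (p i) :> nat by rewrite inordK//; case: (hp i i).
exists f => [|i j].
  apply: injF_bij => i j /(congr1 val) /=; rewrite !fE => hE; apply: ip.
  by case: (hp i j) => _ _; apply.
by rewrite Hr !fE GE; case: (hp i j).
Qed.

(** * Small near paths *)

Section SmallGraphs.
Variable R : realType.

(** The vectors in this lemma and in the next ones realise the required orthogonality
    pattern; the weights solve the linear equations that say that the weighted sum of the
    squares is D E + mu u^T u. *)
Lemma q_sum_3 (G : graph 3) N p : modelled G N p ->
  [\/ N = pred0, exists2 j, (j.*2 < 2)%N & N = pred1 j | exists2 j, (j.+1.*2 <= 2)%N & N = pred2 j j.+1] ->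
  (q R G + q R (gcompl G) <= 5)%N.
Proof.
move=> Gp; have q3 := q_le_n R G; have q3' := q_le_n R (gcompl G).
case=> [NE|[[|j]]// _ NE|[[|j]]// _ NE].
- have := q_modelled_lt R (isT : 1 < 3)%N Gp (Or31 _ _ NE); lia.
- suff /(q_compl_tight_frame R Gp) : frame_check 3 N
    [:: (2%N, (1, 0, 0)); (1%N, (0, 1, 0)); (1%N, (0, 1, 0))] 2 0 0 (0, 0, 0) by lia.
  by rewrite NE; vm_compute.
- have := q_modelled_lt R (isT : 1 < 3)%N Gp (Or33 _ _ (ex_intro2 _ _ 0%N isT NE)); lia.
Qed.

Lemma q_sum_4 (G : graph 4) N p : ~ giso G (path_graph 4) -> modelled G N p ->
  [\/ N = pred0, exists2 j, (j.*2 < 3)%N & N = pred1 j | exists2 j, (j.+1.*2 <= 3)%N & N = pred2 j j.+1] ->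
  (q R G + q R (gcompl G) <= 6)%N.
Proof.
move=> nP4 Gp; case=> [NE|[[|[|j]]]// _ NE|[[|j]]// _ NE].
- have := q_modelled_lt R (isT : 1 < 4)%N Gp (Or31 _ _ NE).
  suff /(q_compl_frame R Gp) : frame_check 4 N
    [:: (1%N, (1, 0, 0)); (2%N, (0, 1, 0)); (1%N, (1, 0, 0)); (2%N, (1, 1, 0))] 2 0 2 (1, 1, 0) by lia.
  by rewrite NE; vm_compute.
- case: nP4; apply: (giso_modelled (r := (fun a b => (a.+1 == b) || (b.+1 == a))%N)
    (h := (nth 0 [:: 1; 2; 3; 0])%N) Gp) => //.
  by rewrite NE; vm_compute.
- have := q_modelled_lt R (isT : 1 < 4)%N Gp (Or32 _ _ (ex_intro2 _ _ 1%N isT NE)).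
  suff /(q_compl_frame R Gp) : frame_check 4 N
    [:: (1%N, (1, 0, 0)); (3%N, (0, 1, 0)); (1%N, (1, 0, 0)); (1%N, (1, 0, 0))] 3 0 0 (0, 0, 0) by lia.
  by rewrite NE; vm_compute.
- have := q_modelled_lt R (isT : 1 < 4)%N Gp (Or33 _ _ (ex_intro2 _ _ 0%N isT NE)).
  suff /(q_compl_frame R Gp) : frame_check 4 N
    [:: (1%N, (1, 0, 0)); (1%N, (0, 1, 0)); (1%N, (1, 0, 1)); (1%N, (0, 0, 1))] 1 1 1 (1, 0, 1) by lia.
  by rewrite NE; vm_compute.
Qed.

Lemma q_sum_6 (G : graph 6) N p : modelled G N p ->
  [\/ N = pred0, exists2 j, (j.*2 < 5)%N & N = pred1 j | exists2 j, (j.+1.*2 <= 5)%N & N = pred2 j j.+1] ->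
  (q R G + q R (gcompl G) <= 8)%N.
Proof.
move=> Gp; have q6 := q_le_n R G; case=> [NE|[[|[|[|j]]]]// _ NE|[[|[|j]]]// _ NE].
- suff /(q_compl_tight_frame R Gp) : frame_check 6 N
    [:: (2%N, (1, 0, 0)); (6%N, (0, 1, 0)); (4%N, (1, 0, -1)); (2%N, (-1, 1, -1)); (1%N, (1, 1, 0));
        (1%N, (-1, -1, -2%:Z))] 10 1 0 (0, 0, 0) by lia.
  by rewrite NE; vm_compute.
- suff /(q_compl_tight_frame R Gp) : frame_check 6 N
    [:: (2%N, (0, 1, 0)); (4%N, (1, 0, -1)); (1%N, (1, -3%:Z, 1)); (2%N, (1, 1, 2)); (1%N, (1, 1, -1));
        (6%N, (1, 0, 0))] 14 1 0 (0, 0, 0) by lia.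
  by rewrite NE; vm_compute.
- have := q_modelled_lt R (isT : 1 < 6)%N Gp (Or32 _ _ (ex_intro2 _ _ 1%N isT NE)).
  suff /(q_compl_frame R Gp) : frame_check 6 N
    [:: (15%N, (1, 0, 0)); (18%N, (0, 1, 0)); (2%N, (1, 0, -1)); (4%N, (1, 1, 1)); (2%N, (1, 1, -2%:Z));
        (1%N, (-1, 0, -2%:Z))] 18 1 6 (1, 1, 0) by lia.
  by rewrite NE; vm_compute.
- have := q_modelled_lt R (isT : 1 < 6)%N Gp (Or32 _ _ (ex_intro2 _ _ 2%N isT NE)).
  suff /(q_compl_frame R Gp) : frame_check 6 N
    [:: (15%N, (1, 0, 0)); (24%N, (0, 1, 0)); (3%N, (1, 0, 2)); (2%N, (2, 1, -1)); (10%N, (1, -1, 1));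
        (6%N, (2, -2%:Z, -1))] 30 1 30 (1, -1, 0) by lia.
  by rewrite NE; vm_compute.
- have := q_modelled_lt R (isT : 1 < 6)%N Gp (Or33 _ _ (ex_intro2 _ _ 0%N isT NE)).
  suff /(q_compl_frame R Gp) : frame_check 6 N
    [:: (12%N, (1, 0, 0)); (15%N, (0, 1, 0)); (6%N, (1, 0, -1)); (1%N, (2, 1, 2)); (2%N, (1, 2, -2%:Z));
        (6%N, (0, 0, 1))] 18 1 6 (1, 1, -1) by lia.
  by rewrite NE; vm_compute.
- have := q_modelled_lt R (isT : 1 < 6)%N Gp (Or33 _ _ (ex_intro2 _ _ 1%N isT NE)).
  suff /(q_compl_frame R Gp) : frame_check 6 N
    [:: (8%N, (1, 0, 0)); (2%N, (0, 1, 0)); (9%N, (1, 0, -1)); (2%N, (-1, 1, -1)); (8%N, (1, 1, 0));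
        (1%N, (-1, 0, -1))] 10 1 2 (3, 1, -1) by lia.
  by rewrite NE; vm_compute.
Qed.

(** In two cases a pair of integral matrices as in q_two_diagonals shows that q(G^c) <= n -
    2. The tables list the first matrix, the difference of the diagonals and the null
    vectors. *)
Lemma q_sum_5 (G : graph 5) N p :
  ~ giso G (path_graph 5) -> ~ giso G T22 -> modelled G N p ->
  [\/ N = pred0, exists2 j, (j.*2 < 4)%N & N = pred1 j | exists2 j, (j.+1.*2 <= 4)%N & N = pred2 j j.+1] ->
  (q R G + q R (gcompl G) <= 7)%N.
Proof.
pose table (rows : seq (seq int)) a b := nth 0 (nth [::] rows a) b.
move=> nP5 nT Gp; case=> [NE|[[|[|j]]]// _ NE|[[|[|j]]]// _ NE].
- have := q_modelled_lt R (isT : 1 < 5)%N Gp (Or31 _ _ NE).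
  suff /(q_compl_frame R Gp) : frame_check 5 N
    [:: (6%N, (1, 0, 0)); (2%N, (0, 1, 0)); (2%N, (1, 0, 1)); (1%N, (-1, 1, 1)); (3%N, (-1, 1, -1))]
    4 1 2 (2, -1, 1) by lia.
  by rewrite NE; vm_compute.
- case: nP5; apply: (giso_modelled (r := (fun a b => (a.+1 == b) || (b.+1 == a))%N)
    (h := (nth 0 [:: 1; 2; 3; 4; 0])%N) Gp) => //.
  by rewrite NE; vm_compute.
- have := q_modelled_lt R (isT : 1 < 5)%N Gp (Or32 _ _ (ex_intro2 _ _ 1%N isT NE)).
  suff /(q_compl_completions R Gp) : completions_check 5 N
    (table [:: [:: 21; 0; -6%:Z; 3; -3%:Z]; [:: 0; 3; 0; -3%:Z; 0]; [:: -6%:Z; 0; 3; 0; -3%:Z];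
               [:: 3; -3%:Z; 0; 4; -3%:Z]; [:: -3%:Z; 0; -3%:Z; -3%:Z; 12]])
    (nth 0 [:: 36; 6; 6; 10; 18])
    (nth 0 [:: 0; 3; 1; 3; 1]) (nth 0 [:: 1; -3%:Z; 2; -3%:Z; 0])
    (nth 0 [:: 0; 1; -1; -1; 1]) (nth 0 [:: 1; -1; -2%:Z; 1; 0]) 0 1 by lia.
  by rewrite NE; vm_compute.
- have := q_modelled_lt R (isT : 1 < 5)%N Gp (Or33 _ _ (ex_intro2 _ _ 0%N isT NE)).
  suff /(q_compl_completions R Gp) : completions_check 5 N
    (table [:: [:: 1; 0; -1; -1; 0]; [:: 0; 1; 0; -1; 0]; [:: -1; 0; 2; 0; -1];
               [:: -1; -1; 0; 3; 1]; [:: 0; 0; -1; 1; 1]])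
    (nth 0 [:: 2; 2; 4; 6; 2])
    (nth 0 [:: 1; 0; 1; 0; 1]) (nth 0 [:: 1; 1; 0; 1; -1])
    (nth 0 [:: 1; 0; -1; 0; 1]) (nth 0 [:: -1; -1; 0; 1; 1]) 3 0 by lia.
  by rewrite NE; vm_compute.
- case: nT; apply: (giso_modelled
    (r := (fun a b => [|| (a.+1 == b) || (b.+1 == a), (a == 1) && (b == 3) | (a == 3) && (b == 1)])%N)
    (h := (nth 0 [:: 0; 1; 3; 4; 2])%N) Gp) => //.
  by rewrite NE; vm_compute.
Qed.

End SmallGraphs.

Local Close Scope ring_scope.

Theorem theorem5p3 (R : realType) (n : nat) (G : graph n) :
  n - 1 <= q R G ->
  ~ giso G (path_graph 4) ->
  ~ giso G (path_graph 5) ->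
  ~ giso G T22 ->
  q R G + q R (gcompl G) <= n + 2.
Proof.
move=> large nP4 nP5 nT; have q1 := q_le_n R G; have q2 := q_le_n R (gcompl G).
have [n2|n2] := leqP n 2; first by lia.
have [N [p [Gp Ncase]]] : exists N p, modelled G N p /\
    [\/ N = pred0, exists2 j, (j.*2 < n.-1)%N & N = pred1 j
      | exists2 j, (j.+1.*2 <= n.-1)%N & N = pred2 j j.+1].
  apply: model_cases; apply: (@near_path_dichotomy R); lia.
have [n6|n6] := ltnP 6 n.
  suff : (q R (gcompl G) <= 2)%N by lia.
  apply: (q_compl_large R n6 Gp).
  case: Ncase => [->|[j jn ->]|[j jn ->]]; [constructor 1|constructor 2|constructor 3] => //.
    by exists j => //; lia.
  by exists j => //; lia.
case: n => [|[|[|[|[|[|[|n]]]]]]] // in G large nP4 nP5 nT q1 q2 n2 n6 p Gp Ncase *.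
- exact: q_sum_3 Gp Ncase.
- exact: q_sum_4 Gp Ncase.
- exact: q_sum_5 Gp Ncase.
- exact: q_sum_6 Gp Ncase.
Qed.
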